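(* Let $(A_n,L_n,\mu_n)_{n\in\mathbb N\cup\{\infty\}}$ be a family of pointed quantum compact metric spaces and suppose $$\lim_{n\to\infty}\mathsf D\bigl((A_n,L_n,\mathfrak M_n,\mu_n),(A_\infty,L_\infty,\mathfrak M_\infty,\mu_\infty)\bigr)=0$$ for some choice of topography $\mathfrak M_n$ of $(A_n,L_n)$ for each $n\in\mathbb N\cup\{\infty\}$ (such that $(A_n,L_n,\mathfrak M_n,\mu_n)$ is a pointed proper quantum metric space). Then, for every $r\ge1$ with $r>\mathrm{qdiam}(A_\infty,L_\infty)$, $$\lim_{n\to\infty}\Lambda^{\bullet *}_{2,4r}\bigl((A_n,L_n,\mu_n),(A_\infty,L_\infty,\mu_\infty)\bigr)=0,$$ where $\Lambda^{\bullet *}_{2,4r}$ is the pointed $(2,4r)$-propinquity.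
   Context: **Basics.** For a C*-algebra $A$: $\mathrm{sa}(A)$ is its self-adjoint part, $S(A)$ its state space, $Q(A)$ the set of positive linear functionals of norm at most $1$; $\mathfrak uA=A$ if $A$ is unital and otherwise $\mathfrak uA=A\oplus\mathbb C$ is the minimal unitization; $1_A$ is the unit of $\mathfrak uA$. $\Re(a)=\frac{a+a^*}2$, $\Im(a)=\frac{a-a^*}{2i}$. An element $h\in\mathrm{sa}(A)$ is strictly positive when $\varphi(h)>0$ for all $\varphi\in S(A)$. A seminorm $L$ on a subspace $\mathrm{dom}(L)\subseteq A$ is hermitian when $a\in\mathrm{dom}(L)$ implies $a^*\in\mathrm{dom}(L)$ and $L(a^* )=L(a)$; then $\mathrm{dom}_{sa}(L)=\mathrm{dom}(L)\cap\mathrm{sa}(A)$. It is a norm modulo constants when it is a norm if $A$ has no unit, and $\{a:L(a)=0\}=\mathbb C1_A$ if $A$ is unital. It is Leibniz when $\mathrm{dom}(L)$ is a subalgebra and $L(ab)\le\|a\|L(b)+L(a)\|b\|$. For $M\ge1$, $\|a\|_{L,M}=\max\{\frac1M\|a\|_A,L(a)\}$. For positive linear functionals $\varphi,\psi$, $\mathsf{bl}_{L,M}(\varphi,\psi)=\sup\{|\varphi(a)-\psi(a)|:a\in\mathrm{dom}_{sa}(L),\|a\|_{L,M}\le1\}$, and $\mathsf{bl}_L=\mathsf{bl}_{L,1}$. For states, $\mathsf{mk}_L(\varphi,\psi)=\sup\{|\varphi(a)-\psi(a)|:a\in\mathrm{dom}_{sa}(L),L(a)\le1\}\in[0,\infty]$,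 and $\mathrm{qdiam}(A,L)=\sup_{\varphi,\psi\in S(A)}\mathsf{mk}_L(\varphi,\psi)$. **Quantum compact metric spaces and propinquity.** A $(C,D)$-Leibniz quantum compact metric space $(A,L)$ is a unital C*-algebra $A$ with a hermitian norm modulo constants $L$ on a dense *-subalgebra such that $\{a\in\mathrm{dom}_{sa}(L):L(a)\le1\}$ is norm closed, $\mathsf{mk}_L$ metrizes the weak* topology of $S(A)$, and $\max\{L(\Re(ab)),L(\Im(ab))\}\le C(L(a)\|b\|+\|a\|L(b))+D\,L(a)L(b)$ for $a,b\in\mathrm{dom}_{sa}(L)$. A quantum compact metric space without qualifier has $L$ Leibniz on $\mathrm{dom}(L)$; it is pointed, $(A,L,\mu)$, when a state $\mu$ is chosen. A quantum isometry $\pi:(D,L_D)\to(A,L_A)$ of such spaces is a *-epimorphism with $L_A(a)=\inf\{L_D(d):d\in\mathrm{dom}_{sa}(L_D),\pi(d)=a\}$ for $a\in\mathrm{dom}_{sa}(L_A)$. A compact $(C,D)$-tunnel $(E,L_E,\pi,\rho)$ from $(A,L_A)$ to $(B,L_B)$ is a $(C,D)$-Leibniz quantum compact metric space $(E,L_E)$ with quantum isometries $\pi$ onto $(A,L_A)$, $\rho$ onto $(B,L_B)$; its pointed extent for $\mu_A,\mu_B$ is the maximum of the Hausdorff distances, for $\mathsf{mk}_{L_E}$, between $S(E)$ and $\pi^*(S(A))$ and between $S(E)$ and $\rho^*(S(B))$, and of $\mathsf{mk}_{L_E}(\mu_A\circ\pi,\mu_B\circ\rho)$. The pointed $(C,D)$-propinquity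 $\Lambda^{\bullet *}_{C,D}$ is the infimum of the pointed extents of compact $(C,D)$-tunnels. **Locally compact spaces.** A separable quantum locally compact metric space (sqlcms) $(A,L)$ is a separable C*-algebra $A$ with a Leibniz hermitian norm modulo constants $L$ on a dense *-subalgebra $\mathrm{dom}(L)$ of $A$ such that: (i) $\mathsf{bl}_L$ induces the weak* topology on $S(A)$; (ii) $\{a\in\mathrm{dom}_{sa}(L):L(a)\le1\}$ is norm closed in $\mathrm{sa}(A)$; (iii) there are a strictly positive $h\in\mathrm{sa}(A)$ and $\mu\in S(A)$ with $\mu(h)=1$ such that $\{hah\in\mathfrak uA:a=b+t1_A,\ t\in\mathbb R,\ b\in\mathrm{dom}_{sa}(L),\ L(b)\le1,\ \mu(b)=-t\}$ is bounded. A pin of $(A,L)$ is a state $\mu$ such that $\{\varphi\in S(A):\mathsf{mk}_L(\varphi,\mu)<\infty\}$ is weak* dense in $S(A)$; then $(A,L,\mu)$ is called pinned. An $L$-Lipschitz $\mu$-pinned exhaustive sequence is a sequence $(h_n)$ in $\mathrm{dom}_{sa}(L)$ with $L(h_n)\to0$, $\mu(h_n)\to1$, $\|h_n\|_A\to1$. A topography of $(A,L)$ is an Abelian C*-subalgebra $\mathfrak M$ of $A$ containing some $h\in\mathrm{dom}(L)$ strictly positive in $A$ such that $\{hah\in\mathfrak uA:a=b+t1_A,\ t\in\mathbb R,\ b\in\mathrm{dom}_{sa}(L),\ L(b)\le1,\ \mu(b)=-t\}$ is bounded for some state $\mu$ of $A$ restricting to a character of $\mathfrak M$; $(A,L,\mathfrak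 M)$ is then a topographic sqlcms. A pointed proper quantum metric space $(A,L,\mathfrak M,\mu)$ is a pinned sqlcms $(A,L,\mu)$ with a topography $\mathfrak M$ such that $\mu$ restricts to a character of $\mathfrak M$ and there is an $L$-Lipschitz $\mu$-pinned exhaustive sequence contained in $\mathfrak M$. **Isometries.** A quantum $M$-isometry $\pi:(D,L_D)\to(A,L_A)$ between sqlcms is a surjective *-morphism, proper (mapping an approximate unit to an approximate unit), with $\pi(\mathrm{dom}(L_D))=\mathrm{dom}(L_A)$, $\|a\|_{L_A,M}=\inf\{\|d\|_{L_D,M}:d\in\mathrm{dom}_{sa}(L_D),\pi(d)=a\}$ for all $a\in\mathrm{dom}_{sa}(L_A)$, and $L_A(\pi(d))\le L_D(d)$ for all $d\in\mathrm{dom}_{sa}(L_D)$. It is topographic from $(D,L_D,\mathfrak M_D)$ to $(A,L_A,\mathfrak M_A)$ when $\pi(\mathfrak M_D)\subseteq\mathfrak M_A$ and for all $a\in\mathrm{dom}_{sa}(L_A)\cap\mathfrak M_A$, $\varepsilon>0$ there is $d\in\mathfrak M_D\cap\mathrm{dom}_{sa}(L_D)$ with $\pi(d)=a$, $\|d\|_D\le e^\varepsilon\|a\|_A$, $L_D(d)\le e^{\varepsilon}L_A(a)$. **Tunnels.** An $M$-tunnel $\tau=(D,L_D,\mathfrak M_D,\pi_A,\pi_B,e)$ from $(A,L_A,\mathfrak M_A,\mu_A)$ to $(B,L_B,\mathfrak M_B,\mu_B)$ consists of a topographic sqlcms $(D,L_D,\mathfrak M_D)$, an element $e\in\mathrm{dom}_{sa}(L_D)\cap\mathfrak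 M_D$, and topographic quantum $M$-isometries $\pi_A:(D,L_D,\mathfrak M_D)\to(A,L_A,\mathfrak M_A)$, $\pi_B:(D,L_D,\mathfrak M_D)\to(B,L_B,\mathfrak M_B)$, such that $\mu_A\circ\pi_A$ is a pin of $(D,L_D)$. Write $eQ(D)e=\{\varphi(e\cdot e):\varphi\in Q(D)\}$, $\pi^*(\varphi)=\varphi\circ\pi$, and $X\subseteq_\varepsilon^{d}Y$ when every $x\in X$ satisfies $\inf_{y\in Y}d(x,y)\le\varepsilon$. The extent $\chi(\tau)$ is the maximum of: $\inf\{\varepsilon>0:eQ(D)e\subseteq_\varepsilon^{\mathsf{bl}_{L_D,M}}\pi_A^*(Q(A))\text{ and }eQ(D)e\subseteq_\varepsilon^{\mathsf{bl}_{L_D,M}}\pi_B^*(Q(B))\}$; $\mathsf{mk}_{L_D}(\mu_A\circ\pi_A,\mu_B\circ\pi_B)$; and $\max\{2M L_D(e),|1-\mu_A(\pi_A(e))|,|1-\mu_B(\pi_B(e))|\}$. The $M$-local quantum metametric is $\eth_M(\mathbb A,\mathbb B)=\inf\{\chi(\tau):\tau\text{ an }M\text{-tunnel from }\mathbb A\text{ to }\mathbb B\}$. **Quantum metametric.** With $e^{-\infty}=0$ and $\sup\emptyset=0$, $$\mathsf D(\mathbb A,\mathbb B)=\max\Bigl\{\inf\bigl\{\varepsilon>0:\sup_{r\in[1,1/\varepsilon]}\eth_r(\mathbb A,\mathbb B)<\varepsilon\bigr\},\ \bigl|e^{-\mathrm{qdiam}(A,L_A)}-e^{-\mathrm{qdiam}(B,L_B)}\bigr|\Bigr\}.$$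 *)

(* Defs.v *)
From HB Require Import structures.
From mathcomp Require Import all_boot all_order all_algebra.
From mathcomp Require Import all_classical all_reals all_analysis.
From mathcomp Require Import complex.

Set Implicit Arguments.
Unset Strict Implicit.
Unset Printing Implicit Defensive.

Import Order.TTheory GRing.Theory Num.Theory.
Import numFieldNormedType.Exports.

Local Open Scope classical_set_scope.
Local Open Scope ring_scope.
Local Open Scope complex_scope.

(* Not necessarily unital complex C*-algebras. The norm of a normed module over
   R[i] takes its values in R[i]; it is always a nonnegative real there. *)
HB.mixin Record CompleteNormedModule_isCStar (R : realType) (A : Type)
    of CompleteNormedModule R[i] A := {
  cmul : A -> A -> A ;
  star : A -> A ;
  cmulA : associative cmul ;
  cmulDl : left_distributive cmul +%R ;
  cmulDr : right_distributive cmul +%R ;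
  cmulZl : forall (c : R[i]) (a b : A), cmul (c *: a) b = c *: cmul a b ;
  cmulZr : forall (c : R[i]) (a b : A), cmul a (c *: b) = c *: cmul a b ;
  starK : involutive star ;
  starD : {morph star : a b / a + b} ;
  starZ : forall (c : R[i]) (a : A), star (c *: a) = (c^*)%C *: star a ;
  starM : forall a b : A, star (cmul a b) = cmul (star b) (star a) ;
  cnormM_le : forall a b : A, `|cmul a b| <= `|a| * `|b| ;
  cstar_norm : forall a : A, `|cmul (star a) a| = `|a| ^+ 2
}.

#[short(type="cstarAlgType")]
HB.structure Definition CStarAlgebra (R : realType) :=
  { A of CompleteNormedModule_isCStar R A & CompleteNormedModule R[i] A }.

Declare Scope cstar_scope.
Delimit Scope cstar_scope with cstar.
Notation "a ** b" := (cmul a b)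
  (at level 40, left associativity) : cstar_scope.
Local Open Scope cstar_scope.

(* The R-valued norm, for elements of a C*-algebra as well as for scalars. *)
Definition rnorm (R : realType) (V : normedZmodType R[i]) (x : V) : R :=
  complex.Re `|x|.

(* Suprema of sets of nonnegative quantities, with sup of the empty set 0. *)
Definition nnsup (R : realType) (S : set \bar R) : \bar R :=
  ereal_sup (0%E |` S).

Section Algebra.
Variables (R : realType) (A : cstarAlgType R).
Implicit Types (a b u : A) (S : set A).

Definition is_unit u := forall a, u ** a = a /\ a ** u = a.
Definition unital := exists u, is_unit u.
Definition sa : set A := [set a | star a = a].
Definition positive_elt a := exists b, a = star b ** b.
Definition Repart a : A := (2%:R : R[i])^-1 *: (a + star a).
Definition Impart a : A := (2%:R * ('i : R[i]))^-1 *: (a - star a).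

Definition star_subalgebra S :=
  [/\ S 0, (forall a b, S a -> S b -> S (a + b)),
      (forall (c : R[i]) a, S a -> S (c *: a)),
      (forall a b, S a -> S b -> S (a ** b)) &
      (forall a, S a -> S (star a))].
Definition abelian_cstar_subalgebra S :=
  [/\ star_subalgebra S, closed S & forall a b, S a -> S b -> a ** b = b ** a].

Definition separable_cstar :=
  exists S : set A, countable S /\ dense S.

(* The net of the approximate unit is given by a proper filter F on I. *)
Definition approximate_unit (I : Type) (F : set_system I) (e : I -> A) :=
  (forall i, positive_elt (e i) /\ rnorm (e i) <= 1) /\
  (forall a, (e i ** a @[i --> F] --> a) /\ (a ** e i @[i --> F] --> a)).

Definition positive_functional (phi : A -> R[i]) :=
  scalar phi /\ forall a, 0 <= phi (star a ** a).
Definition functional_norm (phi : A -> R[i]) : \bar R :=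
  ereal_sup [set (rnorm (phi a))%:E | a in [set a : A | rnorm a <= 1]].
Definition states : set (A -> R[i]) :=
  [set phi | positive_functional phi /\ functional_norm phi = 1%E].
Definition quasi_states : set (A -> R[i]) :=
  [set phi | positive_functional phi /\ (functional_norm phi <= 1)%E].

Definition strictly_positive a := sa a /\ forall phi, states phi -> 0 < phi a.

Definition restricts_to_character (phi : A -> R[i]) S :=
  (forall a b, S a -> S b -> phi (a ** b) = phi a * phi b) /\
  (exists2 a, S a & phi a != 0).

(* The distance d induces on the state space the relative weak* topology, which
   is that of pointwise convergence. *)
Definition induces_weakstar (d : (A -> R[i]) -> (A -> R[i]) -> \bar R) :=
  forall phi, states phi -> forall U : set (A -> R[i]),
    within states (nbhs (phi : {ptws A -> R[i]^o})) U <->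
    exists2 eps : R, 0 < eps &
      forall psi, states psi -> (d phi psi < eps%:E)%E -> U psi.

Definition weakstar_dense_in_states (T : set (A -> R[i])) :=
  states `<=` closure (T : set {ptws A -> R[i]^o}).

End Algebra.

Arguments states {R} A.
Arguments quasi_states {R} A.
Arguments sa {R} A.
Arguments unital {R} A.
Arguments separable_cstar {R} A.

(* The values of a seminorm outside its domain carry no meaning. *)
Record seminorm (R : realType) (A : cstarAlgType R) := Seminorm {
  sn_dom : set A ;
  sn_val :> A -> R ;
  sn_dom0 : sn_dom 0 ;
  sn_domD : forall a b, sn_dom a -> sn_dom b -> sn_dom (a + b) ;
  sn_domZ : forall (c : R[i]) a, sn_dom a -> sn_dom (c *: a) ;
  sn_ge0 : forall a, sn_dom a -> 0 <= sn_val a ;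
  snD : forall a b, sn_dom a -> sn_dom b -> sn_val (a + b) <= sn_val a + sn_val b ;
  snZ : forall (c : R[i]) a, sn_dom a -> sn_val (c *: a) = rnorm c * sn_val a
}.

Section Seminorms.
Variables (R : realType) (A : cstarAlgType R) (L : seminorm A).
Implicit Types (phi psi mu : A -> R[i]) (a b h : A).

Definition dom_sa : set A := sn_dom L `&` sa A.

Definition hermitian_sn :=
  forall a, sn_dom L a -> sn_dom L (star a) /\ L (star a) = L a.

Definition norm_mod_constants :=
  (~ unital A -> forall a, sn_dom L a -> L a = 0 -> a = 0) /\
  (forall u : A, is_unit u ->
     [set a | sn_dom L a /\ L a = 0] = [set c *: u | c in [set: R[i]]]).

Definition leibniz :=
  forall a b, sn_dom L a -> sn_dom L b ->
    sn_dom L (a ** b) /\ L (a ** b) <= rnorm a * L b + L a * rnorm b.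

Definition CD_leibniz (C D : R) :=
  forall a b, dom_sa a -> dom_sa b ->
    Num.max (L (Repart (a ** b))) (L (Impart (a ** b)))
      <= C * (L a * rnorm b + rnorm a * L b) + D * L a * L b.

Definition normLM (M : R) a : R := Num.max (M^-1 * rnorm a) (L a).

Definition blM (M : R) phi psi : \bar R :=
  nnsup [set (rnorm (phi a - psi a))%:E
       | a in [set a | dom_sa a /\ normLM M a <= 1]].
Definition bl := blM 1.

Definition mk phi psi : \bar R :=
  nnsup [set (rnorm (phi a - psi a))%:E | a in [set a | dom_sa a /\ L a <= 1]].

Definition qdiam : \bar R :=
  nnsup [set x | exists phi psi, [/\ states A phi, states A psi & x = mk phi psi]].

(* The part of the definition of a Lipschitz seminorm shared by the compact and
   the locally compact cases. *)
Definition lipschitz_seminorm :=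
  [/\ hermitian_sn, norm_mod_constants, dense (sn_dom L),
      star_subalgebra (sn_dom L) & closed [set a | dom_sa a /\ L a <= 1]].

Definition metric_compact :=
  [/\ unital A, lipschitz_seminorm,
      (forall phi psi, states A phi -> states A psi -> (mk phi psi < +oo)%E) &
      induces_weakstar mk].
Definition CD_qcms (C D : R) := metric_compact /\ CD_leibniz C D.
Definition qcms := metric_compact /\ leibniz.

(* {hah : a = b + t1, t real, b in dom_sa(L), L(b) <= 1, mu(b) = -t}. As A is an
   ideal of its unitization (or A is unital), h(b + t1)h = hbh + t h^2 in A. *)
Definition pinned_ball mu h : set A :=
  [set x | exists (b : A) (t : R),
     [/\ dom_sa b, L b <= 1, mu b = - (t%:C) &
         x = h ** b ** h + (t%:C) *: (h ** h)]].

Definition sqlcms :=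
  [/\ separable_cstar A, lipschitz_seminorm, leibniz, induces_weakstar bl &
      exists (h : A) mu, [/\ strictly_positive h, states A mu, mu h = 1 &
                             bounded_set (pinned_ball mu h)]].

Definition pin mu :=
  states A mu /\
  weakstar_dense_in_states [set phi | states A phi /\ (mk phi mu < +oo)%E].

Definition exhaustive_sequence mu (h : nat -> A) :=
  [/\ (forall n, dom_sa (h n)), L (h n) @[n --> \oo] --> (0 : R),
      (mu (h n) : R[i]^o) @[n --> \oo] --> (1 : R[i]^o) &
      rnorm (h n) @[n --> \oo] --> (1 : R)].

Definition topography (MM : set A) :=
  abelian_cstar_subalgebra MM /\
  exists (h : A) mu,
    [/\ MM h /\ sn_dom L h, strictly_positive h,
        states A mu, restricts_to_character mu MM &
        bounded_set (pinned_ball mu h)].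

Definition topographic_sqlcms (MM : set A) := sqlcms /\ topography MM.

Definition pointed_proper (MM : set A) mu :=
  [/\ sqlcms, pin mu, topography MM, restricts_to_character mu MM &
      exists h : nat -> A, (forall n, MM (h n)) /\ exhaustive_sequence mu h].

End Seminorms.

Definition almost_subset (R : realType) (T : Type) (d : T -> T -> \bar R)
    (eps : R) (X Y : set T) :=
  forall x, X x -> (ereal_inf [set d x y | y in Y] <= eps%:E)%E.

Definition hausdorff_distance (R : realType) (T : Type) (d : T -> T -> \bar R)
    (X Y : set T) : \bar R :=
  Order.max (nnsup [set ereal_inf [set d x y | y in Y] | x in X])
            (nnsup [set ereal_inf [set d x y | x in X] | y in Y]).

Section Morphisms.
Variables (R : realType) (D A : cstarAlgType R).
Variables (LD : seminorm D) (LA : seminorm A).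
Implicit Types (pi : D -> A).

Definition star_morphism pi :=
  [/\ linear pi, (forall a b, pi (a ** b) = pi a ** pi b) &
      (forall a, pi (star a) = star (pi a))].

Definition star_epimorphism pi :=
  star_morphism pi /\ forall a : A, exists d : D, pi d = a.

Definition dual pi (S : set (A -> R[i])) : set (D -> R[i]) :=
  [set phi \o pi | phi in S].

Definition quantum_isometry pi :=
  star_epimorphism pi /\
  forall a, dom_sa LA a ->
    (LA a)%:E = ereal_inf [set (LD d)%:E | d in [set d | dom_sa LD d /\ pi d = a]].

Definition proper_morphism pi :=
  exists (I : Type) (F : set_system I) (e : I -> D),
    [/\ ProperFilter F, approximate_unit F e & approximate_unit F (pi \o e)].

Definition quantum_M_isometry (M : R) pi :=
  [/\ star_epimorphism pi, proper_morphism pi, pi @` sn_dom LD = sn_dom LA,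
      (forall a, dom_sa LA a ->
        (normLM LA M a)%:E =
        ereal_inf [set (normLM LD M d)%:E | d in [set d | dom_sa LD d /\ pi d = a]]) &
      (forall d, dom_sa LD d -> LA (pi d) <= LD d)].

Definition topographic_isometry (M : R) (MD : set D) (MA : set A) pi :=
  [/\ quantum_M_isometry M pi, pi @` MD `<=` MA &
      forall a (eps : R), dom_sa LA a -> MA a -> 0 < eps ->
        exists d, [/\ MD d, dom_sa LD d, pi d = a,
                      rnorm d <= expR eps * rnorm a & LD d <= expR eps * LA a]].

End Morphisms.

Section CompactPropinquity.
Variables (R : realType) (C D : R).
Variables (A : cstarAlgType R) (LA : seminorm A) (muA : A -> R[i]).
Variables (B : cstarAlgType R) (LB : seminorm B) (muB : B -> R[i]).

Record compact_tunnel := CompactTunnel {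
  ct_alg : cstarAlgType R ;
  ct_sn : seminorm ct_alg ;
  ct_left : ct_alg -> A ;
  ct_right : ct_alg -> B ;
  ct_qcms : CD_qcms ct_sn C D ;
  ct_leftP : quantum_isometry ct_sn LA ct_left ;
  ct_rightP : quantum_isometry ct_sn LB ct_right
}.
Arguments ct_left : clear implicits.
Arguments ct_right : clear implicits.

Definition pointed_extent (t : compact_tunnel) : \bar R :=
  let d := mk (ct_sn t) in
  Order.max
    (Order.max
      (hausdorff_distance d (states (ct_alg t)) (dual (ct_left t) (states A)))
      (hausdorff_distance d (states (ct_alg t)) (dual (ct_right t) (states B))))
    (d (muA \o ct_left t) (muB \o ct_right t)).

Definition pointed_propinquity : \bar R :=
  ereal_inf [set x | exists t : compact_tunnel, x = pointed_extent t].

End CompactPropinquity.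

Section Metametric.
Variables (R : realType).
Variables (A : cstarAlgType R) (LA : seminorm A) (MA : set A) (muA : A -> R[i]).
Variables (B : cstarAlgType R) (LB : seminorm B) (MB : set B) (muB : B -> R[i]).

Record tunnel (M : R) := Tunnel {
  tn_alg : cstarAlgType R ;
  tn_sn : seminorm tn_alg ;
  tn_top : set tn_alg ;
  tn_left : tn_alg -> A ;
  tn_right : tn_alg -> B ;
  tn_elt : tn_alg ;
  tn_sqlcms : topographic_sqlcms tn_sn tn_top ;
  tn_elt_dom : dom_sa tn_sn tn_elt ;
  tn_elt_top : tn_top tn_elt ;
  tn_leftP : topographic_isometry tn_sn LA M tn_top MA tn_left ;
  tn_rightP : topographic_isometry tn_sn LB M tn_top MB tn_right ;
  tn_pin : pin tn_sn (muA \o tn_left)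
}.
Arguments tn_left [M] t _ : rename.
Arguments tn_right [M] t _ : rename.

Definition compressed_quasi_states (D : cstarAlgType R) (e : D) : set (D -> R[i]) :=
  [set (fun d => phi (e ** d ** e)) | phi in quasi_states D].

Definition extent (M : R) (t : tunnel M) : \bar R :=
  let d := blM (tn_sn t) M in
  let e := tn_elt t in
  Order.max
    (Order.max
      (ereal_inf [set eps%:E | eps in [set eps : R |
        [/\ 0 < eps,
            almost_subset d eps (compressed_quasi_states e)
              (dual (tn_left t) (quasi_states A)) &
            almost_subset d eps (compressed_quasi_states e)
              (dual (tn_right t) (quasi_states B))]]])
      (mk (tn_sn t) (muA \o tn_left t) (muB \o tn_right t)))
    (Num.max (2%:R * M * tn_sn t e)
      (Num.max (rnorm (1 - muA (tn_left t e))) (rnorm (1 - muB (tn_right t e)))))%:E.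

Definition local_metametric (M : R) : \bar R :=
  ereal_inf [set x | exists t : tunnel M, x = extent t].

Definition metametric : \bar R :=
  Order.max
    (ereal_inf [set eps%:E | eps in [set eps : R | 0 < eps /\
       (nnsup [set local_metametric r | r in [set r : R | (1 <= r <= eps^-1)%R]]
         < eps%:E)%E]])
    (`| expeR (- qdiam LA) - expeR (- qdiam LB) |)%E.

End Metametric.

(* Main.v *)
Require Import Defs.
From HB Require Import structures.
From mathcomp Require Import all_boot all_order all_algebra.
From mathcomp Require Import all_classical all_reals all_analysis.
From mathcomp Require Import complex ring lra.

(* Fix the scale [r] and let [e] be the local unit of a topographic [r]-tunnel [D] of
   small extent between compact spaces [A] and [B]. On the direct sum of [A] and
   [B] consider the seminorm that is at most [l] on [(a, b)] when [LA a <= l],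
   [LB b <= l] and, for some [d] in [D] with [LD d <= l], [|d| <= r l] and some
   scalar [t], both [a - t - piA d] and [b - t - piB d] have norm at most [eta l].
   The error [eta] makes the last condition norm-continuous, so that no closure or
   quotient is needed, and the product of two such decompositions costs the Leibniz
   constants [(2, 4 r)]. An element [a] lifts because [a - muA a] has norm at most
   [qdiam * LA a <= r LA a], so that the [r]-isometry [piA] provides [d].
   A state of [B] pulls back to [D]; compressing it by [e] changes it little since
   [piB e] is almost constant and almost [1], and the extent of the tunnel then
   provides a quasi-state of [A] nearby, whose mass is almost [1]. *)

Set Implicit Arguments.
Unset Strict Implicit.
Unset Printing Implicit Defensive.

Import Order.TTheory GRing.Theory Num.Theory.
Import numFieldNormedType.Exports.
Local Open Scope classical_set_scope.
Local Open Scope ring_scope.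
Local Open Scope complex_scope.
Local Open Scope cstar_scope.

(** * The real-valued norm and the *-algebra operations *)

(** The algebra [D] cannot itself serve as a compact tunnel: it need not have a unit, and the extent
    controls only its quasi-states compressed by [e]. From [D] only elements with [LD d <= l] and
    [|d| <= r l] are used, because the extent compares functionals through [bl] at scale [r], which
    tests nothing larger; this norm bound is the source of the [r] in the second Leibniz constant.
    The scalar [t] restores the constants, on which the new seminorm has to vanish. Its size is not
    prescribed by the decomposition, but it can be kept below [2 |x| + r l], which is what makes
    products controllable. The passage from diameters to norms rests on states that norm
    self-adjoint elements. They are obtained without spectral theory: positivity is a norm
    inequality, square roots are fixed points of a contraction, [z^* z >= 0] follows by iterating an
    improvement of a lower bound, and Hahn-Banach supplies the states. The bound [qdiam < r] is
    needed at both ends of the tunnel; for [A n] it comes from the exponential term of the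
    metametric. *)

Lemma normr_rnorm (R : realType) (V : normedZmodType R[i]) (x : V) : `|x| = (rnorm x)%:C.
Proof. by rewrite /rnorm RRe_real ?normr_real. Qed.

Section RealNorm.
Variables (R : realType) (V : normedZmodType R[i]).
Implicit Types x y : V.

Lemma rnorm_ge0 x : 0 <= rnorm x.
Proof. by rewrite -ler0c -normr_rnorm. Qed.

Lemma rnormD x y : rnorm (x + y) <= rnorm x + rnorm y.
Proof. by rewrite -lecR rmorphD /= -!normr_rnorm ler_normD. Qed.

Lemma rnormN x : rnorm (- x) = rnorm x.
Proof. by rewrite /rnorm normrN. Qed.

Lemma rdistC x y : rnorm (x - y) = rnorm (y - x).
Proof. by rewrite /rnorm distrC. Qed.

Lemma rnormB x y : rnorm (x - y) <= rnorm x + rnorm y.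
Proof. by rewrite -(rnormN y) rnormD. Qed.

Lemma rnorm0 : rnorm (0 : V) = 0.
Proof. by rewrite /rnorm normr0. Qed.

Lemma rnorm_eq0 x : rnorm x = 0 -> x = 0.
Proof. by move=> x0; apply/eqP; rewrite -normr_eq0 normr_rnorm x0. Qed.

End RealNorm.

Section ScaledNorm.
Variables (R : realType) (V : normedModType R[i]).

Lemma rnormC (c : R) : rnorm (c%:C : R[i]) = `|c|.
Proof. by rewrite /rnorm normc_def /= expr0n addr0 sqrtr_sqr. Qed.

Lemma rnormZ (c : R[i]) (x : V) : rnorm (c *: x) = rnorm c * rnorm x.
Proof. by apply: complexI; rewrite rmorphM /= -!normr_rnorm normrZ. Qed.

Lemma rnormZC (c : R) (x : V) : rnorm (c%:C *: x) = `|c| * rnorm x.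
Proof. by rewrite rnormZ rnormC. Qed.

End ScaledNorm.

Section ScalarNorm.
Variable R : realType.
Implicit Types c d : R[i].

Lemma crnormM c d : rnorm (c * d) = rnorm c * rnorm d.
Proof. by apply: complexI; rewrite rmorphM /= -!normr_rnorm normrM. Qed.

Lemma crnormN c : rnorm (- c) = rnorm c.
Proof. by rewrite /rnorm normrN. Qed.

Lemma crnorm0 : rnorm (0 : R[i]) = 0.
Proof. by rewrite /rnorm normr0. Qed.

Lemma crnorm1 : rnorm (1 : R[i]) = 1.
Proof. by rewrite /rnorm normr1. Qed.

Lemma crnormD c d : rnorm (c + d) <= rnorm c + rnorm d.
Proof. by rewrite -lecR rmorphD /= -!normr_rnorm ler_normD. Qed.

Lemma crnorm_ge0 c : 0 <= rnorm c.
Proof. by rewrite -ler0c -normr_rnorm. Qed.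

Lemma crnormi : rnorm ('i : R[i]) = 1.
Proof. by rewrite /rnorm normc_def /= expr0n expr1n add0r sqrtr1. Qed.

Lemma ge0_complex c : 0 <= c -> c = (complex.Re c)%:C.
Proof. by move=> c0; rewrite RRe_real // ger0_real. Qed.

Lemma Re_le_rnorm c : complex.Re c <= rnorm c.
Proof.
case: c => a b; rewrite /rnorm normc_def /=.
apply: le_trans (ler_norm a) _; rewrite -sqrtr_sqr ler_wsqrtr //.
by rewrite lerDl sqr_ge0.
Qed.

End ScalarNorm.

Section CStarBasics.
Variables (R : realType) (A : cstarAlgType R).
Implicit Types a b c x y z : A.

Lemma cmul0l a : 0 ** a = 0.
Proof. by apply: (addIr (0 ** a)); rewrite -cmulDl !add0r. Qed.

Lemma cmul0r a : a ** 0 = 0.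
Proof. by apply: (addIr (a ** 0)); rewrite -cmulDr !add0r. Qed.

Lemma cmulNl a b : (- a) ** b = - (a ** b).
Proof. by apply: (addIr (a ** b)); rewrite -cmulDl !addNr cmul0l. Qed.

Lemma cmulNr a b : a ** (- b) = - (a ** b).
Proof. by apply: (addIr (a ** b)); rewrite -cmulDr !addNr cmul0r. Qed.

Lemma cmulBl a b c : (a - b) ** c = a ** c - b ** c.
Proof. by rewrite cmulDl cmulNl. Qed.

Lemma cmulBr a b c : a ** (b - c) = a ** b - a ** c.
Proof. by rewrite cmulDr cmulNr. Qed.

Lemma star0 : star (0 : A) = 0.
Proof. by apply: (addIr (star 0)); rewrite -starD !add0r. Qed.

Lemma starN a : star (- a) = - star a.
Proof. by apply: (addIr (star a)); rewrite -starD !addNr star0. Qed.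

Lemma starB a b : star (a - b) = star a - star b.
Proof. by rewrite starD starN. Qed.

Lemma starZC (k : R) a : star (k%:C *: a) = k%:C *: star a.
Proof. by rewrite starZ conjc_real. Qed.

Lemma rnormM a b : rnorm (a ** b) <= rnorm a * rnorm b.
Proof. by rewrite -lecR rmorphM /= -!normr_rnorm; exact: cnormM_le. Qed.

Lemma rnorm_cstar a : rnorm (star a ** a) = rnorm a ^+ 2.
Proof. by apply: complexI; rewrite rmorphXn /= -!normr_rnorm cstar_norm. Qed.

Lemma rnorm_star a : rnorm (star a) = rnorm a.
Proof.
suff h b : rnorm b <= rnorm (star b).
  by apply/eqP; rewrite eq_le h -{2}(starK a) h.
have [b0|b0] := leP (rnorm b) 0; first exact: le_trans b0 (rnorm_ge0 _).
by rewrite -(ler_pM2r b0) -expr2 -rnorm_cstar rnormM.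
Qed.

Lemma rnorm_cstarr a : rnorm (a ** star a) = rnorm a ^+ 2.
Proof. by rewrite -{1}(starK a) rnorm_cstar rnorm_star. Qed.

Lemma rnorm_sa2 x : sa A x -> rnorm (x ** x) = rnorm x ^+ 2.
Proof. by move=> xs; rewrite -rnorm_cstar xs. Qed.

Lemma saD x y : sa A x -> sa A y -> sa A (x + y).
Proof. by rewrite /sa /= starD => -> ->. Qed.

Lemma saN x : sa A x -> sa A (- x).
Proof. by rewrite /sa /= starN => ->. Qed.

Lemma saB x y : sa A x -> sa A y -> sa A (x - y).
Proof. by move=> xs ys; exact/saD/saN. Qed.

Lemma saZ (k : R) x : sa A x -> sa A (k%:C *: x).
Proof. by rewrite /sa /= starZC => ->. Qed.

Lemma saM x y : sa A x -> sa A y -> x ** y = y ** x -> sa A (x ** y).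
Proof. by rewrite /sa /= starM => -> -> ->. Qed.

Lemma sa_cstar x : sa A (star x ** x).
Proof. by rewrite /sa /= starM starK. Qed.

Lemma sa_sqr x : sa A x -> sa A (x ** x).
Proof. by move=> xs; exact: saM. Qed.

Lemma half2 x : (2%:R : R[i])^-1 *: (x + x) = x.
Proof. by rewrite scalerDr -scalerDl -[2%:R^-1]div1r -splitr scale1r. Qed.

Lemma ReK x : x = Repart x + 'i *: Impart x.
Proof.
rewrite /Repart /Impart scalerA.
have -> : 'i * (2%:R * 'i)^-1 = 2%:R^-1 :> R[i].
  by rewrite invfM mulrCA divff ?mulr1 // eq_complex /= oner_eq0 andbF.
by rewrite -scalerDr addrACA subrr addr0 half2.
Qed.

Lemma half_real : (2%:R : R[i])^-1 = (2^-1 : R)%:C.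
Proof. by rewrite fmorphV /= rmorph_nat. Qed.

Lemma sa_Repart x : sa A (Repart x).
Proof. by rewrite /Repart half_real; apply: saZ; rewrite /sa /= starD starK addrC. Qed.

Lemma Impart_Repart x : Impart x = Repart ((- 'i : R[i]) *: x).
Proof.
rewrite /Impart /Repart starZ.
have -> : ((- 'i : R[i])^*)%C = 'i by apply/eqP; rewrite eq_complex /= oppr0 opprK !eqxx.
have -> : - 'i *: x + 'i *: star x = (- 'i) *: (x - star x).
  by rewrite scalerBr !scaleNr opprK.
rewrite scalerA; congr (_ *: _).
rewrite invfM; congr (_ * _); apply: (@mulfI _ 'i); first by rewrite eq_complex /= oner_eq0 andbF.
rewrite divff ?mulrN -?expr2 ?sqr_i ?opprK // eq_complex /= oner_eq0 andbF//.
Qed.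

Lemma sa_Impart x : sa A (Impart x).
Proof. by rewrite Impart_Repart; exact: sa_Repart. Qed.

Lemma Repart_sa x : sa A x -> Repart x = x.
Proof.
by rewrite /Repart /sa /= => ->; exact: half2.
Qed.

Lemma rnorm_Repart x : rnorm (Repart x) <= rnorm x.
Proof.
rewrite /Repart half_real rnormZC ger0_norm ?invr_ge0 ?ler0n //.
have := rnormD x (star x); rewrite rnorm_star; lra.
Qed.

End CStarBasics.

(** * Limits in the real-valued norm, and square roots *)

Lemma rball (R : realType) (V : normedModType R[i]) (x y : V) (e : R) :
  rnorm (x - y) < e -> ball x e%:C y.
Proof. by move=> h; rewrite -ball_normE /ball_ /=; move: h; rewrite -ltcR -normr_rnorm. Qed.

Lemma rballP (R : realType) (V : normedModType R[i]) (x y : V) (e : R) :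
  ball x e%:C y -> rnorm (x - y) < e.
Proof. by rewrite -ball_normE /ball_ /= => h; rewrite -ltcR -normr_rnorm. Qed.

Lemma gt0_complex (R : realType) (c : R[i]) :
  0 < c -> exists2 e : R, 0 < e & c = e%:C.
Proof.
move=> c0; exists (complex.Re c); last by apply/ge0_complex/ltW.
by rewrite -ltcR -ge0_complex // ltW.
Qed.

Lemma rnorm_small0 (R : realType) (V : normedModType R[i]) (x : V) (k : R) :
  (forall e, 0 < e -> rnorm x <= k * e) -> x = 0.
Proof.
move=> h; apply: rnorm_eq0; apply/eqP; rewrite eq_le rnorm_ge0 andbT.
apply/ler_addgt0Pr => e e0; rewrite add0r.
have k1 : 0 < `|k| + 1 by apply: ltr_wpDl.
apply: le_trans (h _ (divr_gt0 e0 k1)) _.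
rewrite mulrCA ger_pMr // ler_pdivrMr // mul1r.
by rewrite (le_trans (ler_norm k)) // lerDl.
Qed.

(** The tails are dominated by a geometric series, so that the sequence is Cauchy; the limit is
    handed over as an inequality in [rnorm], free of filters. *)
Lemma geometric_increments_cvg (R : realType) (V : completeNormedModType R[i])
    (v : nat -> V) (q c : R) :
  0 <= q < 1 -> (forall n, rnorm (v n.+1 - v n) <= c * q ^+ n) ->
  exists l, forall e, 0 < e ->
    exists n, forall m, (n <= m)%N -> rnorm (v m - l) < e.
Proof.
move=> /andP[q0 q1] hv.
have c0 : 0 <= c by have := hv 0%N; rewrite expr0 mulr1; apply/le_trans/rnorm_ge0.
have q1' : 0 < 1 - q by rewrite subr_gt0.
have tail n k : rnorm (v (n + k)%N - v n) <= c * q ^+ n * ((1 - q ^+ k) / (1 - q)).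
  elim: k => [|k IH]; first by rewrite addn0 subrr rnorm0 expr0 subrr mul0r mulr0.
  rewrite addnS -(subrK (v (n + k)%N) (v (n + k).+1)) -addrA.
  apply: le_trans (rnormD _ _) _; apply: le_trans (lerD (hv _) IH) _.
  rewrite exprD exprS le_eqVlt; apply/orP; left; apply/eqP; field.
  by rewrite subr_eq0 eq_sym lt_eqF.
have tail' n m : (n <= m)%N -> rnorm (v m - v n) <= c / (1 - q) * q ^+ n.
  move=> /subnKC <-; apply: le_trans (tail _ _) _.
  rewrite [leRHS]mulrAC ler_wpM2l ?mulr_ge0 ?exprn_ge0 //.
  by rewrite ler_piMl ?invr_ge0 ?(ltW q1') // gerBl exprn_ge0.
have small e : 0 < e -> exists n, c / (1 - q) * q ^+ n < e.
  move=> e0; have K0 : 0 < c / (1 - q) + 1.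
    by rewrite ltr_wpDl // divr_ge0 // ltW.
  have : q ^+ n @[n --> \oo] --> (0 : R) by apply: cvg_expr; rewrite ger0_norm.
  move/cvgrPdist_lt => /(_ _ (divr_gt0 e0 K0))[n _ /(_ n (leqnn n))] /=.
  rewrite sub0r normrN ger0_norm ?exprn_ge0 // ltr_pdivlMr // mulrC => h.
  exists n; apply: le_lt_trans h; rewrite ler_wpM2r ?exprn_ge0 //.
  by rewrite lerDl.
have : cvg (v n @[n --> \oo]).
  apply: cauchy_cvg; apply: cauchy_exP => _ /gt0_complex[e /small[n hn] ->].
  exists (v n); exists n => // m /= nm; apply: rball; rewrite rdistC.
  exact: le_lt_trans (tail' _ _ nm) hn.
move=> /cvg_ex[l hl]; exists l => e e0.
have : nbhs l (ball l e%:C) by apply: nbhsx_ballx; rewrite -[0]/(0%:C) ltcR.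
move=> /hl[n _ h]; exists n => m nm.
by rewrite rdistC; apply: rballP; exact: h.
Qed.

Section SquareRoot.
Variables (R : realType) (A : cstarAlgType R).
Implicit Types a b c x y z w : A.

Lemma half_bound (w : A) : rnorm ((2%:R : R[i])^-1 *: w) = rnorm w / 2.
Proof. by rewrite half_real rnormZC ger0_norm ?invr_ge0 ?ler0n // mulrC. Qed.

(* [w] is [1 - sqrt (1 - z)], obtained as the fixed point of the contraction
   [w |-> (z + w^2) / 2]; no unit is needed to state the equation. *)
Lemma cstar_sqrt z : sa A z -> rnorm z < 1 ->
  exists w, [/\ sa A w, w + w - w ** w = z &
                forall c, c ** z = z ** c -> c ** w = w ** c].
Proof.
move=> zs z1.
pose f w := (2%:R : R[i])^-1 *: (z + w ** w).
pose v n := iter n f 0.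
(* [q] plays two roles: [f] preserves the ball of radius [q], as [(q + q^2) / 2 <= q], and is
   [q]-Lipschitz on it, as [2 (f w - f w') = w (w - w') + (w - w') w']. *)
pose q := rnorm z.
have q0 : 0 <= q by exact: rnorm_ge0.
have fB w w' : rnorm w <= q -> rnorm w' <= q ->
    rnorm (f w - f w') <= q * rnorm (w - w').
  move=> wq wq'; rewrite /f -scalerBr half_bound //.
  rewrite opprD addrACA subrr add0r ler_pdivrMr //.
  have -> : w ** w - w' ** w' = w ** (w - w') + (w - w') ** w'.
    by rewrite cmulBr cmulBl addrA subrK.
  apply: le_trans (rnormD _ _) _.
  apply: le_trans (lerD (rnormM _ _) (rnormM _ _)) _.
  rewrite [X in _ + X]mulrC -mulrDl mulrAC ler_wpM2r ?rnorm_ge0 //.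
  lra.
have vq n : rnorm (v n) <= q.
  elim: n => [|n IH]; first by rewrite rnorm0.
  rewrite /= /f half_bound // ler_pdivrMr //.
  apply: le_trans (rnormD _ _) _.
  have := rnormM (v n) (v n); have := rnorm_ge0 (v n).
  rewrite -/q; nra.
have [|n|l hl] := @geometric_increments_cvg R A v q q; first by rewrite q0.
  elim: n => [|n IH]; first by rewrite expr0 mulr1 subr0; exact: (vq 1%N).
  apply: (le_trans (fB _ _ (vq n.+1) (vq n))).
  by rewrite exprS mulrCA ler_wpM2l.
have lq : rnorm l <= q.
  apply/ler_addgt0Pr => e /hl[n hn]; have h := hn n (leqnn n).
  rewrite -(subrK (v n) l) addrC; apply: le_trans (rnormD _ _) _.
  by rewrite rdistC lerD // ltW.
have vs n : sa A (v n).
  elim: n => [|n IH]; first exact: star0.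
  by rewrite /= /f half_real; apply/saZ/saD/sa_sqr.
have vc c n : c ** z = z ** c -> c ** v n = v n ** c.
  move=> cz; elim: n => [|n IH]; first by rewrite cmul0l cmul0r.
  by rewrite /= /f cmulZr cmulZl cmulDr cmulDl cz cmulA IH -cmulA IH cmulA.
exists l; split.
- apply/eqP; rewrite -subr_eq0; apply/eqP; apply: (@rnorm_small0 _ _ _ 2) => e /hl[n hn]; have h := hn n (leqnn n).
  have -> : star l - l = star (l - v n) + (v n - l).
    by rewrite starB vs addrA subrK.
  apply: le_trans (rnormD _ _) _; rewrite rnorm_star rdistC; lra.
- have /eqP : l - f l = 0.
    apply: (@rnorm_small0 _ _ _ 4) => e /hl[n hn]; have h := hn n (leqnn n).
    have -> : l - f l = (l - v n) + (v n - v n.+1) + (f (v n) - f l).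
      by rewrite !addrA subrK subrK.
    have h1 := fB _ _ (vq n) lq.
    have h2 := hn n.+1 (leqnSn n).
    apply: le_trans (rnormD _ _) _; apply: le_trans (lerD (rnormD _ _) h1) _.
    have h3 : rnorm (v n - v n.+1) <= e + e.
      rewrite -(subrK l (v n)) -addrA; apply: le_trans (rnormD _ _) _.
      by rewrite (rdistC l) lerD // ltW.
    have h4 := rnorm_ge0 (v n - l).
    rewrite (rdistC l); move: z1; rewrite -/q; nra.
  rewrite subr_eq0 => /eqP lf.
  have : l + l = z + l ** l.
    by rewrite {1 2}lf /f -scalerDr half2.
  by move=> ->; rewrite addrK.
- move=> c cz; apply/eqP; rewrite -subr_eq0; apply/eqP.
  apply: (@rnorm_small0 _ _ _ (2 * rnorm c)) => e /hl[n hn]; have h := hn n (leqnn n).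
  have -> : c ** l - l ** c = c ** (l - v n) + (v n - l) ** c.
    by rewrite cmulBr cmulBl vc // addrA subrK.
  apply: le_trans (rnormD _ _) _.
  apply: le_trans (lerD (rnormM _ _) (rnormM _ _)) _.
  rewrite (rdistC l); have := rnorm_ge0 c; nra.
Qed.

End SquareRoot.

(** * The order of a unital C*-algebra *)

Section Unital.
Variables (R : realType) (A : cstarAlgType R) (u : A).
Hypothesis hu : is_unit u.
Implicit Types (a b c x y z w : A) (k m s t e d : R).

Lemma umull a : u ** a = a. Proof. by case: (hu a). Qed.
Lemma umulr a : a ** u = a. Proof. by case: (hu a). Qed.

Lemma sa_unit : sa A u.
Proof. by have := @sa_cstar _ _ u; rewrite /sa /= umulr starK. Qed.

(** The C*-identity gives [|u|^2 = |u|]; equality with 1 fails in the zero algebra. *)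
Lemma rnorm_unit_le1 : rnorm u <= 1.
Proof.
have := rnorm_sa2 sa_unit; rewrite umull expr2 => /eqP.
rewrite -subr_eq0 -[X in X - _]mulr1 -mulrBr mulf_eq0 => /orP[/eqP->//|].
by rewrite subr_eq0 => /eqP <-.
Qed.

Definition usc k : A := k%:C *: u.

Lemma uscD k m : usc (k + m) = usc k + usc m.
Proof. by rewrite /usc rmorphD scalerDl. Qed.

Lemma uscN k : usc (- k) = - usc k.
Proof. by rewrite /usc rmorphN scaleNr. Qed.

Lemma uscB k m : usc (k - m) = usc k - usc m.
Proof. by rewrite uscD uscN. Qed.

Lemma usc0 : usc 0 = 0.
Proof. by rewrite /usc scale0r. Qed.

Lemma uscZ k m : k%:C *: usc m = usc (k * m).
Proof. by rewrite /usc scalerA rmorphM. Qed.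

Lemma uscMl k a : usc k ** a = k%:C *: a.
Proof. by rewrite /usc cmulZl umull. Qed.

Lemma uscMr k a : a ** usc k = k%:C *: a.
Proof. by rewrite /usc cmulZr umulr. Qed.

Lemma sa_usc k : sa A (usc k).
Proof. exact/saZ/sa_unit. Qed.

Lemma rnorm_usc k : rnorm (usc k) <= `|k|.
Proof. by rewrite rnormZC ler_piMr ?rnorm_unit_le1. Qed.

(* [x >= 0], expressed without the spectrum. *)
Definition upos x := sa A x /\ exists2 s, 0 <= s & rnorm (usc s - x) <= s.

(** The shift by [d] makes [z = (s - x) / (s + d)] strictly shorter than 1, and
    [1 - z = (x + d) / (s + d)] is the square of [1 - w]. *)
Lemma upos_sqrt x d : upos x -> 0 < d ->
  exists y, [/\ sa A y, y ** y = x + usc d &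
                forall c, c ** x = x ** c -> c ** y = y ** c].
Proof.
move=> [xs [s s0 sx]] d0; have t0 : 0 < s + d by rewrite ltr_wpDl.
pose z : A := (s + d)^-1%:C *: (usc s - x).
have zs : sa A z by apply/saZ/saB => //; exact: sa_usc.
have z1 : rnorm z < 1.
  rewrite rnormZC ger0_norm ?invr_ge0 ?(ltW t0) // mulrC ltr_pdivrMr // mul1r.
  by apply: le_lt_trans sx _; rewrite ltrDl.
have [w [ws wz wc]] := cstar_sqrt zs z1.
exists ((Num.sqrt (s + d))%:C *: (u - w)); split.
- by apply/saZ/saB => //; exact: sa_unit.
- rewrite cmulZl cmulZr scalerA -rmorphM /= -expr2 sqr_sqrtr ?(ltW t0) //.
  rewrite cmulBl !cmulBr !umull umulr -addrA -opprD addrA.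
  rewrite wz scalerBr scalerA -rmorphM /= divff ?gt_eqF // scale1r.
  by rewrite -/(usc _) uscD opprB addrCA [usc s + _]addrC addrK.
- move=> c cx; have cz : c ** z = z ** c.
    by rewrite /z cmulZl cmulZr cmulBl cmulBr uscMl uscMr cx.
  by rewrite cmulZl cmulZr cmulBl cmulBr umull umulr wc.
Qed.

(* [x + iy] has [(x + iy)^* (x + iy) = k]. *)
Lemma rnorm_sum_sqr x y k : sa A x -> sa A y -> x ** y = y ** x -> 0 <= k ->
  x ** x + y ** y = usc k -> rnorm x ^+ 2 <= k.
Proof.
move=> xs ys xy k0 e.
pose w : A := x + 'i *: y.
have sw : star w = x - 'i *: y.
  rewrite /w starD starZ xs ys -scaleNr; congr (_ + _ *: _).
  by apply/eqP; rewrite eq_complex /= oppr0 !eqxx.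
have wk : star w ** w = usc k.
  rewrite -e sw /w cmulDl cmulDr cmulNl cmulDr !cmulZr !cmulZl scalerA -expr2 sqr_i.
  by rewrite scaleN1r xy opprD opprK addrA addrK.
have nw : rnorm w ^+ 2 <= k.
  by rewrite -rnorm_cstar wk; apply: le_trans (rnorm_usc _) _; rewrite ger0_norm.
apply: le_trans nw; rewrite ler_sqr ?nnegrE ?rnorm_ge0 //.
have -> : x = (2%:R : R[i])^-1 *: (w + star w).
  by rewrite sw /w addrACA subrr addr0 half2.
rewrite half_bound //; have := rnormD w (star w); rewrite rnorm_star; lra.
Qed.

(** A square root [h] of [k + d - y^2] commutes with [y], and [h^2 + y^2 = k + d] bounds
    [|h|^2 = |k + d - y^2|] by [k + d]; then [d] is arbitrarily small. *)
Lemma sqr_opp_bound y k : sa A y -> rnorm (y ** y) <= k -> rnorm (usc k - y ** y) <= k.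
Proof.
move=> ys yk; have k0 : 0 <= k := le_trans (rnorm_ge0 _) yk.
apply/ler_addgt0Pr => e e0.
pose d := e / 2; have d0 : 0 < d by rewrite divr_gt0.
have ssq : sa A (y ** y) by exact: sa_sqr.
have t0 : 0 < k + d by rewrite ltr_wpDl.
pose z : A := (k + d)^-1%:C *: (y ** y).
have z1 : rnorm z < 1.
  rewrite rnormZC ger0_norm ?invr_ge0 ?(ltW t0) // mulrC ltr_pdivrMr // mul1r.
  by apply: le_lt_trans yk _; rewrite ltrDl.
have [w [ws wz wc]] := cstar_sqrt (saZ _ ssq) z1.
pose h : A := (Num.sqrt (k + d))%:C *: (u - w).
have hs : sa A h by apply/saZ/saB => //; exact: sa_unit.
have hh : h ** h = usc (k + d) - y ** y.
  rewrite /h cmulZl cmulZr scalerA -rmorphM /= -expr2 sqr_sqrtr ?(ltW t0) //.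
  have -> : (u - w) ** (u - w) = u - z.
    have -> : z = w + w - w ** w by rewrite wz.
    by rewrite cmulBl !cmulBr !umull umulr -addrA -opprD addrA.
  by rewrite scalerBr scalerA -rmorphM /= divff ?gt_eqF // scale1r.
have hy : h ** y = y ** h.
  by rewrite /h cmulZl cmulZr cmulBl cmulBr umull umulr wc // /z cmulZl cmulZr cmulA.
have : rnorm h ^+ 2 <= k + d.
  by apply: (rnorm_sum_sqr hs ys hy (ltW t0)); rewrite hh subrK.
rewrite -rnorm_sa2 // hh => hk.
rewrite -[usc k](addrK (usc d)) -uscD addrAC.
apply: le_trans (rnormB _ _) _.
have := rnorm_usc d; rewrite (gtr0_norm d0) /d in hk *; lra.
Qed.

Lemma upos_sqr y : sa A y -> upos (y ** y).
Proof.
move=> ys; split; first exact: sa_sqr.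
by exists (rnorm (y ** y)); [exact: rnorm_ge0|exact: sqr_opp_bound].
Qed.

(** This frees the radius hidden in [upos]: any bound of the norm serves, because [x + e] is a
    square. *)
Lemma upos_bound x k : upos x -> rnorm x <= k -> rnorm (usc k - x) <= k.
Proof.
move=> px xk; apply/ler_addgt0Pr => e e0.
have [y [ys yx _]] := upos_sqrt px e0.
have := @sqr_opp_bound y (k + e) ys _; rewrite yx uscD opprD addrACA subrr addr0.
apply; apply: le_trans (rnormD _ _) _.
by have := rnorm_usc e; rewrite gtr0_norm //; lra.
Qed.

(** By [upos_bound], all [x + usc d] with [d <= 1] share the radius [|x| + 1], so that the
    inequality survives [d -> 0]. *)
Lemma upos_lim x : (forall d, 0 < d -> upos (x + usc d)) -> upos x.
Proof.
move=> h; split.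
  have [/saB/(_ (sa_usc 1)) + _] := h 1 ltr01; by rewrite addrK.
exists (rnorm x + 1); first by rewrite addr_ge0 ?rnorm_ge0.
apply/ler_addgt0Pr => e e0; pose d := Num.min e 1.
have d0 : 0 < d by rewrite lt_min e0 ltr01.
have [de d1] : d <= e /\ d <= 1 by rewrite !ge_min !lexx orbT.
have xd : rnorm (x + usc d) <= rnorm x + 1.
  apply: le_trans (rnormD _ _) _.
  by have := rnorm_usc d; rewrite (gtr0_norm d0); lra.
have := upos_bound (h d d0) xd; rewrite opprD addrA => hh.
rewrite -(subrK (usc d) (_ - x)); apply: le_trans (rnormD _ _) _.
by have := rnorm_usc d; rewrite (gtr0_norm d0); lra.
Qed.

Lemma uposD x y : upos x -> upos y -> upos (x + y).
Proof.
move=> [xs [s s0 hs]] [ys [t t0 ht]]; split; first exact: saD.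
exists (s + t); first exact: addr_ge0.
by rewrite uscD opprD addrACA; apply: le_trans (rnormD _ _) _; rewrite lerD.
Qed.

Lemma uposZ k x : 0 <= k -> upos x -> upos (k%:C *: x).
Proof.
move=> k0 [xs [s s0 hs]]; split; first exact: saZ.
exists (k * s); first exact: mulr_ge0.
by rewrite -uscZ -scalerBr rnormZC ger0_norm // ler_wpM2l.
Qed.

Lemma upos_uscB k x : sa A x -> rnorm x <= k -> upos (usc k - x).
Proof.
move=> xs xk; split; first exact/saB/xs/sa_usc.
exists k; first exact: le_trans (rnorm_ge0 _) xk.
by rewrite opprB addrC subrK.
Qed.

Lemma upos_uscD k x : sa A x -> rnorm x <= k -> upos (usc k + x).
Proof. by move=> xs xk; rewrite -[x]opprK; apply: upos_uscB; [exact: saN|rewrite rnormN]. Qed.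

Lemma upos_usc k : 0 <= k -> upos (usc k).
Proof.
by move=> k0; rewrite -[usc k]addr0; apply: upos_uscD; [exact: star0|rewrite rnorm0].
Qed.

(** If [y] is a square root of [x + e] commuting with [c], then [c x c = (c y)^2 - e c^2], and [e]
    is chosen so that [e c^2] stays below [d]. *)
Lemma upos_conj c x : upos x -> sa A c -> c ** x = x ** c -> upos (c ** x ** c).
Proof.
move=> px cs cx; apply: upos_lim => d d0.
pose e := d / (rnorm (c ** c) + 1).
have n0 : 0 < rnorm (c ** c) + 1 by rewrite ltr_wpDl ?rnorm_ge0.
have e0 : 0 < e by rewrite divr_gt0.
have [y [ys yx yc]] := upos_sqrt px e0.
have -> : c ** x ** c + usc d = (c ** y) ** (c ** y) + (usc d - e%:C *: (c ** c)).
  have -> : (c ** y) ** (c ** y) = c ** (y ** y) ** c.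
    by rewrite -!cmulA (yc _ cx).
  by rewrite yx cmulDr cmulDl uscMr // cmulZl addrACA subrr addr0.
apply: uposD.
  by apply: upos_sqr; apply: saM => //; exact: yc.
apply: upos_uscB; first exact/saZ/sa_sqr.
rewrite rnormZC gtr0_norm // /e mulrAC ler_pdivrMr // ler_wpM2l ?(ltW d0) //.
by rewrite lerDl.
Qed.

(** Commuting square roots [c] of [m + d - x] and [y] of [m + d + x] satisfy
    [x^2 + (c y)^2 = (m + d)^2], to which [rnorm_sum_sqr] applies. *)
Lemma upos_abs x m : 0 <= m -> upos (usc m - x) -> upos (usc m + x) -> rnorm x <= m.
Proof.
move=> m0 p1 p2; apply/ler_addgt0Pr => d d0.
have [c [cs cx cc]] := upos_sqrt p1 d0.
have [y [ys yx yc]] := upos_sqrt p2 d0.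
have xs : sa A x.
  by have [/saB/(_ (sa_usc m)) + _] := p2; rewrite addrC addKr.
have cx' : c ** x = x ** c.
  by apply/esym/cc; rewrite cmulBl cmulBr uscMl uscMr.
have cy : c ** y = y ** c by apply: yc; rewrite cmulDl cmulDr uscMl uscMr cx'.
have scy : sa A (c ** y) by exact: saM.
have xcy : x ** (c ** y) = (c ** y) ** x.
  rewrite cmulA -cx' -!cmulA; congr (_ ** _).
  by apply: yc; rewrite cmulDl cmulDr uscMl uscMr.
have md : 0 <= m + d by rewrite addr_ge0 // ltW.
rewrite -ler_sqr ?nnegrE ?rnorm_ge0 //.
apply: (rnorm_sum_sqr xs scy xcy); first exact: sqr_ge0.
have -> : (c ** y) ** (c ** y) = (c ** c) ** (y ** y).
  by rewrite -!cmulA; congr (_ ** _); rewrite !cmulA cy.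
rewrite cx yx.
have -> : usc m - x + usc d = usc (m + d) - x by rewrite uscD addrAC.
have -> : usc m + x + usc d = usc (m + d) + x by rewrite uscD addrAC.
rewrite cmulBl !cmulDr !uscMl !uscMr uscZ -expr2.
by rewrite [LHS]addrC opprD addrA addrK subrK.
Qed.

Lemma upos_le_norm x m : 0 <= m -> upos x -> upos (usc m - x) -> rnorm x <= m.
Proof.
move=> m0 px pm; apply: upos_abs => //.
have -> : usc m + x = (usc m - x) + (x + x) by rewrite !addrA subrK.
by apply/uposD/uposD.
Qed.

End Unital.

Section StarPositivity.
Variables (R : realType) (A : cstarAlgType R) (u : A).
Hypothesis hu : is_unit u.
Implicit Types (a b c x y z w : A) (k m s t e d : R).
Local Notation usc := (usc u).
Local Notation upos := (upos u).

(** Divide [|c|^4 = |c^4| <= |c^3| |c|] by [|c|]. *)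
Lemma rnorm_sa3 c : sa A c -> rnorm c ^+ 3 <= rnorm (c ** c ** c).
Proof.
move=> cs; have [c0|c0] := leP (rnorm c) 0.
  have -> : rnorm c = 0 by apply/eqP; rewrite eq_le c0 rnorm_ge0.
  by rewrite expr0n rnorm_ge0.
rewrite -(ler_pM2r c0) -exprSr; apply: le_trans (rnormM _ _).
rewrite -cmulA rnorm_sa2; last exact: sa_sqr.
by rewrite rnorm_sa2 // -exprM.
Qed.

(** For [z = x + i y] with [x], [y] self-adjoint the cross terms cancel and the sum is
    [2 x^2 + 2 y^2]. *)
Lemma cstarD_pos z : upos (star z ** z + z ** star z).
Proof.
have xs := sa_Repart z; have ys := sa_Impart z.
have := ReK z; move: (Repart z) (Impart z) xs ys => x y xs ys ->.
have -> : star (x + 'i *: y) = x - 'i *: y.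
  rewrite starD starZ xs ys -scaleNr; congr (_ + _ *: _).
  by apply/eqP; rewrite eq_complex /= oppr0 !eqxx.
have -> : (x - 'i *: y) ** (x + 'i *: y) + (x + 'i *: y) ** (x - 'i *: y)
    = (x ** x + x ** x) + (y ** y + y ** y).
  set p := 'i *: (x ** y); set q := 'i *: (y ** x).
  have -> : (x - 'i *: y) ** (x + 'i *: y) = (x ** x + y ** y) + (p - q).
    rewrite cmulBl !cmulDr !cmulZr !cmulZl -/p -/q scalerA -expr2 sqr_i scaleN1r.
    by rewrite opprB addrACA.
  have -> : (x + 'i *: y) ** (x - 'i *: y) = (x ** x + y ** y) - (p - q).
    rewrite cmulDl !cmulBr !cmulZr !cmulZl -/p -/q scalerA -expr2 sqr_i scaleN1r.
    by rewrite opprK opprB [q + _]addrC addrACA [- p + _]addrC.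
  by rewrite addrACA subrr addr0 addrACA.
by apply: uposD; apply: uposD; apply: upos_sqr.
Qed.

(* With [a = z^* z], [b = z z^*] and [N = |a| = |b|], the C*-identity gives
   [|(a + N) a (a + N)| = |z (a + N)|^2 = |(b + N) b (b + N)|]. If [a <= k < N],
   then [b >= - k] because [a + b >= 0], so that the left-hand side is at most
   [N (N + k)^2] while the right-hand side is at least [4 N^3]. *)
Lemma cstar_le_norm z k : 0 <= k -> upos (usc k - star z ** z) ->
  rnorm (star z ** z) <= k.
Proof.
move=> k0; set a := star z ** z => pa.
have as_ : sa A a := sa_cstar z.
pose b := z ** star z.
have bs : sa A b by have := sa_cstar (star z); rewrite starK.
pose N := rnorm a.
have Na : rnorm a = N by [].
have Nb : rnorm b = N by rewrite rnorm_cstarr /N rnorm_cstar.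
rewrite leNgt; apply/negP => kN; rewrite Na in kN.
have N0 : 0 < N := le_lt_trans k0 kN.
have pb : upos (usc k + b).
  have -> : usc k + b = (usc k - a) + (a + b) by rewrite addrA subrK.
  exact/uposD/cstarD_pos.
pose f := a + usc N; pose g := b + usc N.
have fs : sa A f by apply/saD/sa_usc.
have gs : sa A g by apply/saD/sa_usc.
have fN : rnorm f <= N + k.
  apply: (upos_le_norm hu); first by rewrite addr_ge0 // ltW.
    by rewrite /f addrC; apply: upos_uscD => //; rewrite Na.
  by rewrite /f opprD uscD [usc N + _]addrC addrACA subrr addr0.
(* If [m = |g|] were below [2 N], then [b = g - N <= m - N < N] and [b >= - k > - N] would force
   [|b| < N]. *)
have gN : 2 * N <= rnorm g.
  rewrite leNgt; apply/negP => gm; pose m := rnorm g.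
  pose s := Num.max k (m - N).
  have sk : k <= s by rewrite le_max lexx.
  have sm : m - N <= s by rewrite le_max lexx orbT.
  have s0 : 0 <= s := le_trans k0 sk.
  suff : rnorm b <= s by rewrite Nb /s le_max !leNgt kN /= /m; lra.
  apply: (upos_abs hu) => //.
    have -> : usc s - b = usc (s - (m - N)) + (usc m - g).
      rewrite /g (opprD b) [usc m + _]addrCA -uscB addrCA -uscD [LHS]addrC.
      by congr (- b + _%:C *: u); ring.
    apply: uposD; last exact: upos_uscB.
    by apply: upos_usc => //; rewrite subr_ge0.
  have -> : usc s + b = usc (s - k) + (usc k + b) by rewrite addrA -uscD subrK.
  by apply: uposD => //; apply: upos_usc => //; rewrite subr_ge0.
have fz : rnorm (f ** a ** f) = rnorm (g ** b ** g).
  have gz : z ** f = g ** z by rewrite cmulDl cmulDr uscMl // uscMr // cmulA.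
  have -> : f ** a ** f = star (z ** f) ** (z ** f) by rewrite starM fs !cmulA.
  have -> : g ** b ** g = (z ** f) ** star (z ** f).
    by rewrite gz starM gs !cmulA.
  by rewrite rnorm_cstar rnorm_cstarr.
have f1 : rnorm (f ** a ** f) <= N * (N + k) ^+ 2.
  apply: le_trans (rnormM _ _) _.
  have h1 := rnormM f a; rewrite Na in h1.
  have h2 := rnorm_ge0 f; rewrite expr2 mulrA; apply: ler_pM => //.
    exact: rnorm_ge0.
  by apply: le_trans h1 _; rewrite mulrC ler_wpM2l // ltW.
have g1 : rnorm g ^+ 3 - N * rnorm g ^+ 2 <= rnorm (g ** b ** g).
  have -> : g ** b ** g = g ** g ** g - N%:C *: (g ** g).
    have -> : b = g - usc N by rewrite /g addrK.
    by rewrite cmulBr cmulBl uscMr // cmulZl.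
  rewrite lerBlDr; apply: le_trans (rnorm_sa3 gs) _.
  rewrite -[X in rnorm X <= _](subrK (N%:C *: (g ** g))).
  by apply: le_trans (rnormD _ _) _; rewrite rnormZC gtr0_norm // rnorm_sa2.
have h := rnorm_ge0 g.
have : rnorm g ^+ 2 * (rnorm g - N) <= N * (N + k) ^+ 2.
  by rewrite mulrBr -exprSr [_ * N]mulrC -fz in g1 *; exact: le_trans g1 f1.
move: (rnorm g) gN h => G gN h.
have : (2 * N) ^+ 2 * N <= G ^+ 2 * (G - N).
  apply: ler_pM; [exact: sqr_ge0|exact: ltW| |lra].
  by rewrite ler_sqr ?nnegrE // mulr_ge0 // ltW.
have : (N + k) ^+ 2 < (2 * N) ^+ 2.
  by rewrite ltr_sqr ?nnegrE ?addr_ge0 ?mulr_ge0 ?(ltW N0) //; lra.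
move: (_ ^+ 2 * (G - N)) => X; nra.
Qed.

(** A normal form for real polynomials in [v] of degree at most 3: identities between them reduce to
    [ring] or [field] on each coefficient. *)
Definition ucubic v k3 k2 k1 k0 : A :=
  k3%:C *: (v ** v ** v) + k2%:C *: (v ** v) + k1%:C *: v + usc k0.

Lemma ucubicD v k3 k2 k1 k0 m3 m2 m1 m0 :
  ucubic v k3 k2 k1 k0 + ucubic v m3 m2 m1 m0 =
  ucubic v (k3 + m3) (k2 + m2) (k1 + m1) (k0 + m0).
Proof.
rewrite /ucubic uscD !rmorphD !scalerDl /=.
rewrite [LHS]addrACA; congr (_ + _).
by rewrite [LHS]addrACA; congr (_ + _); rewrite [LHS]addrACA.
Qed.

Lemma ucubicZ v t k3 k2 k1 k0 :
  t%:C *: ucubic v k3 k2 k1 k0 = ucubic v (t * k3) (t * k2) (t * k1) (t * k0).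
Proof. by rewrite /ucubic !scalerDr uscZ !scalerA -!rmorphM. Qed.

Lemma ucubicM v k2 k1 k0 m1 m0 :
  ucubic v 0 k2 k1 k0 ** ucubic v 0 0 m1 m0 =
  ucubic v (k2 * m1) (k2 * m0 + k1 * m1) (k1 * m0 + k0 * m1) (k0 * m0).
Proof.
rewrite {1 2}/ucubic !scale0r !add0r cmulDr uscMr // [_%:C *: (_ + _)]scalerDr.
rewrite cmulZr !cmulDl uscMl // !cmulZl.
have -> : m1%:C *: (k2%:C *: (v ** v ** v) + k1%:C *: (v ** v) + k0%:C *: v) =
    ucubic v (k2 * m1) (k1 * m1) (k0 * m1) 0.
  by rewrite /ucubic usc0 addr0 !scalerDr !scalerA -!rmorphM /= ![m1 * _]mulrC.
have -> : m0%:C *: (k2%:C *: (v ** v) + k1%:C *: v) + m0%:C *: usc k0 =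
    ucubic v 0 (k2 * m0) (k1 * m0) (k0 * m0).
  by rewrite /ucubic scale0r add0r uscZ !scalerDr !scalerA -!rmorphM /= ![m0 * _]mulrC.
by rewrite ucubicD; congr ucubic; ring.
Qed.

Lemma ucubic_id v : v = ucubic v 0 0 1 0.
Proof. by rewrite /ucubic !scale0r !add0r usc0 addr0 scale1r. Qed.

Lemma ucubic_usc v k : usc k = ucubic v 0 0 0 k.
Proof. by rewrite /ucubic !scale0r !add0r. Qed.

Lemma ucubicN v k3 k2 k1 k0 :
  - ucubic v k3 k2 k1 k0 = ucubic v (- k3) (- k2) (- k1) (- k0).
Proof. by rewrite -[LHS]scaleN1r -(rmorphN1 (real_complex R)) ucubicZ !mulN1r. Qed.

(* If [z^* z <= 3 m], then [4 m^3 - t (3 m - t)^2 = (t - m)^2 (4 m - t)] bounds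
   [(z c)^* (z c)] above for [c = 3 m - z^* z], and
   [9 m^2 t = t (3 m - t)^2 + t^2 (6 m - t)] transfers a lower bound of the former
   to [z^* z], improving the ratio by the factor [4 / 27]. *)
Lemma cstar_pos_step q :
  0 <= q ->
  (forall z k, 0 < k -> upos (usc k - star z ** z) -> upos (star z ** z + usc (q * k))) ->
  forall z k, 0 < k -> upos (usc k - star z ** z) ->
    upos (star z ** z + usc (4 / 27 * q * k)).
Proof.
move=> q0 IH z k k0; set v := star z ** z => pv.
have vs : sa A v := sa_cstar z.
pose m := k / 3; have m0 : 0 < m by rewrite divr_gt0.
have km : k = 3 * m by rewrite /m; field.
pose c := usc k - v; have cs : sa A c by apply/saB/vs/sa_usc.
have cv : c ** v = v ** c by rewrite /c cmulBl cmulBr uscMl // uscMr.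
have zc : star (z ** c) ** (z ** c) = c ** v ** c by rewrite starM cs !cmulA.
(* [4 m^3] is the maximum of [t (3 m - t)^2] on [[0, 3 m]], attained at [t = m]; divided by [9 m^2]
   it becomes [4 m / 9 = (4 / 27) k]. *)
have h := IH (z ** c) (4 * m ^+ 3); rewrite zc in h.
have cE : c = ucubic v 0 0 (-1) (3 * m).
  by rewrite /c km {1}(ucubic_usc v) {2}(ucubic_id v) ucubicN ucubicD; congr ucubic; ring.
have vE := ucubic_id v.
have cvE : c ** v = ucubic v 0 (-1) (3 * m) 0.
  transitivity (ucubic v 0 0 (-1) (3 * m) ** ucubic v 0 0 1 0); first by rewrite -cE -vE.
  by rewrite ucubicM; congr ucubic; ring.
have cvcE : c ** v ** c = ucubic v 1 (- 6 * m) (9 * m ^+ 2) 0.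
  by rewrite cvE cE ucubicM; congr ucubic; ring.
have {}h : upos (c ** v ** c + usc (q * (4 * m ^+ 3))).
  apply: h; first by rewrite mulr_gt0 // exprn_gt0.
  pose l := v - usc m; pose g := usc k - v + usc m.
  have ls : sa A l by apply/saB/sa_usc.
  have lE : l = ucubic v 0 0 1 (- m).
    by rewrite /l (ucubic_usc v) {1}vE ucubicN ucubicD; congr ucubic; ring.
  have gE : g = ucubic v 0 0 (-1) (4 * m).
    by rewrite /g -/c cE (ucubic_usc v) ucubicD; congr ucubic; ring.
  have lgE : l ** g = ucubic v 0 (-1) (5 * m) (- 4 * m ^+ 2).
    by rewrite lE gE ucubicM; congr ucubic; ring.
  have -> : usc (4 * m ^+ 3) - c ** v ** c = l ** g ** l.
    rewrite cvcE (ucubic_usc v) ucubicN ucubicD lgE lE ucubicM.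
    by congr ucubic; ring.
  apply: upos_conj => //; first by apply/uposD/upos_usc/ltW.
  by rewrite lgE gE lE ucubicM; congr ucubic; ring.
have {}h : upos ((9 * m ^+ 2)%:C *: (v + usc (4 / 27 * q * k))).
  pose g := usc k - v + usc (3 * m).
  have gE : g = ucubic v 0 0 (-1) (6 * m).
    by rewrite /g -/c cE (ucubic_usc v) ucubicD; congr ucubic; ring.
  have vgE : v ** g = ucubic v 0 (-1) (6 * m) 0.
    rewrite gE; transitivity (ucubic v 0 0 1 0 ** ucubic v 0 0 (-1) (6 * m)).
      by rewrite -vE.
    by rewrite ucubicM; congr ucubic; ring.
  have vgvE : v ** g ** v = ucubic v (-1) (6 * m) 0 0.
    rewrite vgE; transitivity (ucubic v 0 (-1) (6 * m) 0 ** ucubic v 0 0 1 0).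
      by rewrite -vE.
    by rewrite ucubicM; congr ucubic; ring.
  have -> : (9 * m ^+ 2)%:C *: (v + usc (4 / 27 * q * k)) =
      (c ** v ** c + usc (q * (4 * m ^+ 3))) + v ** g ** v.
    rewrite cvcE vgvE !(ucubic_usc v) {1}vE !ucubicD ucubicZ km.
    by congr ucubic; field.
  apply: uposD => //; apply: upos_conj => //.
    by apply/uposD/upos_usc => //; rewrite mulr_ge0 // ltW.
  rewrite vgE gE; transitivity (ucubic v 0 0 (-1) (6 * m) ** ucubic v 0 0 1 0).
    by rewrite ucubicM; congr ucubic; ring.
  by rewrite -vE.
have m2 : 0 < 9 * m ^+ 2 by rewrite mulr_gt0 // exprn_gt0.
have := uposZ _ h => /(_ (9 * m ^+ 2)^-1).
rewrite scalerA -rmorphM /= mulVf ?gt_eqF // scale1r.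
by apply; rewrite invr_ge0 ltW.
Qed.

(** The lower bound [- k] given by [cstar_le_norm] is multiplied by [4 / 27] at each use of
    [cstar_pos_step], hence tends to 0. *)
Lemma cstar_pos z : upos (star z ** z).
Proof.
have iter n : forall z k, 0 < k -> upos (usc k - star z ** z) ->
    upos (star z ** z + usc ((4 / 27) ^+ n * k)).
  elim: n => [|n IH] {}z k k0 pz.
    rewrite expr0 mul1r addrC; apply: (upos_uscD hu); first exact: sa_cstar.
    by apply: cstar_le_norm => //; exact: ltW.
  rewrite exprS. apply: (cstar_pos_step _ IH k0 pz). exact: exprn_ge0.
have k0 : 0 < rnorm (star z ** z) + 1 by rewrite ltr_wpDl ?rnorm_ge0.
apply: upos_lim => // d d0.
have : (4 / 27 : R) ^+ n @[n --> \oo] --> (0 : R).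
  by apply: cvg_expr; rewrite ger0_norm //; lra.
move/cvgrPdist_lt => /(_ _ (divr_gt0 d0 k0))[n _ /(_ n (leqnn n))] /=.
rewrite sub0r normrN ger0_norm ?exprn_ge0 // ltr_pdivlMr // => h.
have -> : star z ** z + usc d = star z ** z +
    usc ((4 / 27) ^+ n * (rnorm (star z ** z) + 1)) +
    usc (d - (4 / 27) ^+ n * (rnorm (star z ** z) + 1)).
  by rewrite -addrA -uscD addrCA subrr addr0.
apply: uposD; last by apply: upos_usc => //; rewrite subr_ge0 ltW.
apply: iter => //; apply: (upos_uscB hu); first exact: sa_cstar.
by rewrite lerDl.
Qed.

End StarPositivity.

(** For [y] self-adjoint and shorter than 1, the square root [1 - w] of [1 - y^2] has its [w] in
    [D], so that its image [u - pi w] makes sense even if [D] has no unit. The squares of [pi y] and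
    [u - pi w] add up to [u], hence [|pi y| <= 1]. *)
Lemma star_morphism_contractive (R : realType) (D B : cstarAlgType R) (u : B)
    (pi : D -> B) :
  is_unit u -> star_morphism pi -> forall d, rnorm (pi d) <= rnorm d.
Proof.
move=> hu [piL piM piS] d.
have piD x y : pi (x + y) = pi x + pi y by have := piL 1 x y; rewrite !scale1r.
have piZ (c : R[i]) x : pi (c *: x) = c *: pi x.
  have pi0 : pi 0 = 0 by apply: (addIr (pi 0)); rewrite -piD !add0r.
  by have := piL c x 0; rewrite pi0 !addr0.
have piN x : pi (- x) = - pi x by rewrite -scaleN1r piZ scaleN1r.
have sa_contr x : sa D x -> rnorm (pi x) <= rnorm x.
  move=> xs; apply/ler_addgt0Pr => e e0; set k := rnorm x + e.
  have k0 : 0 < k by rewrite ltr_wpDl ?rnorm_ge0.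
  pose y : D := k^-1%:C *: x; have ys : sa D y by exact: saZ.
  have y1 : rnorm y < 1.
    rewrite rnormZC gtr0_norm ?invr_gt0 // mulrC ltr_pdivrMr // mul1r.
    by rewrite /k ltrDl.
  have yy1 : rnorm (y ** y) < 1.
    by rewrite rnorm_sa2 // expr_lt1 // rnorm_ge0.
  have [w [ws wy wc]] := cstar_sqrt (sa_sqr ys) yy1.
  have pys : sa B (pi y) by rewrite /sa /= -piS ys.
  have pws : sa B (pi w) by rewrite /sa /= -piS ws.
  have : rnorm (pi y) ^+ 2 <= 1.
    apply: (rnorm_sum_sqr hu pys (y := u - pi w)) => //.
    - by apply: saB => //; exact: sa_unit.
    - by rewrite cmulBl cmulBr !(umull hu) !(umulr hu) -!piM wc // cmulA.
    - rewrite -piM -wy !piD piN piM cmulBl !cmulBr !(umull hu) !(umulr hu) /usc scale1r.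
      by rewrite -[pi w + pi w - _]addrA -[u - pi w - _]addrA -opprD [LHS]addrC subrK.
  rewrite expr_le1 ?rnorm_ge0 // => h.
  have -> : x = k%:C *: y by rewrite scalerA -rmorphM /= divff ?gt_eqF // scale1r.
  by rewrite piZ rnormZC gtr0_norm // ler_piMr // ltW.
rewrite -ler_sqr ?nnegrE ?rnorm_ge0 // -!rnorm_cstar -piS -piM.
exact/sa_contr/sa_cstar.
Qed.

(** * States and the Hahn-Banach theorem *)

Section HahnBanach.
Variables (R : realType) (V : lmodType R[i]).
Implicit Types (x y : V) (p q : V -> R).

Definition sublinear q :=
  (forall x y, q (x + y) <= q x + q y) /\
  (forall (c : R) x, 0 < c -> q (c%:C *: x) <= c * q x).

Lemma sublinear0 q : sublinear q -> q 0 = 0.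
Proof.
move=> [_ h]; have := h 2 0 (ltr0Sn _ _); rewrite scaler0.
have /(h 2^-1 0) : 0 < (2^-1 : R) by rewrite invr_gt0.
by rewrite scaler0; lra.
Qed.

Lemma sublinear_ge q x : sublinear q -> - q (- x) <= q x.
Proof.
move=> sq; have := sq.1 x (- x); rewrite subrr sublinear0 //; lra.
Qed.

(** The pointwise infimum works: it is finite because [q x >= - q (- x) >= - p (- x)], and
    subadditive because the smaller of two members of the chain can be used at both points. *)
Lemma sublinear_chain p (A : set (V -> R)) : A !=set0 ->
  (forall q, A q -> sublinear q /\ forall x, q x <= p x) ->
  (forall q q', A q -> A q' ->
     (forall x, q x <= q' x) \/ (forall x, q' x <= q x)) ->
  exists2 q, sublinear q & forall q' x, A q' -> q x <= q' x.
Proof.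
move=> [q0 Aq0] hA chain.
pose S x := [set q x | q in A].
have Sq q x : A q -> S x (q x) by move=> Aq; exists q.
have Sl x : has_lbound (S x).
  exists (- p (- x)) => _ [q /hA[sq qp] <-].
  by apply: le_trans (sublinear_ge x sq); rewrite lerN2.
have Sn x : S x !=set0 by exists (q0 x); exact: Sq.
exists (fun x => inf (S x)); last by move=> q' x Aq'; apply: ge_inf => //; exact: Sq.
split=> [x y|c x c0].
  rewrite -lerBlDr; apply: lb_le_inf => // _ [q Aq <-].
  rewrite lerBlDr -lerBlDl; apply: lb_le_inf => // _ [q' Aq' <-].
  rewrite lerBlDl.
  have [h|h] := chain q q' Aq Aq'.
    apply: le_trans (ge_inf (Sl _) (Sq _ (x + y) Aq)) _.
    by apply: le_trans ((hA q Aq).1.1 x y) _; rewrite lerD2l.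
  apply: le_trans (ge_inf (Sl _) (Sq _ (x + y) Aq')) _.
  by apply: le_trans ((hA q' Aq').1.1 x y) _; rewrite lerD2r.
rewrite -ler_pdivrMl //; apply: lb_le_inf => // _ [q Aq <-].
rewrite ler_pdivrMl //; apply: le_trans (ge_inf (Sl _) (Sq _ _ Aq)) _.
exact: (hA q Aq).1.2.
Qed.

(** For sublinear [q], the largest sublinear minorant of [q] whose value at [- y] is at most
    [- q y]. *)
Definition directional q y x := inf [set q (x + t%:C *: y) - t * q y | t in [set t : R | 0 <= t]].

Lemma directional_le q y x t : sublinear q -> 0 <= t ->
  directional q y x <= q (x + t%:C *: y) - t * q y.
Proof.
move=> sq t0; apply: ge_inf; last by exists t.
exists (- q (- x)) => _ [s /= s0 <-].
have [->|sn] := eqVneq s 0.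
  by rewrite scale0r addr0 mul0r subr0; exact: sublinear_ge.
have sp : 0 < s by rewrite lt_neqAle eq_sym sn.
have := sq.1 (x + s%:C *: y) (- x); rewrite addrAC subrr add0r.
have := sq.2 s^-1 (s%:C *: y); rewrite invr_gt0 => /(_ sp).
rewrite scalerA -rmorphM /= mulVf // scale1r ler_pdivlMl //; lra.
Qed.

Lemma directional_ge q y x m :
  (forall t, 0 <= t -> m <= q (x + t%:C *: y) - t * q y) -> m <= directional q y x.
Proof.
move=> h; apply: lb_le_inf => [|_ [t t0 <-]]; last exact: h.
by exists (q (x + 0%:C *: y) - 0 * q y); exists 0 => //=.
Qed.

Lemma directional_sublinear q y : sublinear q -> sublinear (directional q y).
Proof.
move=> sq; split=> [x x'|c x c0].
  rewrite -lerBlDr; apply: directional_ge => t t0.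
  rewrite lerBlDr -lerBlDl; apply: directional_ge => s s0; rewrite lerBlDl.
  apply: le_trans (directional_le _ _ sq (addr_ge0 t0 s0)) _.
  rewrite rmorphD scalerDl addrACA.
  have := sq.1 (x + t%:C *: y) (x' + s%:C *: y); lra.
rewrite -ler_pdivrMl //; apply: directional_ge => t t0; rewrite ler_pdivrMl //.
have ct : 0 <= c * t by rewrite mulr_ge0 // ltW.
apply: le_trans (directional_le _ _ sq ct) _.
rewrite rmorphM -scalerA -scalerDr mulrBr mulrA lerD2r.
exact: sq.2.
Qed.

Lemma directional_le0 q y x : sublinear q -> directional q y x <= q x.
Proof.
move=> sq; have := directional_le y x sq (lexx 0).
by rewrite scale0r addr0 mul0r subr0.
Qed.

Lemma sublinear_minimal p : sublinear p ->
  exists q, [/\ sublinear q, forall x, q x <= p x &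
    forall q', sublinear q' -> (forall x, q' x <= q x) -> q' = q].
Proof.
move=> sp.
pose T := {q : V -> R | sublinear q /\ forall x, q x <= p x}.
(* The order is reversed, since [Zorn] provides maximal elements. *)
pose Rel (s t : T) := `[< forall x, sval t x <= sval s x >].
have p0 : sublinear p /\ forall x, p x <= p x by split.
have [| | |A totA|t ht] := @Zorn T Rel.
- by move=> t; apply/asboolP.
- move=> r s t /asboolP h1 /asboolP h2; apply/asboolP => x.
  exact: le_trans (h2 x) (h1 x).
- move=> [s ps] [t pt] /asboolP /= h1 /asboolP /= h2.
  apply: eq_exist; apply/funext => x; apply/eqP.
  by rewrite eq_le h1 h2.
- have [[t0 At0]|A0] := pselect (A !=set0); last first.
    by exists (exist _ p p0) => s As; exfalso; apply: A0; exists s.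
  have [||q q'|q sq qA] := @sublinear_chain p [set sval t | t in A].
  + by exists (sval t0); exists t0.
  + by move=> _ [t _ <-]; exact: svalP t.
  + move=> [s As <-] [t At <-].
    by case: (totA s t As At) => /asboolP h; [right|left].
  + have qp : sublinear q /\ forall x, q x <= p x.
      split=> // x; apply: le_trans (qA (sval t0) x _) ((svalP t0).2 x).
      by exists t0.
    exists (exist _ q qp) => s As; apply/asboolP => x /=; apply: qA.
    by exists s.
- case: t ht => q [sq qp] ht; exists q; split=> // q' sq' q'q.
  have h : sublinear q' /\ forall x, q' x <= p x.
    by split=> // x; exact: le_trans (q'q x) (qp x).
  have := ht (exist _ q' h) => /(_ _)/(congr1 sval) /=; apply.
  by apply/asboolP.
Qed.

(* A minimal sublinear functional is additive. *)
Lemma hahn_banach p x0 : sublinear p ->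
  exists f : V -> R, [/\ forall x y, f (x + y) = f x + f y,
    forall (c : R) x, f (c%:C *: x) = c * f x,
    forall x, f x <= p x & f x0 = p x0].
Proof.
(* Minimising below [directional p x0] instead of [p] gives [q (- x0) <= - p x0], which forces
   equality at [x0]. *)
move=> sp; have [q [sq qp qmin]] := sublinear_minimal (directional_sublinear x0 sp).
have dE y : directional q y = q.
  by apply: qmin => [|x]; [exact: directional_sublinear|exact: directional_le0].
have qD x y : q (x + y) = q x + q y.
  apply/eqP; rewrite eq_le sq.1 /=.
  by have := directional_le y x sq ler01; rewrite dE scale1r mul1r; lra.
have qN x : q (- x) = - q x.
  by have := qD x (- x); rewrite subrr sublinear0 //; lra.
have qZp (c : R) x : 0 < c -> q (c%:C *: x) = c * q x.
  move=> c0; apply/eqP; rewrite eq_le sq.2 //=.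
  have := sq.2 c^-1 (c%:C *: x); rewrite invr_gt0 => /(_ c0).
  by rewrite scalerA -rmorphM /= mulVf ?gt_eqF // scale1r ler_pdivlMl.
exists q; split=> //.
- move=> c x; have [c0|c0|->] := ltgtP c 0.
  + have := qZp (- c) x; rewrite oppr_gt0 => /(_ c0).
    by rewrite rmorphN scaleNr qN mulNr => /oppr_inj.
  + exact: qZp.
  + by rewrite scale0r mul0r sublinear0.
- by move=> x; apply: le_trans (qp x) _; exact: directional_le0.
- apply/eqP; rewrite eq_le (le_trans (qp x0) (directional_le0 _ _ sp)) /=.
  rewrite -lerN2 -qN; apply: le_trans (qp _) _.
  apply: le_trans (directional_le _ _ sp ler01) _.
  by rewrite scale1r addNr sublinear0 // mul1r sub0r.
Qed.

End HahnBanach.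

Section PositiveFunctionals.
Variables (R : realType) (A : cstarAlgType R).
Implicit Types (x y z : A) (phi : A -> R[i]) (k : R).

Section Linear.
Variable phi : A -> R[i].
Hypothesis pp : positive_functional phi.

Lemma pfD x y : phi (x + y) = phi x + phi y.
Proof. by have := pp.1 1 x y; rewrite scale1r mul1r. Qed.

Lemma pf0 : phi 0 = 0.
Proof. by apply: (addIr (phi 0)); rewrite -pfD !add0r. Qed.

Lemma pfZ (c : R[i]) x : phi (c *: x) = c * phi x.
Proof. by have := pp.1 c x 0; rewrite pf0 !addr0. Qed.

Lemma pfN x : phi (- x) = - phi x.
Proof. by rewrite -scaleN1r pfZ mulN1r. Qed.

Lemma pfB x y : phi (x - y) = phi x - phi y.
Proof. by rewrite pfD pfN. Qed.

End Linear.

Variable u : A.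
Hypothesis hu : is_unit u.
Local Notation upos := (upos u).
Local Notation usc := (usc u).

Section Positive.
Variable phi : A -> R[i].
Hypothesis pp : positive_functional phi.

Lemma pf_unit_ge0 : 0 <= phi u.
Proof. by have := pp.2 u; rewrite (sa_unit hu) (umull hu). Qed.

Definition pf_mass : R := complex.Re (phi u).

Lemma pf_unitE : phi u = pf_mass%:C.
Proof. exact: ge0_complex pf_unit_ge0. Qed.

Lemma pf_mass_ge0 : 0 <= pf_mass.
Proof. by rewrite -ler0c -pf_unitE pf_unit_ge0. Qed.

Lemma pf_usc k : phi (usc k) = (k * pf_mass)%:C.
Proof. by rewrite (pfZ pp) pf_unitE -rmorphM. Qed.

(** In [R[i]] the inequality [0 <= c] includes that [c] is real: the instance [d = 1] settles this,
    small [d] settle the sign. *)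
Lemma complex_ge0_eps (c : R[i]) k : 0 <= k ->
  (forall d, 0 < d -> 0 <= c + (d * k)%:C) -> 0 <= c.
Proof.
case: c => a b k0 h; have := h 1 ltr01; rewrite !lecE /= => /andP[/eqP].
rewrite addr0 => i0 _; rewrite i0 eqxx /=.
apply/ler_addgt0Pr => e e0.
have k1 : 0 < k + 1 by rewrite ltr_wpDl.
have := h (e / (k + 1)) (divr_gt0 e0 k1); rewrite lecE /= => /andP[_ h1].
apply: le_trans h1 _; rewrite lerD2l mulrAC ler_pdivrMr // ler_wpM2l ?(ltW e0) //.
by rewrite lerDl.
Qed.

Lemma pf_upos x : upos x -> 0 <= phi x.
Proof.
move=> px; apply: (complex_ge0_eps pf_mass_ge0) => d d0.
have [y [ys yx _]] := upos_sqrt hu px d0.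
by rewrite -pf_usc -(pfD pp) -yx -{1}ys; exact: pp.2.
Qed.

Lemma pf_sa_real x : sa A x -> phi x = (complex.Re (phi x))%:C.
Proof.
move=> xs; have : 0 <= phi (usc (rnorm x) + x) by apply/pf_upos/upos_uscD.
rewrite (pfD pp) pf_usc; case: (phi x) => a b; rewrite lecE /= => /andP[/eqP + _].
by rewrite add0r => ->.
Qed.

Lemma pf_sa_bound x : sa A x -> rnorm (phi x) <= pf_mass * rnorm x.
Proof.
move=> xs; have [t e] : exists t : R, phi x = t%:C by eexists; exact: pf_sa_real.
rewrite e rnormC ler_norml.
have : 0 <= phi (usc (rnorm x) + x) by apply/pf_upos/upos_uscD.
have : 0 <= phi (usc (rnorm x) - x) by apply/pf_upos/upos_uscB.
rewrite (pfB pp) (pfD pp) pf_usc e !lecE /= => /andP[_ h1] /andP[_ h2].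
have {}h1 : 0 <= rnorm x * pf_mass - t := h1.
have {}h2 : 0 <= rnorm x * pf_mass + t := h2.
by apply/andP; split; lra.
Qed.

Lemma pf_ReIm x : phi x = phi (Repart x) + 'i * phi (Impart x).
Proof. by rewrite {1}(ReK x) (pfD pp) (pfZ pp 'i). Qed.

(** Multiplying [x] by a phase makes [phi x] real and nonnegative, hence equal to the value of [phi]
    at a self-adjoint part. *)
Lemma pf_bound x : rnorm (phi x) <= pf_mass * rnorm x.
Proof.
have [p0|pn] := eqVneq (phi x) 0.
  by rewrite p0 /rnorm normr0 mulr_ge0 ?rnorm_ge0 // pf_mass_ge0.
pose c := `|phi x| / phi x.
have cx : phi (c *: x) = (rnorm (phi x))%:C by rewrite (pfZ pp) divfK // normr_rnorm.
have c1 : rnorm c = 1.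
  by rewrite /rnorm normf_div normr_id divff ?normr_eq0.
have : rnorm (phi (Repart (c *: x))) <= pf_mass * rnorm (c *: x).
  apply: le_trans (pf_sa_bound (sa_Repart _)) _.
  by rewrite ler_wpM2l ?pf_mass_ge0 // rnorm_Repart.
rewrite rnormZ c1 mul1r; apply: le_trans.
have := pf_ReIm (c *: x); rewrite cx (pf_sa_real (sa_Repart _)) (pf_sa_real (sa_Impart _)).
move=> /(congr1 (@complex.Re R)) /= e.
have -> : rnorm (phi x) = complex.Re (phi (Repart (c *: x))) by rewrite e; ring.
by rewrite rnormC ler_norm.
Qed.

Lemma functional_norm_mass : functional_norm phi = pf_mass%:E.
Proof.
apply/eqP; rewrite eq_le; apply/andP; split.
  apply: ge_ereal_sup => _ [x /= x1 <-]; rewrite lee_fin.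
  apply: le_trans (pf_bound x) _; rewrite ler_piMr ?pf_mass_ge0 //.
apply: ereal_sup_ubound; exists u; first exact: rnorm_unit_le1.
by rewrite pf_unitE rnormC ger0_norm ?pf_mass_ge0.
Qed.

End Positive.

Lemma statesP phi : states A phi <-> positive_functional phi /\ phi u = 1.
Proof.
split=> -[pp h]; split=> //.
  by move: h; rewrite functional_norm_mass // => -[h]; rewrite pf_unitE // h.
by rewrite functional_norm_mass // /pf_mass h.
Qed.

Lemma quasi_statesP phi :
  quasi_states A phi <-> positive_functional phi /\ pf_mass phi <= 1.
Proof. by split=> -[pp h]; split=> //; move: h; rewrite functional_norm_mass // lee_fin. Qed.

Lemma state_bound phi x : states A phi -> rnorm (phi x) <= rnorm x.
Proof.
by move=> /statesP[pp h]; have := pf_bound pp x; rewrite /pf_mass h mul1r.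
Qed.

Lemma state_usc phi k : states A phi -> phi (usc k) = k%:C.
Proof. by move=> /statesP[pp h]; rewrite pf_usc // /pf_mass h mulr1. Qed.

Lemma state_dist phi psi x (c : R[i]) : states A phi -> states A psi ->
  rnorm (phi x - psi x) <= 2 * rnorm (x - c *: u).
Proof.
move=> sp sq; have /statesP[pp p1] := sp; have /statesP[pq q1] := sq.
have -> : phi x - psi x = phi (x - c *: u) - psi (x - c *: u).
  by rewrite (pfB pp) (pfB pq) (pfZ pp) (pfZ pq) p1 q1 opprB addrA subrK.
have h1 := state_bound (x - c *: u) sp; have h2 := state_bound (x - c *: u) sq.
have := crnormD (phi (x - c *: u)) (- psi (x - c *: u)); rewrite crnormN; lra.
Qed.

Hypothesis u0 : rnorm u = 1.

Lemma upos_usc_ge0 k : upos (usc k) -> 0 <= k.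
Proof.
move=> [_ [s s0]]; rewrite -uscB rnormZC u0 mulr1 ler_norml => /andP[_]; lra.
Qed.

Definition order_bounds x := [set s | upos (usc s - Repart x)].

Lemma order_bounds_norm x s : upos (usc s - Repart x) -> - rnorm x <= s.
Proof.
move=> h; have : upos (usc (s + rnorm x)).
  have -> : usc (s + rnorm x) = usc s - Repart x + (usc (rnorm x) + Repart x).
    by rewrite uscD [usc (rnorm x) + _]addrC addrA subrK.
  by apply: uposD => //; apply: upos_uscD => //; [exact: sa_Repart|exact: rnorm_Repart].
by move/upos_usc_ge0; lra.
Qed.

(** The upper end of the spectrum of [Repart x], in terms of the order; the real-linear functionals
    that it dominates are the real parts of states. *)
Definition order_sup x : R := inf (order_bounds x).

Lemma order_sup_le x s : upos (usc s - Repart x) -> order_sup x <= s.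
Proof.
by move=> h; apply: ge_inf => //; exists (- rnorm x) => t; exact: order_bounds_norm.
Qed.

Lemma order_sup_ge x m : (forall s, upos (usc s - Repart x) -> m <= s) -> m <= order_sup x.
Proof.
move=> h; apply: lb_le_inf => //; exists (rnorm x); rewrite /order_bounds /=.
by apply: upos_uscB => //; [exact: sa_Repart|exact: rnorm_Repart].
Qed.

Lemma RepartD x y : Repart (x + y) = Repart x + Repart y.
Proof. by rewrite /Repart starD addrACA scalerDr. Qed.

Lemma RepartZ k x : Repart (k%:C *: x) = k%:C *: Repart x.
Proof. by rewrite /Repart starZC -scalerDr scalerA mulrC -scalerA. Qed.

Lemma RepartN x : Repart (- x) = - Repart x.
Proof. by rewrite /Repart starN -opprD scalerN. Qed.

Lemma order_sup_sublinear : sublinear order_sup.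
Proof.
split=> [x y|c x c0].
  rewrite -lerBlDr; apply: order_sup_ge => s hs.
  rewrite lerBlDr -lerBlDl; apply: order_sup_ge => t ht; rewrite lerBlDl.
  by apply: order_sup_le; rewrite RepartD uscD opprD addrACA; exact: uposD.
rewrite -ler_pdivrMl //; apply: order_sup_ge => s hs; rewrite ler_pdivrMl //.
by apply: order_sup_le; rewrite RepartZ -uscZ -scalerBr; apply: uposZ => //; exact: ltW.
Qed.

(** Otherwise [s - x] and [t + x] would be positive for some [s] and [t] below [|x|], and [upos_abs]
    would make [x] shorter than its norm. *)
Lemma order_sup_norming x : sa A x ->
  rnorm x <= order_sup x \/ rnorm x <= order_sup (- x).
Proof.
move=> xs; apply: contrapT => hn.
have h1 : order_sup x < rnorm x.
  by rewrite ltNge; apply/negP => h; apply: hn; left.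
have h2 : order_sup (- x) < rnorm x.
  by rewrite ltNge; apply/negP => h; apply: hn; right.
have [s hs sx] : exists2 s, upos (usc s - x) & s < rnorm x.
  apply: contrapT => h; move: h1; apply/negP; rewrite -leNgt; apply: order_sup_ge => s.
  rewrite Repart_sa // => hs; rewrite leNgt; apply/negP => sx; apply: h; exists s => //.
have [t ht tx] : exists2 t, upos (usc t + x) & t < rnorm x.
  apply: contrapT => h; move: h2; apply/negP; rewrite -leNgt; apply: order_sup_ge => t.
  rewrite Repart_sa ?opprK; last exact: saN.
  by move=> ht; rewrite leNgt; apply/negP => tx; apply: h; exists t.
have [x0|x0] := leP (rnorm x) 0.
  apply: hn; left; apply: order_sup_ge => m hm; apply: le_trans (order_bounds_norm hm).
  by have := rnorm_ge0 x; lra.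
pose m := Num.max 0 (Num.max s t).
have [m0 [sm tm]] : 0 <= m /\ (s <= m /\ t <= m).
  by rewrite /m !le_max !lexx !orbT.
have : rnorm x <= m.
  apply: (upos_abs hu) => //.
    have -> : usc m - x = usc (m - s) + (usc s - x) by rewrite uscB addrA subrK.
    by apply: uposD => //; apply: upos_usc => //; rewrite subr_ge0.
  have -> : usc m + x = usc (m - t) + (usc t + x) by rewrite uscB addrA subrK.
  by apply: uposD => //; apply: upos_usc => //; rewrite subr_ge0.
by rewrite leNgt /m !gt_max x0 sx tx.
Qed.

(** The state is the complexification [f x - i f (i x)] of a Hahn-Banach functional [f]. Domination
    by [order_sup] makes [f] nonnegative on [upos] and zero on elements without real part;
    [cstar_pos] then gives positivity on all [x^* x]. *)
Lemma order_sup_state x0 : exists2 phi, states A phi &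
  complex.Re (phi x0) = order_sup x0.
Proof.
have [f [fD fZ fp fx0]] := @hahn_banach R A _ x0 order_sup_sublinear.
pose phi x := (f x +i* - f ('i *: x)) : R[i].
have fN x : f (- x) = - f x.
  by rewrite -scaleN1r -(rmorphN1 (real_complex R)) fZ mulN1r.
have f0 : f 0 = 0 by have := fZ 0 0; rewrite scaler0 mul0r.
have fa x : Repart x = 0 -> f x = 0.
  move=> x0'; apply/eqP; rewrite eq_le; apply/andP; split.
    apply: le_trans (fp _) _; apply: order_sup_le.
    by rewrite x0' subr0; exact: upos_usc.
  rewrite -oppr_le0 -fN; apply: le_trans (fp _) _; apply: order_sup_le.
  by rewrite RepartN x0' oppr0 subr0; exact: upos_usc.
have fi x : sa A x -> f ('i *: x) = 0.
  move=> xs; apply: fa; rewrite /Repart starZ xs.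
  have -> : ('i^*)%C = - 'i :> R[i] by apply/eqP; rewrite eq_complex /= oppr0 !eqxx.
  by rewrite scaleNr subrr scaler0.
have f_pos x : upos x -> 0 <= f x.
  move=> px; rewrite -oppr_le0 -fN; apply: le_trans (fp _) _; apply: order_sup_le.
  by rewrite Repart_sa ?usc0 ?add0r ?opprK //; apply: saN; case: px.
have f1 : f u = 1.
  have su := sa_unit hu.
  have e : usc 1 = u by rewrite /usc scale1r.
  apply/eqP; rewrite eq_le; apply/andP; split.
    apply: le_trans (fp _) _; apply: order_sup_le.
    by rewrite Repart_sa // e subrr -(usc0 u); exact: upos_usc.
  rewrite -lerN2 -fN; apply: le_trans (fp _) _; apply: order_sup_le.
  rewrite Repart_sa ?opprK; last exact: saN.
  by rewrite uscN e addNr -(usc0 u); exact: upos_usc.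
exists phi; last by rewrite /phi /= fx0.
apply/statesP; split; last first.
  by rewrite /phi f1 fi ?oppr0 //; exact: sa_unit.
split.
  move=> [a b] x y.
  have e1 : (a +i* b) *: x = a%:C *: x + b%:C *: ('i *: x).
    rewrite scalerA -scalerDl; congr (_ *: _).
    by apply/eqP; rewrite eq_complex /=; apply/andP; split; apply/eqP; ring.
  have e2 : 'i *: ((a +i* b) *: x) = a%:C *: ('i *: x) + b%:C *: (- x).
    rewrite -scaleN1r !scalerA -scalerDl; congr (_ *: _).
    by apply/eqP; rewrite eq_complex /=; apply/andP; split; apply/eqP; ring.
  rewrite /phi scalerDr !fD e2 e1 !fD !fZ fN.
  by apply/eqP; rewrite eq_complex /=; apply/andP; split; apply/eqP; ring.
move=> x; rewrite /phi fi; last exact: sa_cstar.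
by rewrite oppr0 ler0c; apply/f_pos/cstar_pos.
Qed.

Lemma norming_state x : sa A x -> exists2 phi, states A phi & rnorm x <= rnorm (phi x).
Proof.
move=> xs; have [h|h] := order_sup_norming xs.
  have [phi sp e] := order_sup_state x; exists phi => //; rewrite -e in h.
  exact: le_trans h (Re_le_rnorm _).
have [phi sp e] := order_sup_state (- x); exists phi => //; rewrite -e in h.
have /statesP[pp _] := sp; apply: le_trans h _; rewrite (pfN pp).
by apply: le_trans (Re_le_rnorm _) _; rewrite /rnorm normrN.
Qed.

End PositiveFunctionals.

(** * Direct sums of C*-algebras *)

(* An alias, because products have no canonical pointed uniform structure. *)
Definition csum (R : realType) (A B : cstarAlgType R) : Type := (A * B)%type.

HB.instance Definition _ (R : realType) (A B : cstarAlgType R) :=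
  NormedModule.copy (csum A B) (A * B)%type.
HB.instance Definition _ (R : realType) (A B : cstarAlgType R) :=
  isPointed.Build (csum A B) (0, 0).

Section DirectSum.
Variables (R : realType) (A B : cstarAlgType R).
Local Notation C := (csum A B).
Implicit Types x y : C.

Lemma csum_complete (F : set_system C) : ProperFilter F -> cauchy F -> cvg F.
Proof.
move=> PF cF.
have cF' : cauchy_ex F by exact/cauchyP.
have bE x y e : ball x e y -> ball x.1 e y.1 /\ ball x.2 e y.2 by [].
have c1 : cvg (fst @ F : set_system A).
  apply: cauchy_cvg; apply: cauchy_exP => e /cF'[x xe].
  by exists x.1; apply: (@filterS _ F _ _ _ _ xe) => y /bE[].
have c2 : cvg (snd @ F : set_system B).
  apply: cauchy_cvg; apply: cauchy_exP => e /cF'[x xe].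
  by exists x.2; apply: (@filterS _ F _ _ _ _ xe) => y /bE[].
apply/cvg_ex; exists (lim (fst @ F : set_system A), lim (snd @ F : set_system B)).
by move=> U UU; apply: (@filterS _ F _ _ _ _ (cvg_pair c1 c2 UU)) => -[].
Qed.

HB.instance Definition _ := Uniform_isComplete.Build (csum A B) csum_complete.

Lemma csum_rnorm x : rnorm x = Num.max (rnorm x.1) (rnorm x.2).
Proof.
apply: complexI; rewrite -normr_rnorm.
have -> : `|x| = Num.max `|x.1| `|x.2| by [].
have [h|h] := leP (rnorm x.1) (rnorm x.2).
  by rewrite max_r ?normr_rnorm // lecR.
by rewrite max_l ?normr_rnorm // lecR ltW.
Qed.

Definition csum_mul x y : C := (x.1 ** y.1, x.2 ** y.2).
Definition csum_star x : C := (star x.1, star x.2).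

Lemma csum_mulA : associative csum_mul.
Proof. by move=> x y z; rewrite /csum_mul /= !cmulA. Qed.

Lemma csum_mulDl : left_distributive csum_mul +%R.
Proof. by move=> x y z; rewrite /csum_mul /= !cmulDl. Qed.

Lemma csum_mulDr : right_distributive csum_mul +%R.
Proof. by move=> x y z; rewrite /csum_mul /= !cmulDr. Qed.

Lemma csum_mulZl (c : R[i]) x y : csum_mul (c *: x) y = c *: csum_mul x y.
Proof. by rewrite /csum_mul /= !cmulZl. Qed.

Lemma csum_mulZr (c : R[i]) x y : csum_mul x (c *: y) = c *: csum_mul x y.
Proof. by rewrite /csum_mul /= !cmulZr. Qed.

Lemma csum_starK : involutive csum_star.
Proof. by move=> [a b]; rewrite /csum_star /= !starK. Qed.

Lemma csum_starD : {morph csum_star : x y / x + y}.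
Proof. by move=> x y; rewrite /csum_star /= !starD. Qed.

Lemma csum_starZ (c : R[i]) x : csum_star (c *: x) = (c^*)%C *: csum_star x.
Proof. by rewrite /csum_star /= !starZ. Qed.

Lemma csum_starM x y : csum_star (csum_mul x y) = csum_mul (csum_star y) (csum_star x).
Proof. by rewrite /csum_star /csum_mul /= !starM. Qed.

Lemma csum_normM x y : `|csum_mul x y| <= `|x| * `|y|.
Proof.
rewrite !normr_rnorm -rmorphM lecR !csum_rnorm /= ge_max; apply/andP; split.
  apply: le_trans (rnormM _ _) _.
  by apply: ler_pM; rewrite ?rnorm_ge0 // le_max lexx.
apply: le_trans (rnormM _ _) _.
by apply: ler_pM; rewrite ?rnorm_ge0 // le_max lexx orbT.
Qed.

Lemma csum_cstar x : `|csum_mul (csum_star x) x| = `|x| ^+ 2.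
Proof.
rewrite !normr_rnorm -rmorphXn; congr (_%:C); rewrite !csum_rnorm /= !rnorm_cstar.
have h1 := rnorm_ge0 x.1; have h2 := rnorm_ge0 x.2.
have [h|h] := leP (rnorm x.1) (rnorm x.2).
  by rewrite max_r // ler_sqr.
by rewrite max_l // ler_sqr // ltW.
Qed.

HB.instance Definition _ := CompleteNormedModule_isCStar.Build R (csum A B)
  csum_mulA csum_mulDl csum_mulDr csum_mulZl csum_mulZr csum_starK csum_starD
  csum_starZ csum_starM csum_normM csum_cstar.

Lemma csum_rnorm_le x (k : R) : rnorm x.1 <= k -> rnorm x.2 <= k -> rnorm x <= k.
Proof. by rewrite csum_rnorm ge_max => -> ->. Qed.

Lemma csum_rnorm1 x : rnorm x.1 <= rnorm x.
Proof. by rewrite csum_rnorm le_max lexx. Qed.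

Lemma csum_rnorm2 x : rnorm x.2 <= rnorm x.
Proof. by rewrite csum_rnorm le_max lexx orbT. Qed.

Lemma csum_is_unit (uA : A) (uB : B) : is_unit uA -> is_unit uB -> is_unit ((uA, uB) : C).
Proof.
move=> hA hB [a b]; case: (hA a) (hB b) => a1 a2 [b1 b2].
by split; [change ((uA ** a, uB ** b) = (a, b))|change ((a ** uA, b ** uB) = (a, b))];
  rewrite ?a1 ?a2 ?b1 ?b2.
Qed.

Lemma csum_sa x : sa C x <-> sa A x.1 /\ sa B x.2.
Proof.
case: x => a b; rewrite /sa /=; split; last by move=> [h1 h2]; congr pair.
by move=> h; split; [exact: (congr1 fst h)|exact: (congr1 snd h)].
Qed.

End DirectSum.

(** * Transport of states along a tunnel *)

Section NonnegativeSup.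
Variables (R : realType).
Implicit Types (S : set \bar R).

Lemma nnsup_ge0 S : (0 <= nnsup S)%E.
Proof. by apply: ereal_sup_ubound; left. Qed.

Lemma nnsup_ubound S x : S x -> (x <= nnsup S)%E.
Proof. by move=> Sx; apply: ereal_sup_ubound; right. Qed.

Lemma nnsup_le S (k : \bar R) : (0 <= k)%E -> (forall x, S x -> (x <= k)%E) -> (nnsup S <= k)%E.
Proof. by move=> k0 h; apply: ge_ereal_sup => x [->//|/h]. Qed.

End NonnegativeSup.

Section SeminormFacts.
Variables (R : realType) (A : cstarAlgType R) (L : seminorm A).
Implicit Types (a b : A) (phi psi mu : A -> R[i]) (k l : R).

Lemma snN a : sn_dom L a -> L (- a) = L a.
Proof.
move=> da; rewrite -scaleN1r (snZ _ da) (_ : rnorm _ = 1) ?mul1r //.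
by have := crnormN (1 : R[i]); rewrite {2}/rnorm normr1.
Qed.

Lemma snZC k a : sn_dom L a -> L (k%:C *: a) = `|k| * L a.
Proof. by move=> da; rewrite snZ // rnormC. Qed.

Lemma sn0 : L 0 = 0.
Proof. by rewrite -(scale0r 0) -(rmorph0 (real_complex R)) snZC ?normr0 ?mul0r //; exact: sn_dom0. Qed.

Lemma sn_domN a : sn_dom L a -> sn_dom L (- a).
Proof. by rewrite -scaleN1r; exact: sn_domZ. Qed.

Lemma sn_domB a b : sn_dom L a -> sn_dom L b -> sn_dom L (a - b).
Proof. by move=> da db; apply: sn_domD => //; exact: sn_domN. Qed.

Lemma snB a b : sn_dom L a -> sn_dom L b -> L (a - b) <= L a + L b.
Proof. by move=> da db; rewrite -(snN db); apply: snD => //; exact: sn_domN. Qed.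

Lemma dom_saZ k a : dom_sa L a -> dom_sa L (k%:C *: a).
Proof. by move=> [da sa_]; split; [exact: sn_domZ|exact: saZ]. Qed.

Lemma sn_Repart a : hermitian_sn L -> sn_dom L a ->
  dom_sa L (Repart a) /\ L (Repart a) <= L a.
Proof.
move=> hL da; have [ds Ls] := hL a da; split.
  by split; [apply/sn_domZ/sn_domD|exact: sa_Repart].
rewrite /Repart half_real snZC ?ger0_norm ?invr_ge0 //; last exact: sn_domD.
have := snD da ds; rewrite Ls; lra.
Qed.

Lemma sn_Impart a : hermitian_sn L -> sn_dom L a ->
  dom_sa L (Impart a) /\ L (Impart a) <= L a.
Proof.
move=> hL da; rewrite Impart_Repart.
have [d1 l1] := sn_Repart hL (sn_domZ (- 'i) da).
by split=> //; apply: le_trans l1 _; rewrite (snZ _ da) (_ : rnorm _ = 1) ?mul1r // -(crnormi R); exact: crnormN.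
Qed.

Lemma mk_lt_dist phi psi k : positive_functional phi -> positive_functional psi ->
  (mk L phi psi <= k%:E)%E ->
  forall a l, 0 <= l -> dom_sa L a -> L a <= l -> rnorm (phi a - psi a) <= k * l.
Proof.
move=> pp pq h a l l0 da La.
have k0 : 0 <= k by rewrite -lee_fin; apply: le_trans h; exact: nnsup_ge0.
(* [a] is rescaled by [m > 0] rather than by [l], which may vanish. *)
have dist m : 0 < m -> l <= m -> rnorm (phi a - psi a) <= k * m.
  move=> m0 lm.
  have := le_trans (nnsup_ubound _) h => /(_ (rnorm (phi (m^-1%:C *: a) - psi (m^-1%:C *: a)))%:E).
  rewrite lee_fin (pfZ pp) (pfZ pq) -mulrBr crnormM rnormC gtr0_norm ?invr_gt0 //.
  rewrite ler_pdivrMl // [m * k]mulrC; apply.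
  exists (m^-1%:C *: a); last first.
    by rewrite (pfZ pp) (pfZ pq) -mulrBr crnormM rnormC gtr0_norm ?invr_gt0.
  split; first exact: dom_saZ.
  by rewrite snZC ?gtr0_norm ?invr_gt0 // ?ler_pdivrMl // ?mulr1 ?(le_trans La) //; case: da.
apply/ler_addgt0Pr => e e0; have k1 : 0 < k + 1 by rewrite ltr_wpDl.
apply: le_trans (dist (l + e / (k + 1)) _ _) _.
- by rewrite ltr_wpDl // divr_gt0.
- by rewrite lerDl divr_ge0 // ltW.
- rewrite mulrDr lerD2l mulrCA ler_piMr ?(ltW e0) // ler_pdivrMr // mul1r.
  by rewrite lerDl.
Qed.

Lemma mk_le phi psi k : 0 <= k ->
  (forall a, dom_sa L a -> L a <= 1 -> rnorm (phi a - psi a) <= k) ->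
  (mk L phi psi <= k%:E)%E.
Proof.
by move=> k0 h; apply: nnsup_le => // _ [a [da La] <-]; rewrite lee_fin; exact: h.
Qed.

Lemma mk_ge0 phi psi : (0 <= mk L phi psi)%E.
Proof. exact: nnsup_ge0. Qed.

End SeminormFacts.

Section CompactFacts.
Variables (R : realType) (A : cstarAlgType R) (L : seminorm A) (u : A) (mu : A -> R[i]).
Variable r : R.
Hypotheses (hu : is_unit u) (hmu : states A mu) (hnc : norm_mod_constants L).
Hypothesis hr : (qdiam L < r%:E)%E.
Implicit Types (a : A).

Lemma rnorm_unit : rnorm u = 1.
Proof.
apply/eqP; rewrite eq_le rnorm_unit_le1 //=.
have := state_bound hu u hmu; have /(statesP hu)[_ ->] := hmu.
by rewrite /rnorm normr1.
Qed.

Lemma sn_unit (c : R[i]) : sn_dom L (c *: u) /\ L (c *: u) = 0.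
Proof.
have : [set a | sn_dom L a /\ L a = 0] (c *: u) by rewrite (hnc.2 u hu); exists c.
by [].
Qed.

Lemma qdiam_mk phi psi : states A phi -> states A psi -> (mk L phi psi <= r%:E)%E.
Proof.
move=> sp sq; apply: le_trans (ltW hr); apply: nnsup_ubound.
by exists phi, psi.
Qed.

Definition state_center a : R := complex.Re (mu a).

Lemma centerE a : sa A a -> mu a = (state_center a)%:C.
Proof. by have /(statesP hu)[pp _] := hmu; exact: (pf_sa_real hu pp). Qed.

Lemma dom_sa_center a : dom_sa L a -> dom_sa L (a - usc u (state_center a)).
Proof.
move=> [da sa_]; split; last by apply: saB => //; exact: sa_usc.
by apply: sn_domB => //; case: (sn_unit (state_center a)%:C).
Qed.

Lemma sn_center a (c : R[i]) : sn_dom L a -> L (a - c *: u) <= L a.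
Proof.
move=> da; have [du Lu] := sn_unit c.
by apply: le_trans (snB da du) _; rewrite Lu addr0.
Qed.

(** A state that norms the self-adjoint element [a - muA a] turns the bound on the diameter into a
    bound on the norm. *)
Lemma rnorm_center a (l : R) : 0 <= l -> dom_sa L a -> L a <= l ->
  rnorm (a - usc u (state_center a)) <= r * l.
Proof.
move=> l0 da La; have [_ sa_] := dom_sa_center da.
have [phi sp h] := norming_state hu rnorm_unit sa_.
apply: le_trans h _; have /(statesP hu)[pp p1] := sp; have /(statesP hu)[pm _] := hmu.
rewrite (pfB pp) (state_usc hu _ sp) -centerE; last by case: da.
exact: mk_lt_dist (qdiam_mk sp hmu) _ _ l0 da La.
Qed.

End CompactFacts.

Section Isometries.
Variables (R : realType) (D A : cstarAlgType R).
Variables (LD : seminorm D) (LA : seminorm A) (pi : D -> A) (M : R).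

Lemma isometry_lift (a : A) (k d : R) : quantum_M_isometry LD LA M pi -> 0 < M ->
  dom_sa LA a -> M^-1 * rnorm a <= k -> LA a <= k -> 0 < d ->
  exists x, [/\ dom_sa LD x, pi x = a, LD x <= k + d & rnorm x <= M * (k + d)].
Proof.
move=> [_ _ _ h _] M0 da ak Lk d0.
have := h a da => /esym e.
have /ereal_inf_lt : (ereal_inf [set (normLM LD M x)%:E | x in [set x | dom_sa LD x /\ pi x = a]]
    < (k + d)%:E)%E.
  have kd : k < k + d by rewrite ltrDl.
  by rewrite e lte_fin /normLM gt_max (le_lt_trans ak kd) (le_lt_trans Lk kd).
move=> [_ [x [dx px] <-]]; rewrite lte_fin gt_max => /andP[h1 h2].
exists x; split=> //; first exact: ltW.
by move: h1; rewrite ltr_pdivrMl // => /ltW.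
Qed.

(** [D] need not have a unit at which to read the norm of [phi \o pi], which is bounded through the
    contractivity of [pi] instead. *)
Lemma pullback_quasi_state (u : A) (phi : A -> R[i]) : is_unit u ->
  star_morphism pi -> states A phi -> quasi_states D (phi \o pi).
Proof.
move=> hu hpi sp; have /(statesP hu)[pp _] := sp.
have [piL piM piS] := hpi.
split; first split.
- move=> c x y /=; rewrite piL (pfD pp) (pfZ pp) //.
- by move=> x /=; rewrite piM piS; exact: pp.2.
- apply: ge_ereal_sup => _ [x /= x1 <-]; rewrite lee_fin.
  apply: le_trans (state_bound hu _ sp) _.
  exact: le_trans (star_morphism_contractive hu hpi x) x1.
Qed.

End Isometries.

Section CoreEstimate.
Variables (R : realType) (D A B : cstarAlgType R).
Variables (LD : seminorm D) (LA : seminorm A) (LB : seminorm B).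
Variables (piA : D -> A) (piB : D -> B) (uA : A) (uB : B) (muB : B -> R[i]).
Variables (r eps eps' : R) (e : D).
Hypotheses (huA : is_unit uA) (huB : is_unit uB).
Hypotheses (hmuB : states B muB) (hncB : norm_mod_constants LB).
Hypotheses (r1 : 1 <= r) (qB : (qdiam LB < r%:E)%E).
Hypotheses (iA : quantum_M_isometry LD LA r piA) (iB : quantum_M_isometry LD LB r piB).
Hypotheses (eps0 : 0 < eps) (eps1 : eps <= 1 / 20) (eps'eps : eps' < eps).
Hypotheses (de : dom_sa LD e) (Le : 2 * r * LD e <= eps)
  (mue : rnorm (1 - muB (piB e)) <= eps).
Hypothesis almost : almost_subset (blM LD r) eps' (compressed_quasi_states e)
  (dual piA (quasi_states A)).

Let piBm : star_morphism piB. Proof. by case: iB => -[]. Qed.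
Let piAm : star_morphism piA. Proof. by case: iA => -[]. Qed.
Let r0 : 0 < r. Proof. exact: lt_le_trans r1. Qed.

(* As [LB (piB e) <= eps / (2 r)], the element [piB e] is close to the constant
   [muB (piB e)], which is itself close to [1]. *)
Lemma rnorm_unit_compression : rnorm (uB - piB e) <= 3 / 2 * eps.
Proof.
have [[_ _ piS] [_ _ dm _ Lpi]] := (piBm, iB).
have ds : dom_sa LB (piB e).
  split; last by rewrite /sa /= -piS; case: de => _ ->.
  by have : (piB @` sn_dom LD) (piB e) by [exists e => //; case: de]; rewrite dm.
have Le' : LB (piB e) <= eps / (2 * r).
  apply: le_trans (Lpi e de) _; rewrite ler_pdivlMr ?mulr_gt0 //.
  by rewrite mulrC.
have e2 : 0 <= eps / (2 * r) by rewrite divr_ge0 ?mulr_ge0 ?ltW.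
have h := rnorm_center huB hmuB hncB qB e2 ds Le'.
rewrite (_ : r * (eps / (2 * r)) = eps / 2) in h; last by field; rewrite gt_eqF.
have h2 : rnorm (uB - usc uB (state_center muB (piB e))) <= eps.
  rewrite -{1}[uB]scale1r -scalerBl; apply: le_trans mue.
  rewrite rnormZ (rnorm_unit huB hmuB) mulr1 -(centerE huB hmuB) //.
  by case: ds.
rewrite -(subrK (usc uB (state_center muB (piB e))) uB) -addrA.
apply: le_trans (rnormD _ _) _; rewrite (rdistC (usc _ _)); lra.
Qed.

(** With [v = piB e] and [w = 1 - v], the difference is [w x + v x w]; its norm is at most
    [(3 + 9 eps / 4) eps |x|], and [eps <= 1 / 20] leaves room below the constant 4. *)
Lemma compression_close (x : B) :
  rnorm (x - piB e ** x ** piB e) <= 4 * eps * rnorm x.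
Proof.
set v := piB e; pose w := uB - v.
have hw : rnorm w <= 3 / 2 * eps := rnorm_unit_compression.
have hv : rnorm v <= 1 + 3 / 2 * eps.
  have -> : v = uB - w by rewrite /w opprB addrC subrK.
  apply: le_trans (rnormB _ _) _; rewrite lerD //; exact: rnorm_unit_le1.
have -> : x - v ** x ** v = w ** x + v ** x ** w.
  by rewrite /w cmulBl cmulBr (umull huB) (umulr huB) addrA subrK.
apply: le_trans (rnormD _ _) _.
have w0 := rnorm_ge0 w; have v0 := rnorm_ge0 v; have x0 := rnorm_ge0 x.
have h1 := rnormM w x; have h2 := rnormM (v ** x) w; have h3 := rnormM v x.
have h4 : rnorm w * rnorm x <= 3 / 2 * eps * rnorm x by rewrite ler_wpM2r.
have h5 : rnorm (v ** x) <= (1 + 3 / 2 * eps) * rnorm x.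
  by apply: le_trans h3 _; rewrite ler_wpM2r.
have h6 : rnorm (v ** x) * rnorm w <= (1 + 3 / 2 * eps) * rnorm x * (3 / 2 * eps).
  by apply: ler_pM => //; exact: rnorm_ge0.
have h7 : eps * eps * rnorm x <= 1 / 20 * eps * rnorm x.
  by rewrite ler_wpM2r // ler_wpM2r // ltW.
have h8 : 0 <= eps * rnorm x by rewrite mulr_ge0 // ltW.
lra.
Qed.

(** Compressing by [e] costs [4 eps (r l)]. The compressed functional is [eps]-close to a
    quasi-state of [A] on the elements that [blM LD r] tests, which after division by [l] include
    [d]; this costs [eps l <= r eps l]. *)
Lemma quasi_state_transport phi : states B phi ->
  exists2 psi, quasi_states A psi & forall (d : D) (l : R), 0 < l -> dom_sa LD d ->
    LD d <= l -> rnorm d <= r * l -> rnorm (phi (piB d) - psi (piA d)) <= 5 * r * eps * l.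
Proof.
move=> sp; have /(statesP huB)[pp _] := sp.
have /almost : compressed_quasi_states e (fun d => (phi \o piB) (e ** d ** e)).
  by exists (phi \o piB) => //; apply: pullback_quasi_state sp.
move=> h; have /ereal_inf_lt : (ereal_inf [set blM LD r (fun d => (phi \o piB) (e ** d ** e)) y
    | y in dual piA (quasi_states A)] < eps%:E)%E by apply: le_lt_trans h _; rewrite lte_fin.
move=> [_ [_ [psi qpsi <-] <-]] hbl; exists psi => // d l l0 dd Ld nd.
have /(quasi_statesP huA)[pq _] := qpsi.
pose d' := l^-1%:C *: d.
have [piL piM piS] := piBm; have [piLA _ _] := piAm.
have piB0 : piB 0 = 0.
  by have := piL (-1) 0 0; rewrite scaler0 addr0 scaleN1r addNr.
have piA0 : piA 0 = 0.
  by have := piLA (-1) 0 0; rewrite scaler0 addr0 scaleN1r addNr.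
have piBZ c x : piB (c *: x) = c *: piB x by have := piL c x 0; rewrite piB0 !addr0.
have piAZ c x : piA (c *: x) = c *: piA x by have := piLA c x 0; rewrite piA0 !addr0.
have : rnorm (phi (piB (e ** d' ** e)) - psi (piA d')) <= eps.
  rewrite -lee_fin; apply: le_trans (ltW hbl); apply: nnsup_ubound.
  exists d' => //; split; first exact: dom_saZ.
  rewrite /normLM ge_max rnormZC gtr0_norm ?invr_gt0 //.
  rewrite snZC ?gtr0_norm ?invr_gt0 //; last by case: dd.
  by rewrite !ler_pdivrMl // !mulr1 [l * r]mulrC nd Ld.
rewrite cmulZr cmulZl piBZ piAZ (pfZ pp) (pfZ pq) -mulrBr crnormM rnormC.
rewrite gtr0_norm ?invr_gt0 // ler_pdivrMl // => h1.
have h2 : rnorm (phi (piB d) - phi (piB (e ** d ** e))) <= 4 * eps * (r * l).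
  rewrite -(pfB pp); apply: le_trans (state_bound huB _ sp) _.
  rewrite !piM; apply: le_trans (compression_close _) _.
  rewrite ler_wpM2l ?mulr_ge0 ?(ltW eps0) //.
  exact: le_trans (star_morphism_contractive huB piBm d) nd.
rewrite -(subrK (phi (piB (e ** d ** e))) (phi (piB d))) -addrA.
apply: le_trans (crnormD _ _) _.
have h3 : l * eps <= r * l * eps by rewrite ler_wpM2r ?(ltW eps0) // ler_peMl // ltW.
lra.
Qed.

(* The mass of [psi] is estimated on a lift of the unit of [B]. *)
Lemma state_transport phi : states B phi ->
  exists2 psi, states A psi & forall (d : D) (l : R), 0 < l -> dom_sa LD d ->
    LD d <= l -> rnorm d <= r * l -> rnorm (phi (piB d) - psi (piA d)) <= 12 * r * eps * l.
Proof.
move=> sp; have /(statesP huB)[pp p1] := sp.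
have [psi qpsi hpsi] := quasi_state_transport sp.
have /(quasi_statesP huA)[pq m1] := qpsi.
set m := pf_mass uA psi in m1.
have dB : dom_sa LB uB.
  have [h _] := sn_unit huB hncB 1; rewrite scale1r in h.
  by split=> //; exact: sa_unit.
have LuB : LB uB = 0 by have [_ h] := sn_unit huB hncB 1; rewrite scale1r in h.
(* The unit has seminorm 0 and norm 1, so that it lifts at scale [1 / r], up to the slack
   [eps / r]. *)
have [d0 [dd0 pd0 Ld0 nd0]] : exists x, [/\ dom_sa LD x, piB x = uB,
    LD x <= r^-1 + eps / r & rnorm x <= r * (r^-1 + eps / r)].
  apply: (isometry_lift iB) => //; rewrite ?LuB ?invr_ge0 ?(ltW r0) //; last exact: divr_gt0.
  by rewrite ler_piMr ?invr_ge0 ?(ltW r0) // rnorm_unit_le1.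
have l0 : 0 < r^-1 + eps / r by rewrite addr_gt0 ?invr_gt0 ?divr_gt0.
have := hpsi _ _ l0 dd0 Ld0 nd0; rewrite pd0 p1.
have -> : 5 * r * eps * (r^-1 + eps / r) = 5 * eps * (1 + eps) by field; rewrite gt_eqF.
move=> h1.
have nA : rnorm (piA d0) <= 1 + eps.
  apply: le_trans (star_morphism_contractive huA piAm d0) _; apply: le_trans nd0 _.
  by rewrite le_eqVlt; apply/orP; left; apply/eqP; field; rewrite gt_eqF.
have m0 : 0 <= m by exact: pf_mass_ge0.
have h2 : rnorm (psi (piA d0)) <= m * (1 + eps).
  by apply: le_trans (pf_bound huA pq _) _; rewrite ler_wpM2l.
have h3 : 1 <= m * (1 + eps) + 5 * eps * (1 + eps).
  have : rnorm (1 : R[i]) <= rnorm (1 - psi (piA d0)) + rnorm (psi (piA d0)).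
    by rewrite -{1}(subrK (psi (piA d0)) 1); exact: crnormD.
  have -> : rnorm (1 : R[i]) = 1 by rewrite /rnorm normr1.
  lra.
have me : m * eps <= 1 * eps by rewrite ler_wpM2r // ltW.
have ee : eps * eps <= 1 / 20 * eps by rewrite ler_wpM2r // ltW.
(* The missing mass is at most [eps + 5 eps (1 + eps) <= 7 eps]. Normalising [psi] therefore costs
   [7 eps (r l)], and [5 + 7] is the final constant 12. *)
have m7 : 1 - 7 * eps <= m by lra.
have mpos : 0 < m by apply: lt_le_trans m7; have := eps1; lra.
exists (fun a => m^-1%:C * psi a).
  apply/(statesP huA); split; last first.
    by rewrite pf_unitE // -/m -rmorphM /= mulVf ?gt_eqF.
  split=> [c x y|x]; first by rewrite (pfD pq) (pfZ pq) mulrDr mulrCA.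
  by rewrite mulr_ge0 // ?ler0c ?invr_ge0 //; exact: pq.2.
move=> d l lpos dd Ld nd.
have h4 := hpsi d l lpos dd Ld nd.
have h5 : rnorm (psi (piA d) - m^-1%:C * psi (piA d)) <= 7 * eps * (r * l).
  have -> : psi (piA d) - m^-1%:C * psi (piA d) = (1 - m^-1)%:C * psi (piA d).
    by rewrite rmorphB mulrBl mul1r.
  rewrite crnormM rnormC.
  have h6 : rnorm (psi (piA d)) <= m * (r * l).
    apply: le_trans (pf_bound huA pq _) _; rewrite ler_wpM2l //.
    exact: le_trans (star_morphism_contractive huA piAm d) nd.
  apply: le_trans (ler_wpM2l (normr_ge0 _) h6) _.
  rewrite [leLHS]mulrA ler_wpM2r ?mulr_ge0 ?(ltW r0) ?(ltW lpos) //.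
  have -> : `|1 - m^-1| * m = `|m - 1|.
    by rewrite -{2}(gtr0_norm mpos) -normrM mulrBl mul1r mulVf ?gt_eqF.
  by rewrite ler0_norm ?subr_le0 //; lra.
rewrite -(subrK (psi (piA d)) (phi (piB d))) -addrA.
apply: le_trans (crnormD _ _) _; lra.
Qed.

End CoreEstimate.

(** * The Lipschitz seminorm of the compact tunnel *)

Section StarMorphismFacts.
Variables (R : realType) (D E : cstarAlgType R) (p : D -> E).
Hypothesis hp : star_morphism p.

Lemma smor0 : p 0 = 0.
Proof. by case: hp => h _ _; have := h (-1) 0 0; rewrite scaler0 addr0 scaleN1r addNr. Qed.

Lemma smorD x y : p (x + y) = p x + p y.
Proof. by case: hp => h _ _; have := h 1 x y; rewrite !scale1r. Qed.

Lemma smorZ (c : R[i]) x : p (c *: x) = c *: p x.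
Proof. by case: hp => h _ _; have := h c x 0; rewrite smor0 !addr0. Qed.

Lemma smorM x y : p (x ** y) = p x ** p y.
Proof. by case: hp. Qed.

Lemma smorS x : p (star x) = star (p x).
Proof. by case: hp. Qed.

End StarMorphismFacts.

Section Link.
Variables (R : realType) (E D : cstarAlgType R) (LD : seminorm D) (p : D -> E) (u : E).
Variables (r eta : R).
Hypotheses (hu : is_unit u) (u1 : rnorm u = 1) (hp : star_morphism p).
Hypotheses (herm : hermitian_sn LD) (leib : leibniz LD).
Hypotheses (r1 : 1 <= r) (eta0 : 0 < eta) (eta1 : eta <= 1).
Implicit Types (x y : E) (d : D) (t c : R[i]) (l m : R).

(** Stated for a single morphism [p] into a unital algebra: with [p = (piA, piB)] into the direct
    sum, one norm inequality carries both conditions. The scalar [t] stands for the unit that [D]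
    may lack. *)
Definition linked x l := exists d t,
  [/\ sn_dom LD d, LD d <= l, rnorm d <= r * l & rnorm (x - t *: u - p d) <= eta * l].

Let r0 : 0 < r. Proof. exact: lt_le_trans r1. Qed.

Lemma linked_mono x l m : l <= m -> linked x l -> linked x m.
Proof.
move=> lm [d [t [dd Ld nd xd]]]; exists d, t; split=> //.
- exact: le_trans Ld lm.
- by apply: le_trans nd _; rewrite ler_pM2l.
- by apply: le_trans xd _; rewrite ler_pM2l.
Qed.

Lemma linkedD x y l m : linked x l -> linked y m -> linked (x + y) (l + m).
Proof.
move=> [d [t [dd Ld nd xd]]] [d' [t' [dd' Ld' nd' yd]]]; exists (d + d'), (t + t'); split.
- exact: sn_domD.
- by apply: le_trans (snD dd dd') _; rewrite lerD.
- by rewrite mulrDr; apply: le_trans (rnormD _ _) _; rewrite lerD.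
- have -> : x + y - (t + t') *: u - p (d + d') =
      (x - t *: u - p d) + (y - t' *: u - p d').
    by rewrite (smorD hp) scalerDl !opprD [x + y + _]addrACA [LHS]addrACA.
  by rewrite mulrDr; apply: le_trans (rnormD _ _) _; rewrite lerD.
Qed.

Lemma linkedZ c x l : linked x l -> linked (c *: x) (rnorm c * l).
Proof.
move=> [d [t [dd Ld nd xd]]]; exists (c *: d), (c * t); split.
- exact: sn_domZ.
- by rewrite snZ // ler_wpM2l // crnorm_ge0.
- by rewrite rnormZ mulrCA ler_wpM2l // crnorm_ge0.
- by rewrite (smorZ hp) -(scalerA c t u) -!scalerBr rnormZ mulrCA ler_wpM2l // crnorm_ge0.
Qed.

Lemma linked_star x l : linked x l -> linked (star x) l.
Proof.
move=> [d [t [dd Ld nd xd]]]; have [ds Ls] := herm dd; exists (star d), (t^*)%C; split=> //.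
- by rewrite Ls.
- by rewrite rnorm_star.
- by rewrite (smorS hp) -{1}(sa_unit hu) -starZ -!starB rnorm_star.
Qed.

Lemma linked_small x l : 0 <= l -> rnorm x <= eta * l -> linked x l.
Proof.
move=> l0 xl; exists 0, 0; split.
- exact: sn_dom0.
- by rewrite sn0.
- by rewrite rnorm0 mulr_ge0 // ltW.
- by rewrite scale0r (smor0 hp) !subr0.
Qed.

(* For [|x| <= eta l] the decomposition [d = 0], [t = 0] is allowed; otherwise
   [eta l < |x|] can be absorbed in the bound of [|t|]. *)
Lemma linked_bounded x l : 0 <= l -> linked x l -> exists d t,
  [/\ sn_dom LD d, LD d <= l, rnorm d <= r * l, rnorm (x - t *: u - p d) <= eta * l &
      rnorm t <= 2 * rnorm x + r * l].
Proof.
move=> l0 h; have [xl|xl] := leP (rnorm x) (eta * l).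
  exists 0, 0; split.
  - exact: sn_dom0.
  - by rewrite sn0.
  - by rewrite rnorm0 mulr_ge0 // ltW.
  - by rewrite scale0r (smor0 hp) !subr0.
  - by rewrite crnorm0 addr_ge0 // mulr_ge0 ?rnorm_ge0 // ltW.
have [d [t [dd Ld nd xd]]] := h; exists d, t; split=> //.
have -> : rnorm t = rnorm (t *: u) by rewrite rnormZ u1 mulr1.
have -> : t *: u = x - (x - t *: u - p d) - p d.
  by rewrite -addrA -opprD subrK opprB addrC subrK.
have h1 := rnormB (x - (x - t *: u - p d)) (p d).
have h2 := rnormB x (x - t *: u - p d).
have h3 := star_morphism_contractive hu hp d.
lra.
Qed.

(** Expanding [(t + d) (t' + d')] gives the scalar [t t'] and the element [d d' + t d' + t' d]. In
    the seminorm [d d'] contributes [2 r l m], and the bound [2 |x| + r l] on [|t|] contributes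
    [2 |x| m + r l m], likewise for [t']: hence 2 and [4 r]. *)
Lemma linkedM x y l m : 0 <= l -> 0 <= m -> linked x l -> linked y m ->
  linked (x ** y) (2 * (l * rnorm y + rnorm x * m) + 4 * r * l * m).
Proof.
move=> l0 m0 /(linked_bounded l0)[d [t [dd Ld nd xd tb]]].
move=> /(linked_bounded m0)[d' [t' [dd' Ld' nd' yd tb']]].
have [ddd Ldd] := leib dd dd'.
exists (d ** d' + (t *: d' + t' *: d)), (t * t').
have d0 := rnorm_ge0 d; have d'0 := rnorm_ge0 d'.
have L0 := sn_ge0 dd; have L'0 := sn_ge0 dd'.
have t0 := crnorm_ge0 t; have t'0 := crnorm_ge0 t'.
have x0 := rnorm_ge0 x; have y0 := rnorm_ge0 y.
have tm : rnorm t * m <= (2 * rnorm x + r * l) * m by rewrite ler_wpM2r.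
have tl : rnorm t' * l <= (2 * rnorm y + r * m) * l by rewrite ler_wpM2r.
have dlm : rnorm d * LD d' <= r * l * m by apply: ler_pM.
have ldm : LD d * rnorm d' <= l * (r * m) by apply: ler_pM.
have domt : sn_dom LD (t *: d') by exact: sn_domZ.
have domt' : sn_dom LD (t' *: d) by exact: sn_domZ.
split.
- by apply: sn_domD => //; exact: sn_domD.
- apply: le_trans (snD ddd (sn_domD domt domt')) _.
  have h1 := snD domt domt'; rewrite !snZ // in h1.
  have h2 : rnorm t * LD d' <= rnorm t * m by rewrite ler_wpM2l.
  have h3 : rnorm t' * LD d <= rnorm t' * l by rewrite ler_wpM2l.
  lra.
- apply: le_trans (rnormD _ _) _.
  have h1 := rnormD (t *: d') (t' *: d); rewrite !rnormZ in h1.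
  have h2 : rnorm t * rnorm d' <= rnorm t * (r * m) by rewrite ler_wpM2l.
  have h3 : rnorm t' * rnorm d <= rnorm t' * (r * l) by rewrite ler_wpM2l.
  have h4 : rnorm (d ** d') <= r * l * (r * m).
    by apply: le_trans (rnormM _ _) _; apply: ler_pM.
  have h5 : r * (rnorm t * m) <= r * ((2 * rnorm x + r * l) * m) by rewrite ler_pM2l.
  have h6 : r * (rnorm t' * l) <= r * ((2 * rnorm y + r * m) * l) by rewrite ler_pM2l.
  have h7 : 0 <= r * r * l * m by rewrite !mulr_ge0 // ltW.
  lra.
- pose s := t *: u + p d; pose s' := t' *: u + p d'.
  have xs : x - t *: u - p d = x - s by rewrite /s opprD addrA.
  have ys : y - t' *: u - p d' = y - s' by rewrite /s' opprD addrA.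
  rewrite xs in xd; rewrite ys in yd.
  have -> : x ** y - (t * t') *: u - p (d ** d' + (t *: d' + t' *: d)) = x ** y - s ** s'.
    rewrite /s /s' -addrA -opprD; congr (_ - _).
    rewrite !(smorD hp) !(smorZ hp) (smorM hp) cmulDl !cmulDr.
    rewrite !cmulZl !cmulZr !(umull hu) !(umulr hu) scalerA.
    by rewrite -!addrA; congr (_ + _); rewrite [LHS]addrC -addrA.
  (* In this form only the norms of [x] and [y] occur, not those of [s] and [s']; [eta <= 1] absorbs
     the quadratic term. *)
  have -> : x ** y - s ** s' = (x - s) ** y + x ** (y - s') - (x - s) ** (y - s').
    have e1 : x ** (y - s') - (x - s) ** (y - s') = s ** (y - s') by rewrite -cmulBl subKr.
    by rewrite -[RHS]addrA e1 cmulBl cmulBr addrA subrK.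
  have n1 := rnormM (x - s) y; have n2 := rnormM x (y - s').
  have n3 := rnormM (x - s) (y - s').
  have m1 : rnorm (x - s) * rnorm y <= eta * l * rnorm y by rewrite ler_wpM2r.
  have m2 : rnorm x * rnorm (y - s') <= rnorm x * (eta * m) by rewrite ler_wpM2l.
  have m3 : rnorm (x - s) * rnorm (y - s') <= eta * l * (eta * m).
    by apply: ler_pM => //; exact: rnorm_ge0.
  apply: le_trans (rnormB _ _) _.
  have n4 := rnormD ((x - s) ** y) (x ** (y - s')).
  have e2 : eta * (eta * l * m) <= 1 * (eta * l * m).
    by rewrite ler_wpM2r // !mulr_ge0 // ltW.
  have e3 : eta * l * m <= eta * r * l * m.
    by rewrite ler_wpM2r // ler_wpM2r // ler_peMr // ltW.
  have e4 : 0 <= eta * (l * rnorm y) by rewrite !mulr_ge0 // ltW.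
  have e5 : 0 <= eta * (rnorm x * m) by rewrite !mulr_ge0 // ltW.
  have e6 : 0 <= eta * r * l * m by rewrite !mulr_ge0 // ltW.
  lra.
Qed.

Definition link x : R := inf [set l | 0 <= l /\ linked x l].

Lemma linked_norm x : linked x (rnorm x / eta).
Proof.
apply: linked_small; first by rewrite divr_ge0 ?rnorm_ge0 // ltW.
by rewrite mulrCA divff ?mulr1 // gt_eqF.
Qed.

Lemma link_le x l : 0 <= l -> linked x l -> link x <= l.
Proof. by move=> l0 h; apply: ge_inf => //; exists 0 => m []. Qed.

Lemma link_ge x m : (forall l, 0 <= l -> linked x l -> m <= l) -> m <= link x.
Proof.
move=> h; apply: lb_le_inf => [|l [l0 hl]]; last exact: h.
by exists (rnorm x / eta); split; [rewrite divr_ge0 ?rnorm_ge0 // ltW|exact: linked_norm].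
Qed.

Lemma link_ge0 x : 0 <= link x.
Proof. exact: link_ge. Qed.

Lemma link_lt x l : link x < l -> linked x l.
Proof.
move=> h; apply: contrapT => hn; move: h; apply/negP; rewrite -leNgt.
apply: link_ge => m m0 hm; rewrite leNgt; apply/negP => ml; apply: hn.
exact: linked_mono (ltW ml) hm.
Qed.

Lemma linkD x y : link (x + y) <= link x + link y.
Proof.
rewrite -lerBlDr; apply: link_ge => l l0 hl; rewrite lerBlDr -lerBlDl.
apply: link_ge => m m0 hm; rewrite lerBlDl; apply: link_le; first exact: addr_ge0.
exact: linkedD.
Qed.

Lemma link_leZ c x : link (c *: x) <= rnorm c * link x.
Proof.
have [->|c0] := eqVneq c 0.
  rewrite scale0r crnorm0 mul0r; apply: link_le => //; apply: linked_small => //.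
  by rewrite rnorm0 mulr0.
have cp : 0 < rnorm c.
  by rewrite lt_neqAle crnorm_ge0 andbT; apply: contraNneq c0 => e;
     rewrite -normr_eq0 normr_rnorm -e.
rewrite -ler_pdivrMl //; apply: link_ge => l l0 hl; rewrite ler_pdivrMl //.
by apply: link_le; [rewrite mulr_ge0 // ltW|exact: linkedZ].
Qed.

Lemma linkZ c x : link (c *: x) = rnorm c * link x.
Proof.
apply/eqP; rewrite eq_le link_leZ /=.
have [->|c0] := eqVneq c 0; first by rewrite crnorm0 mul0r link_ge0.
have := link_leZ c^-1 (c *: x); rewrite scalerA mulVf // scale1r => h.
apply: le_trans (ler_wpM2l (crnorm_ge0 c) h) _.
by rewrite mulrA -crnormM divff // crnorm1 mul1r.
Qed.

Lemma link_star x : link (star x) = link x.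
Proof.
suff h y : link (star y) <= link y by apply/eqP; rewrite eq_le h -{1}(starK x) h.
by apply: link_ge => l l0 hl; apply: link_le => //; exact: linked_star.
Qed.

Lemma link_norm x : link x <= rnorm x / eta.
Proof. by apply: link_le; [rewrite divr_ge0 ?rnorm_ge0 // ltW|exact: linked_norm]. Qed.

Lemma linkM x y : link (x ** y) <= 2 * (link x * rnorm y + rnorm x * link y) + 4 * r * link x * link y.
Proof.
have x0 := rnorm_ge0 x; have y0 := rnorm_ge0 y.
have lx0 := link_ge0 x; have ly0 := link_ge0 y.
set X := link x in lx0 *; set Y := link y in ly0 *.
have bound e : 0 < e -> link (x ** y) <=
    2 * ((X + e) * rnorm y + rnorm x * (Y + e)) + 4 * r * (X + e) * (Y + e).
  move=> e0; have Xe : 0 <= X + e by rewrite addr_ge0 // ltW.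
  have Ye : 0 <= Y + e by rewrite addr_ge0 // ltW.
  apply: link_le.
    by rewrite addr_ge0 ?mulr_ge0 ?addr_ge0 ?mulr_ge0 // ltW.
  by apply: linkedM => //; apply: link_lt; rewrite ltrDl.
apply/ler_addgt0Pr => e e0.
(* For [f <= 1], replacing [X], [Y] by [X + f], [Y + f] raises the bound by at most [f K]; the final
   1 keeps [K] positive. *)
pose K := 2 * (rnorm y + rnorm x) + 4 * r * (X + Y + 1) + 1.
have K1 : 1 <= K.
  by rewrite lerDr !addr_ge0 ?mulr_ge0 ?addr_ge0 // ltW.
have K0 : 0 < K := lt_le_trans ltr01 K1.
pose f := Num.min 1 (e / K).
have f0 : 0 < f by rewrite lt_min ltr01 divr_gt0.
have f1 : f <= 1 by rewrite ge_min lexx.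
have fK : f * K <= e by rewrite -ler_pdivlMr // ge_min lexx orbT.
apply: le_trans (bound f f0) _.
have ff : r * (f * f) <= r * (f * 1) by rewrite ler_pM2l // ler_pM2l.
by rewrite /K in fK; lra.
Qed.
End Link.

(** * Weak* topology and marginals of states *)

Section Topology.
Variables (R : realType) (V : normedModType R[i]).

Lemma dense_rnormP (S : set V) :
  dense S <-> forall x (e : R), 0 < e -> exists2 y, S y & rnorm (x - y) < e.
Proof.
split=> [dS x e e0|h U [x Ux] oU].
  have [||y [Uy Sy]] := dS (ball x e%:C)^°.
  - by exists x; apply: nbhsx_ballx; rewrite -[0]/(0%:C) ltcR.
  - exact: open_interior.
  by exists y => //; apply: rballP; exact: (@interior_subset _ (ball x e%:C)).
have : nbhs x U by exact: open_nbhs_nbhs.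
move=> /nbhs_ballP[_ /gt0_complex[e e0 ->] bU].
by have [y Sy xy] := h x e e0; exists y; split=> //; apply/bU/rball.
Qed.

Lemma closed_rnormP (S : set V) :
  closed S <-> forall x, (forall e : R, 0 < e -> exists2 y, S y & rnorm (x - y) < e) -> S x.
Proof.
split=> [cS x h|h x cx].
  apply: cS => U /nbhs_ballP[_ /gt0_complex[e e0 ->] bU].
  by have [y Sy xy] := h e e0; exists y; split=> //; apply/bU/rball.
apply: h => e e0; have [|y [Sy xy]] := cx (ball x e%:C).
  by apply: nbhsx_ballx; rewrite -[0]/(0%:C) ltcR.
by exists y => //; exact: rballP.
Qed.

End Topology.

Section WeakStar.
Variables (R : realType) (A : cstarAlgType R).
Implicit Types (phi psi : A -> R[i]).

Lemma evaluation_cvg phi (x : A) :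
  (fun g : {ptws A -> R[i]^o} => (g x : R[i]^o)) @ nbhs (phi : {ptws A -> R[i]^o}) --> (phi x : R[i]^o).
Proof.
have /pointwise_cvgP : {ptws, nbhs (phi : {ptws A -> R[i]^o}) --> (phi : A -> R[i]^o)} by [].
exact.
Qed.

Lemma evaluation_near phi (x : A) (e : R) : 0 < e ->
  \forall psi \near (phi : {ptws A -> R[i]^o}), rnorm (phi x - psi x : R[i]) < e.
Proof.
move=> e0; have /cvg_ballP/(_ e%:C) := @evaluation_cvg phi x.
rewrite -[0]/(0%:C) ltcR => /(_ e0).
by apply: filterS => psi; exact: (@rballP R R[i]^o).
Qed.

(** The sets containing an [mk]-ball of states form a filter [F], which converges to [phi]
    pointwise: on the domain by splitting into real and imaginary parts, elsewhere by density and
    the contractivity of states. *)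
Lemma mk_ball_weakstar (L : seminorm A) (u : A) phi (U : set (A -> R[i])) :
  is_unit u -> hermitian_sn L -> dense (sn_dom L) -> states A phi ->
  within (states A) (nbhs (phi : {ptws A -> R[i]^o})) U ->
  exists2 eps : R, 0 < eps &
    forall psi, states A psi -> (mk L phi psi < eps%:E)%E -> U psi.
Proof.
move=> hu hL /dense_rnormP dL sp.
pose F : set_system {ptws A -> R[i]^o} := [set V : set {ptws A -> R[i]^o} | exists2 eps : R, 0 < eps &
  forall psi, states A psi -> (mk L phi psi < eps%:E)%E -> V psi].
have FF : Filter F.
  split.
  - by exists 1.
  - move=> P Q [e e0 hP] [f f0 hQ]; exists (Num.min e f).
      by rewrite lt_min e0.
    move=> psi sq; rewrite /= EFin_min lt_min => /andP[h1 h2].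
    by split; [exact: hP|exact: hQ].
  - by move=> P Q PQ [e e0 hP]; exists e => // psi sq h; exact/PQ/hP.
have /pointwise_cvgP H : forall x, (fun g : {ptws A -> R[i]^o} => (g x : R[i]^o)) @ F --> (phi x : R[i]^o).
  move=> x; apply/cvg_ballP => _ /gt0_complex[e e0 ->].
  have e4 : 0 < e / 4 by rewrite divr_gt0.
  have [y dy xy] := dL x _ e4.
  have l0 := sn_ge0 dy; have l1 : 0 < L y + 1 by rewrite ltr_wpDl.
  exists (e / 8 / (L y + 1)); first by rewrite !divr_gt0.
  move=> psi sq /ltW h /=; apply: (@rball R R[i]^o).
  have /(statesP hu)[pp _] := sp; have /(statesP hu)[pq _] := sq.
  have [dre Lre] := sn_Repart hL dy; have [dim Lim] := sn_Impart hL dy.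
  have h1 := mk_lt_dist pp pq h l0 dre Lre; have h2 := mk_lt_dist pp pq h l0 dim Lim.
  have hl : e / 8 / (L y + 1) * L y <= e / 8.
    by rewrite mulrAC ler_pdivrMr // ler_wpM2l ?divr_ge0 ?(ltW e0) // lerDl.
  have yb : rnorm (phi y - psi y) <= e / 4.
    rewrite (pf_ReIm pp y) (pf_ReIm pq y).
    have -> : phi (Repart y) + 'i * phi (Impart y) - (psi (Repart y) + 'i * psi (Impart y)) =
      (phi (Repart y) - psi (Repart y)) + 'i * (phi (Impart y) - psi (Impart y)) by ring.
    apply: le_trans (crnormD _ _) _; rewrite crnormM crnormi mul1r; lra.
  have -> : phi x - psi x = phi (x - y) + (phi y - psi y) - psi (x - y).
    by rewrite (pfB pp) (pfB pq); ring.
  have b1 := state_bound hu (x - y) sp; have b2 := state_bound hu (x - y) sq.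
  have := crnormD (phi (x - y) + (phi y - psi y)) (- psi (x - y)).
  have := crnormD (phi (x - y)) (phi y - psi y); rewrite crnormN.
  rewrite /rnorm in yb b1 b2 xy *; lra.
move=> /H[e e0 h]; exists e => // psi sq hm; exact: (h psi sq hm sq).
Qed.

End WeakStar.

Section Normalise.
Variables (R : realType) (A : cstarAlgType R) (u : A).
Hypothesis hu : is_unit u.

Lemma normalised_state (f : A -> R[i]) : positive_functional f -> pf_mass u f != 0 ->
  states A (fun a => (pf_mass u f)^-1%:C * f a).
Proof.
move=> pf m0; apply/(statesP hu); split; last first.
  by rewrite (pf_unitE hu pf) -rmorphM /= mulVf.
split=> [c x y|x]; first by rewrite (pfD pf) (pfZ pf) mulrDr mulrCA.
by rewrite mulr_ge0 ?ler0c ?invr_ge0 ?pf_mass_ge0 //; exact: pf.2.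
Qed.

Lemma massless (f : A -> R[i]) a : positive_functional f -> pf_mass u f = 0 -> f a = 0.
Proof.
move=> pf m0; have := pf_bound hu pf a; rewrite m0 mul0r => h.
by apply/eqP; rewrite -normr_eq0 normr_rnorm (_ : rnorm _ = 0) //;
   apply/eqP; rewrite eq_le h crnorm_ge0.
Qed.

End Normalise.

Section Marginal.
Variables (R : realType) (A E : cstarAlgType R) (LA : seminorm A).
Variables (uA : A) (uE : E) (mu : A -> R[i]) (j : A -> E) (r : R).
Hypotheses (hu : is_unit uA) (huE : is_unit uE) (hmu : states A mu).
Hypotheses (hr : (qdiam LA < r%:E)%E) (r1 : 1 <= r).
Hypothesis weak : induces_weakstar (mk LA).
Hypothesis jpos : forall phi, positive_functional phi -> positive_functional (phi \o j).
Hypothesis j1 : rnorm (j uA) <= 1.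

Local Notation mass psi := (pf_mass uA (psi \o j)).

Lemma mass_le1 psi : states E psi -> mass psi <= 1.
Proof.
move=> sp; apply: le_trans (Re_le_rnorm _) _.
by apply: le_trans (state_bound huE _ sp) _.
Qed.

(* If the marginal of [phi] vanishes, any state serves as [chi]: nearby marginals
   have a small mass, and normalised they are at distance at most [r] from [chi]. *)
Lemma marginal_near phi : states E phi -> exists chi : A -> R[i],
  [/\ states A chi, forall a, phi (j a) = (mass phi)%:C * chi a &
   forall d : R, 0 < d -> \forall psi \near (phi : {ptws E -> R[i]^o}), states E psi ->
     forall a, dom_sa LA a -> LA a <= 1 ->
       rnorm (psi (j a) - (mass psi)%:C * chi a) <= d].
Proof.
move=> sp; have /(statesP huE)[pp _] := sp.
have hmass psi : states E psi -> positive_functional (psi \o j).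
  by move=> /(statesP huE)[pq _]; exact: jpos.
have FF : Filter (nbhs (phi : {ptws E -> R[i]^o})) by exact: nbhs_filter.
have [m0|m0] := eqVneq (mass phi) 0.
  exists mu; split=> //.
    by move=> a; rewrite m0 mul0r; exact: (massless hu a (hmass _ sp) m0).
  move=> d d0; have r0 : 0 < r by exact: lt_le_trans r1.
  have := evaluation_near phi (j uA) (divr_gt0 d0 r0).
  apply: filterS => psi hpsi sq a da La.
  have pq := hmass _ sq; have mq0 := pf_mass_ge0 hu pq.
  have mE : mass psi < d / r.
    have := hpsi; have -> : phi (j uA) = 0 by exact: (massless hu uA (hmass _ sp) m0).
    by rewrite sub0r crnormN; apply: le_lt_trans; exact: Re_le_rnorm.
  have [q0|q0] := eqVneq (mass psi) 0.
    rewrite q0 mul0r subr0 (massless hu a pq q0 : psi (j a) = 0) crnorm0; exact: ltW.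
  have snu := normalised_state hu pq q0.
  have /(statesP hu)[pnu _] := snu; have /(statesP hu)[pmu _] := hmu.
  have := mk_lt_dist pnu pmu (qdiam_mk hr snu hmu) ler01 da La.
  rewrite mulr1 => h.
  have -> : psi (j a) - (mass psi)%:C * mu a =
      (mass psi)%:C * ((mass psi)^-1%:C * psi (j a) - mu a).
    by rewrite mulrBr mulrA -rmorphM /= divff // mul1r.
  rewrite crnormM rnormC ger0_norm //.
  apply: le_trans (ler_wpM2l mq0 h) _.
  by rewrite -ler_pdivlMr // ltW.
pose T (psi : E -> R[i]) (a : A) : R[i] := (mass psi)^-1%:C * psi (j a).
have sT : states A (T phi) by exact: normalised_state (hmass _ sp) m0.
exists (T phi); split=> //.
  by move=> a; rewrite /T mulrA -rmorphM /= divff // mul1r.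
move=> d d0.
have : within (states A) (nbhs (T phi : {ptws A -> R[i]^o}))
    [set chi | (mk LA (T phi) chi < d%:E)%E].
  by apply/(weak sT); exists d.
have ev (x : E) := @evaluation_cvg R E phi x.
(* Dividing by [psi (j uA)] instead of its real part gives the same result on states and makes
   pointwise convergence a matter of limits of quotients. *)
pose T' (psi : {ptws E -> R[i]^o}) : {ptws A -> R[i]^o} := fun a => (psi (j uA))^-1 * psi (j a).
have T'E psi : states E psi -> T' psi = T psi.
  move=> sq; apply/funext => a; rewrite /T' /T fmorphV; congr (_^-1 * _).
  exact: (pf_unitE hu (hmass _ sq)).
have : T' @ nbhs (phi : {ptws E -> R[i]^o}) --> (T phi : {ptws A -> R[i]^o}).
  rewrite -(T'E _ sp); apply/pointwise_cvgP => a.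
  have nz : phi (j uA) != 0.
    by rewrite -[phi _]/((phi \o j) uA) (pf_unitE hu (hmass _ sp)) -(rmorph0 (real_complex R)) (inj_eq (@complexI R)).
  have := cvgM (cvgV nz (ev (j uA))) (ev (j a)).
  exact.
move=> cT /cT H; apply: (@filterS _ _ FF _ _ _ H) => psi /= h sq a da La.
have pq := hmass _ sq.
have [q0|q0] := eqVneq (mass psi) 0.
  rewrite q0 mul0r subr0 (massless hu a pq q0 : psi (j a) = 0) crnorm0; exact: ltW.
have snu := normalised_state hu pq q0.
have := h; rewrite (T'E _ sq) => /(_ snu)/ltW hm.
have /(statesP hu)[pnu _] := snu; have /(statesP hu)[pT _] := sT.
have := mk_lt_dist pT pnu hm ler01 da La; rewrite mulr1 => {}h.
have -> : psi (j a) - (mass psi)%:C * T phi a =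
    - ((mass psi)%:C * (T phi a - (mass psi)^-1%:C * psi (j a))).
  have e : (mass psi)%:C * ((mass psi)^-1%:C * psi (j a)) = psi (j a).
    by rewrite mulrA -rmorphM /= divff // mul1r.
  by rewrite mulrBr e opprB.
rewrite crnormN crnormM rnormC ger0_norm ?(pf_mass_ge0 hu pq) //.
apply: le_trans h; rewrite ler_piMl ?crnorm_ge0 //; exact: mass_le1.
Qed.

End Marginal.

Lemma leibniz_bound (R : realType) (r a b na nb X Y nX nY : R) : 0 <= r ->
  0 <= a <= X -> 0 <= b <= Y -> 0 <= na <= nX -> 0 <= nb <= nY ->
  na * b + a * nb <= 2 * (X * nY + nX * Y) + 4 * r * X * Y.
Proof.
move=> r0 /andP[a0 aX] /andP[b0 bY] /andP[na0 naX] /andP[nb0 nbY].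
have h1 : na * b <= nX * Y by apply: ler_pM.
have h2 : a * nb <= X * nY by apply: ler_pM.
have h3 : 0 <= r * X * Y.
  by rewrite !mulr_ge0 //; [exact: le_trans aX|exact: le_trans bY].
have h4 : 0 <= na * b by rewrite mulr_ge0.
have h5 : 0 <= a * nb by rewrite mulr_ge0.
lra.
Qed.

Lemma link_bound (R : realType) (r a b X Y nX nY : R) : 0 <= r ->
  0 <= a <= X -> 0 <= b <= Y -> 0 <= nX -> 0 <= nY ->
  2 * (a * nY + nX * b) + 4 * r * a * b <= 2 * (X * nY + nX * Y) + 4 * r * X * Y.
Proof.
move=> r0 /andP[a0 aX] /andP[b0 bY] nX0 nY0.
have h1 : a * nY <= X * nY by rewrite ler_wpM2r.
have h2 : nX * b <= nX * Y by rewrite ler_wpM2l.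
have h3 : r * (a * b) <= r * (X * Y) by rewrite ler_wpM2l // ler_pM.
lra.
Qed.

(** [g] and [f] are the two restrictions of a state of a direct sum. Only [f] moves: its
    normalisation is transported, scaled back by the mass of [f] and added to [g], so that the error
    is multiplied by a mass at most 1. *)
Lemma mixed_state_transport (R : realType) (C1 C2 : cstarAlgType R) (u1 : C1) (u2 : C2)
    (g : C1 -> R[i]) (f : C2 -> R[i]) (ball : C1 -> C2 -> Prop) (k : R) :
  is_unit u1 -> is_unit u2 -> positive_functional g -> positive_functional f ->
  pf_mass u1 g = 1 - pf_mass u2 f -> pf_mass u2 f <= 1 -> 0 <= k ->
  (forall phi, states C2 phi -> exists2 psi, states C1 psi &
     forall a b, ball a b -> rnorm (phi b - psi a) <= k) ->
  exists2 psi, states C1 psi & forall a b, ball a b -> rnorm (g a + f b - psi a) <= k.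
Proof.
move=> hu1 hu2 pg pf mE m1 k0 h.
have [m0|m0] := eqVneq (pf_mass u2 f) 0.
  exists g; last by move=> a b _; rewrite (massless hu2 b pf m0) addr0 subrr crnorm0.
  by apply/(statesP hu1); split=> //; rewrite (pf_unitE hu1 pg) mE m0 subr0.
have [chi sc hc] := h _ (normalised_state hu2 pf m0).
set m := pf_mass u2 f in mE m1 m0 hc.
have mp : 0 <= m := pf_mass_ge0 hu2 pf.
have /(statesP hu1)[pc c1] := sc.
exists (fun a => g a + m%:C * chi a).
  apply/(statesP hu1); split; last first.
    by rewrite (pf_unitE hu1 pg) c1 mulr1 mE -rmorphD /= subrK.
  split=> [c x y|x].
    by rewrite (pfD pg) (pfZ pg) (pfD pc) (pfZ pc); ring.
  by rewrite addr_ge0 ?mulr_ge0 ?ler0c //; [exact: pg.2|exact: pc.2].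
move=> a b /hc hab.
have -> : g a + f b - (g a + m%:C * chi a) = m%:C * (m^-1%:C * f b - chi a).
  have e : m%:C * (m^-1%:C * f b) = f b by rewrite mulrA -rmorphM /= divff // mul1r.
  by rewrite mulrBr e; ring.
rewrite crnormM rnormC ger0_norm //; apply: le_trans hab.
by rewrite ler_piMl ?crnorm_ge0.
Qed.

(** * The compact tunnel on the direct sum *)

Section TunnelSeminorm.
Variables (R : realType) (A B D : cstarAlgType R).
Variables (LA : seminorm A) (LB : seminorm B) (LD : seminorm D).
Variables (uA : A) (uB : B) (muA : A -> R[i]) (muB : B -> R[i]).
Variables (piA : D -> A) (piB : D -> B) (r eta : R).
Hypotheses (hA : qcms LA) (hB : qcms LB) (hmuA : states A muA) (hmuB : states B muB).
Hypotheses (huA : is_unit uA) (huB : is_unit uB).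
Hypotheses (qA : (qdiam LA < r%:E)%E) (qB : (qdiam LB < r%:E)%E).
Hypotheses (herm : hermitian_sn LD) (leib : leibniz LD).
Hypotheses (iA : quantum_M_isometry LD LA r piA) (iB : quantum_M_isometry LD LB r piB).
Hypotheses (r1 : 1 <= r) (eta0 : 0 < eta) (eta1 : eta <= 1).

Local Notation E := (csum A B).
Implicit Types (x y : E).

Let uE : E := (uA, uB).
Let p (d : D) : E := (piA d, piB d).

Let huE : is_unit uE. Proof. exact: csum_is_unit. Qed.
Let piAm : star_morphism piA. Proof. by case: iA => -[]. Qed.
Let piBm : star_morphism piB. Proof. by case: iB => -[]. Qed.
Let r0 : 0 < r. Proof. exact: lt_le_trans r1. Qed.

Let uE1 : rnorm uE = 1.
Proof. by rewrite csum_rnorm /= (rnorm_unit huA hmuA) (rnorm_unit huB hmuB) maxxx. Qed.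

Let pm : star_morphism p.
Proof.
split=> [c x y|x y|x]; rewrite /p.
- by rewrite (smorD piAm) (smorD piBm) (smorZ piAm) (smorZ piBm).
- by rewrite (smorM piAm) (smorM piBm).
- by rewrite (smorS piAm) (smorS piBm).
Qed.

Let lnk := link LD p uE r eta.

Definition tsn_dom : set E := [set x | sn_dom LA x.1 /\ sn_dom LB x.2].
Definition tsn_val x : R := Num.max (Num.max (LA x.1) (LB x.2)) (lnk x).

Lemma tsn_le x k : LA x.1 <= k -> LB x.2 <= k -> lnk x <= k -> tsn_val x <= k.
Proof. by rewrite /tsn_val !ge_max => -> -> ->. Qed.

Lemma tsn_ge1 x : LA x.1 <= tsn_val x.
Proof. by rewrite /tsn_val !le_max lexx. Qed.

Lemma tsn_ge2 x : LB x.2 <= tsn_val x.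
Proof. by rewrite /tsn_val !le_max lexx orbT. Qed.

Lemma tsn_ge3 x : lnk x <= tsn_val x.
Proof. by rewrite /tsn_val le_max lexx orbT. Qed.

Lemma tsn_dom0 : tsn_dom 0.
Proof. by split; exact: sn_dom0. Qed.

Lemma tsn_domD x y : tsn_dom x -> tsn_dom y -> tsn_dom (x + y).
Proof. by move=> [? ?] [? ?]; split; exact: sn_domD. Qed.

Lemma tsn_domZ (c : R[i]) x : tsn_dom x -> tsn_dom (c *: x).
Proof. by move=> [? ?]; split; exact: sn_domZ. Qed.

Lemma lnk_ge0 x : 0 <= lnk x.
Proof. exact: link_ge0. Qed.

Lemma tsn_ge0 x : tsn_dom x -> 0 <= tsn_val x.
Proof. by move=> _; apply: le_trans (lnk_ge0 x) (tsn_ge3 x). Qed.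

Lemma tsnD x y : tsn_dom x -> tsn_dom y -> tsn_val (x + y) <= tsn_val x + tsn_val y.
Proof.
move=> [d1 d2] [d1' d2']; apply: tsn_le.
- by apply: le_trans (snD d1 d1') _; rewrite lerD ?tsn_ge1.
- by apply: le_trans (snD d2 d2') _; rewrite lerD ?tsn_ge2.
- by apply: le_trans (linkD _ _ pm r1 eta0 x y) _; rewrite lerD ?tsn_ge3.
Qed.

Lemma tsnZ (c : R[i]) x : tsn_dom x -> tsn_val (c *: x) = rnorm c * tsn_val x.
Proof.
move=> [d1 d2]; rewrite /tsn_val /lnk (linkZ _ _ pm r1 eta0) (snZ _ d1) (snZ _ d2).
by rewrite !maxr_pMr // crnorm_ge0.
Qed.

Definition tsn : seminorm E :=
  Seminorm tsn_dom0 tsn_domD tsn_domZ tsn_ge0 tsnD tsnZ.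

Let hermA : hermitian_sn LA. Proof. by case: hA => -[_ []]. Qed.
Let hermB : hermitian_sn LB. Proof. by case: hB => -[_ []]. Qed.
Let ncA : norm_mod_constants LA. Proof. by case: hA => -[_ []]. Qed.
Let ncB : norm_mod_constants LB. Proof. by case: hB => -[_ []]. Qed.

Lemma tsn_hermitian : hermitian_sn tsn.
Proof.
move=> x [d1 d2]; have [d1' L1] := hermA d1; have [d2' L2] := hermB d2.
split; first by split.
by rewrite /= /tsn_val /= L1 L2 /lnk (link_star huE pm herm r1 eta0).
Qed.

Lemma tsn_product x y : sn_dom tsn x -> sn_dom tsn y ->
  sn_dom tsn (x ** y) /\
  tsn (x ** y) <= 2 * (tsn x * rnorm y + rnorm x * tsn y) + 4 * r * tsn x * tsn y.
Proof.
move=> dx dy; have [d1 d2] := dx; have [d1' d2'] := dy.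
have [dA leA] := hA.2 _ _ d1 d1'; have [dB leB] := hB.2 _ _ d2 d2'.
split; first by split.
rewrite /=; apply: tsn_le.
- apply: le_trans leA _; apply: leibniz_bound; rewrite ?(ltW r0) //.
  + by rewrite sn_ge0 // tsn_ge1.
  + by rewrite sn_ge0 // tsn_ge1.
  + by rewrite rnorm_ge0 csum_rnorm1.
  + by rewrite rnorm_ge0 csum_rnorm1.
- apply: le_trans leB _; apply: leibniz_bound; rewrite ?(ltW r0) //.
  + by rewrite sn_ge0 // tsn_ge2.
  + by rewrite sn_ge0 // tsn_ge2.
  + by rewrite rnorm_ge0 csum_rnorm2.
  + by rewrite rnorm_ge0 csum_rnorm2.
- apply: le_trans (linkM huE uE1 pm leib r1 eta0 eta1 x y) _.
  apply: link_bound; rewrite ?(ltW r0) ?rnorm_ge0 //.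
  + by rewrite lnk_ge0 tsn_ge3.
  + by rewrite lnk_ge0 tsn_ge3.
Qed.

Lemma tsn_CD_leibniz : CD_leibniz tsn 2 (4 * r).
Proof.
move=> x y [dx _] [dy _]; have [dxy h] := tsn_product dx dy.
rewrite ge_max; apply/andP; split; apply: le_trans h.
  by case: (sn_Repart tsn_hermitian dxy).
by case: (sn_Impart tsn_hermitian dxy).
Qed.

Lemma lnk_approx x l : lnk x < l -> exists d t,
  [/\ sn_dom LD d, LD d <= l, rnorm d <= r * l & rnorm (x - t *: uE - p d) <= eta * l].
Proof. exact: link_lt. Qed.

(** The vanishing of [LA] and [LB] yields two scalars, one for each summand; the vanishing of [lnk]
    puts both within [(eta + r) e] of a common [t], for every [e]. *)
Lemma tsn_norm_mod_constants : norm_mod_constants tsn.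
Proof.
split=> [nu|v hv]; first by exfalso; apply: nu; exists uE.
have -> : v = uE by rewrite -[v](umulr huE) (umull hv).
apply/seteqP; split=> [x [[d1 d2] /= x0]|_ [c _ <-]]; last first.
  have [dA lA] := sn_unit huA ncA c; have [dB lB] := sn_unit huB ncB c.
  split; first by split.
  apply/eqP; rewrite eq_le tsn_ge0 ?andbT; last by split.
  apply: tsn_le; rewrite /= ?lA ?lB //.
  apply: link_le => //; exists 0, c; split; first exact: sn_dom0.
  - by rewrite sn0.
  - by rewrite rnorm0 mulr0.
  - by rewrite (smor0 pm) subrr subr0 rnorm0 mulr0.
have zA : LA x.1 = 0.
  by apply/eqP; rewrite eq_le sn_ge0 // andbT -x0 tsn_ge1.
have zB : LB x.2 = 0.
  by apply/eqP; rewrite eq_le sn_ge0 // andbT -x0 tsn_ge2.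
have zN : lnk x = 0.
  by apply/eqP; rewrite eq_le lnk_ge0 andbT -x0 tsn_ge3.
have [c _ cE] : [set c *: uA | c in [set: R[i]]] x.1 by rewrite -(ncA.2 _ huA).
have [c' _ cE'] : [set c *: uB | c in [set: R[i]]] x.2 by rewrite -(ncB.2 _ huB).
exists c => //; rewrite /uE [RHS]surjective_pairing -cE -cE'.
congr pair; suff : c - c' = 0 by move/subr0_eq ->.
apply: (@rnorm_small0 R R[i]^o _ (2 * (eta + r))) => e e0.
have [|d [t [_ _ nd hd]]] := @lnk_approx x e; first by rewrite zN.
have b1 : rnorm (c - t) <= eta * e + r * e.
  have -> : rnorm (c - t) = rnorm ((c - t) *: uA) by rewrite rnormZ (rnorm_unit huA hmuA) mulr1.
  have -> : (c - t) *: uA = (x - t *: uE - p d).1 + piA d.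
    by rewrite /= subrK scalerBl cE.
  apply: le_trans (rnormD _ _) _; rewrite lerD //.
    exact: le_trans (csum_rnorm1 _) hd.
  exact: le_trans (star_morphism_contractive huA piAm d) nd.
have b2 : rnorm (c' - t) <= eta * e + r * e.
  have -> : rnorm (c' - t) = rnorm ((c' - t) *: uB) by rewrite rnormZ (rnorm_unit huB hmuB) mulr1.
  have -> : (c' - t) *: uB = (x - t *: uE - p d).2 + piB d.
    by rewrite /= subrK scalerBl cE'.
  apply: le_trans (rnormD _ _) _; rewrite lerD //.
    exact: le_trans (csum_rnorm2 _) hd.
  exact: le_trans (star_morphism_contractive huB piBm d) nd.
have -> : c - c' = (c - t) + - (c' - t) by ring.
apply: le_trans (crnormD _ _) _; rewrite crnormN; lra.
Qed.

Lemma tsn_lipschitz : lipschitz_seminorm tsn.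
Proof.
have [[_ [_ _ dnA sA cA] _ _] _] := hA; have [[_ [_ _ dnB sB cB] _ _] _] := hB.
split.
- exact: tsn_hermitian.
- exact: tsn_norm_mod_constants.
- apply/dense_rnormP => x e e0.
  have [a da xa] := (dense_rnormP _).1 dnA x.1 e e0.
  have [b db xb] := (dense_rnormP _).1 dnB x.2 e e0.
  by exists (a, b); [split|rewrite csum_rnorm gt_max /= xa].
- case: sA => _ _ _ sAM sAS; case: sB => _ _ _ sBM sBS; split.
  + exact: tsn_dom0.
  + exact: tsn_domD.
  + exact: tsn_domZ.
  + by move=> x y [? ?] [? ?]; split; [exact: sAM|exact: sBM].
  + by move=> x [? ?]; split; [exact: sAS|exact: sBS].
- apply/closed_rnormP => x hx.
  have : [set a | dom_sa LA a /\ LA a <= 1] x.1.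
    apply: (closed_rnormP _).1 cA _ _ => e /hx[y [[[d1 d2] /csum_sa[s1 s2]] y1] xy].
    exists y.1; last exact: le_lt_trans (csum_rnorm1 (x - y)) xy.
    by split=> //; apply: le_trans y1; exact: tsn_ge1.
  move=> [[d1 s1] L1].
  have : [set a | dom_sa LB a /\ LB a <= 1] x.2.
    apply: (closed_rnormP _).1 cB _ _ => e /hx[y [[[d1' d2'] /csum_sa[s1' s2']] y1] xy].
    exists y.2; last exact: le_lt_trans (csum_rnorm2 (x - y)) xy.
    by split=> //; apply: le_trans y1; exact: tsn_ge2.
  move=> [[d2 s2] L2].
  split; first by split; [split|apply/csum_sa].
  (* By [link_norm], a move of norm at most [eta e] changes the link by at most [e]. *)
  apply: tsn_le => //; apply/ler_addgt0Pr => e e0.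
  have [y [_ y1] xy] := hx _ (mulr_gt0 eta0 e0).
  rewrite -(subrK y x) addrC; apply: le_trans (linkD _ _ pm r1 eta0 _ _) _.
  rewrite lerD //; first exact: le_trans (tsn_ge3 y) y1.
  apply: le_trans (link_norm _ _ pm r1 eta0 _) _.
  by rewrite ler_pdivrMr // mulrC ltW.
Qed.

Lemma isometry_dom (C : cstarAlgType R) (LC : seminorm C) (pi : D -> C) d :
  quantum_M_isometry LD LC r pi -> dom_sa LD d -> dom_sa LC (pi d) /\ LC (pi d) <= LD d.
Proof.
move=> [[pim _] _ dm _ Lpi] dd; split; last exact: Lpi.
split; last by rewrite /sa /= -(smorS pim); case: dd => _ ->.
have : (pi @` sn_dom LD) (pi d) by exists d => //; case: dd.
by rewrite dm.
Qed.

Lemma linked_pair (d : D) (c : R[i]) l :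
  sn_dom LD d -> LD d <= l -> rnorm d <= r * l -> 0 <= l ->
  lnk (c *: uA + piA d, c *: uB + piB d) <= l.
Proof.
move=> dd Ld nd l0; apply: link_le => //; exists d, c; split=> //.
have -> : (c *: uA + piA d, c *: uB + piB d) = c *: uE + p d :> E by [].
by rewrite addrAC addrK subrr rnorm0 mulr_ge0 // ltW.
Qed.

(** For a lift [d] of [a - muA a], the pair [(a, muA a + piB d)] is linked with no error at all, so
    that its seminorm exceeds [LA a] by no more than the slack of the lift. *)
Lemma tsn_isometry1 : quantum_isometry tsn LA (fst : E -> A).
Proof.
split; first by split=> [|a]; [split|exists (a, 0)].
move=> a da; apply/eqP; rewrite eq_le; apply/andP; split.
  by apply: le_ereal_inf_tmp => _ [x [_ <-] <-]; rewrite lee_fin tsn_ge1.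
apply/lee_addgt0Pr => e e0.
have L0 : 0 <= LA a by apply: sn_ge0; case: da.
have na := rnorm_center huA hmuA ncA qA L0 da (lexx _).
have [|||d [dd pd Ld nd]] := isometry_lift iA r0 (dom_sa_center muA huA ncA da) (k := LA a) (d := e).
- by rewrite ler_pdivrMl.
- by apply: sn_center => //; case: da.
- by [].
set c := (state_center muA a)%:C in pd.
have [[dB sB] LBd] := isometry_dom iB dd.
have [dc Lc] := sn_unit huB ncB c.
have Le0 : 0 <= LA a + e by rewrite addr_ge0 // ltW.
have xE : (a, c *: uB + piB d) = (c *: uA + piA d, c *: uB + piB d).
  by congr pair; rewrite pd addrC subrK.
apply: ge_ereal_inf; exists (tsn_val (a, c *: uB + piB d))%:E; last first.
  rewrite -EFinD lee_fin; apply: tsn_le => /=; first by rewrite lerDl ltW.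
    by apply: le_trans (snD dc dB) _; rewrite Lc add0r (le_trans LBd).
  by rewrite xE; apply: linked_pair => //; case: dd.
exists (a, c *: uB + piB d) => //; split=> //; case: da => da sa_.
split; first by split=> //=; exact: sn_domD.
by apply/csum_sa; split=> //=; apply: saD => //; apply: saZ; exact: sa_unit.
Qed.

Lemma tsn_isometry2 : quantum_isometry tsn LB (snd : E -> B).
Proof.
split; first by split=> [|b]; [split|exists (0, b)].
move=> b db; apply/eqP; rewrite eq_le; apply/andP; split.
  by apply: le_ereal_inf_tmp => _ [x [_ <-] <-]; rewrite lee_fin tsn_ge2.
apply/lee_addgt0Pr => e e0.
have L0 : 0 <= LB b by apply: sn_ge0; case: db.
have nb := rnorm_center huB hmuB ncB qB L0 db (lexx _).
have [|||d [dd pd Ld nd]] := isometry_lift iB r0 (dom_sa_center muB huB ncB db) (k := LB b) (d := e).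
- by rewrite ler_pdivrMl.
- by apply: sn_center => //; case: db.
- by [].
set c := (state_center muB b)%:C in pd.
have [[dA sA] LAd] := isometry_dom iA dd.
have [dc Lc] := sn_unit huA ncA c.
have Le0 : 0 <= LB b + e by rewrite addr_ge0 // ltW.
have xE : (c *: uA + piA d, b) = (c *: uA + piA d, c *: uB + piB d).
  by congr pair; rewrite pd addrC subrK.
apply: ge_ereal_inf; exists (tsn_val (c *: uA + piA d, b))%:E; last first.
  rewrite -EFinD lee_fin; apply: tsn_le => /=; last first.
  - by rewrite xE; apply: linked_pair => //; case: dd.
  - by rewrite lerDl ltW.
  - by apply: le_trans (snD dc dA) _; rewrite Lc add0r (le_trans LAd).
exists (c *: uA + piA d, b) => //; split=> //; case: db => db sb.
split; first by split=> //=; exact: sn_domD.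
by apply/csum_sa; split=> //=; apply: saD => //; apply: saZ; exact: sa_unit.
Qed.

Lemma tsn_diameter phi psi x : states E phi -> states E psi ->
  tsn_val x <= 1 -> rnorm (phi x - psi x) <= 8 * r.
Proof.
(* The link is an infimum, so that a decomposition is only available at scales above 1; scale 2
   gives [2 (2 eta + 2 r) <= 8 r]. *)
move=> sp sq x1; have [|d [t [_ _ nd hd]]] := @lnk_approx x 2.
  by apply: le_lt_trans (tsn_ge3 x) _; apply: le_lt_trans x1 _; rewrite ltr1n.
apply: le_trans (state_dist huE x t sp sq) _.
rewrite -(subrK (p d) (x - t *: uE)).
have h1 := rnormD (x - t *: uE - p d) (p d).
have h2 := star_morphism_contractive huE pm d.
have := eta1; have := r1; lra.
Qed.

Let jA (a : A) : E := (a, 0).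
Let jB (b : B) : E := (0, b).

Lemma jA_positive phi : positive_functional phi -> positive_functional (phi \o jA).
Proof.
move=> pp; split=> [c a b|a] /=.
  rewrite -(pfZ pp) -(pfD pp); congr phi; rewrite /jA; congr pair.
  by rewrite /= scaler0 addr0.
have := pp.2 (jA a); congr (0 <= phi _); congr pair; exact: cmul0r.
Qed.

Lemma jB_positive phi : positive_functional phi -> positive_functional (phi \o jB).
Proof.
move=> pp; split=> [c a b|a] /=.
  rewrite -(pfZ pp) -(pfD pp); congr phi; rewrite /jB; congr pair.
  by rewrite /= scaler0 addr0.
have := pp.2 (jB a); congr (0 <= phi _); congr pair; exact: cmul0r.
Qed.

Lemma state_split phi x : positive_functional phi -> phi x = phi (jA x.1) + phi (jB x.2).
Proof.
move=> pp; rewrite -(pfD pp); congr phi; case: x => a b.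
by rewrite /jA /jB; congr pair; rewrite /= ?addr0 ?add0r.
Qed.

Local Notation massA phi := (pf_mass uA (phi \o jA)).
Local Notation massB phi := (pf_mass uB (phi \o jB)).

Lemma mass_split phi : states E phi -> massB phi = 1 - massA phi.
Proof.
move=> /(statesP huE)[pp p1]; have := state_split uE pp; rewrite p1 /pf_mass /= => e.
have -> : phi (jB uB) = 1 - phi (jA uA) by rewrite e addrC addKr.
by case: (phi _) => a b.
Qed.

Lemma pullback_state1 chi : states A chi -> states E (chi \o fst).
Proof.
move=> /(statesP huA)[pp p1]; apply/(statesP huE); split=> //.
by split=> [c x y|x] /=; [rewrite (pfD pp) (pfZ pp)|exact: pp.2].
Qed.

Lemma pullback_state2 chi : states B chi -> states E (chi \o snd).
Proof.
move=> /(statesP huB)[pp p1]; apply/(statesP huE); split=> //.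
by split=> [c x y|x] /=; [rewrite (pfD pp) (pfZ pp)|exact: pp.2].
Qed.

(** A state is the mixture of its normalised marginals. Nearby states have nearby marginals, by the
    weak* hypotheses on [LA] and [LB], and nearby masses; moving a small mass between the summands
    is cheap because the diameter is finite. *)
Lemma tsn_weakstar : induces_weakstar (mk tsn).
Proof.
have [[_ [_ _ dns _ _] _ weakA] _] := hA; have [[_ _ _ weakB] _] := hB.
move=> phi sp U; split.
  by apply: (mk_ball_weakstar huE tsn_hermitian) => //; case: tsn_lipschitz.
move=> [e e0 hU].
have FF : Filter (nbhs (phi : {ptws E -> R[i]^o})) by exact: nbhs_filter.
have jA1 : rnorm (jA uA) <= 1.
  by apply: csum_rnorm_le; rewrite /= ?rnorm0 // rnorm_unit_le1.
have jB1 : rnorm (jB uB) <= 1.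
  by apply: csum_rnorm_le; rewrite /= ?rnorm0 // rnorm_unit_le1.
have [chA [scA chAE nearA]] :=
  marginal_near huA huE hmuA qA r1 weakA jA_positive jA1 sp.
have [chB [scB chBE nearB]] :=
  marginal_near huB huE hmuB qB r1 weakB jB_positive jB1 sp.
have e8 : 0 < e / 8 by rewrite divr_gt0.
(* A mass [e / (32 r)] moved over the diameter [8 r] costs [e / 4]; with [e / 8] for each marginal
   the total is [e / 2]. *)
have e32 : 0 < e / (32 * r) by rewrite divr_gt0 // mulr_gt0.
have nearU := evaluation_near phi (jA uA) e32.
have H := @filterI _ _ FF _ _ (@filterI _ _ FF _ _ (nearA _ e8) (nearB _ e8)) nearU.
suff : nbhs (phi : {ptws E -> R[i]^o}) [set psi | states E psi -> U psi] by [].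
apply: (@filterS _ _ FF _ _ _ H) => psi [[hpA hpB] hpU] sq.
apply: hU => //; apply: (@le_lt_trans _ _ (e / 2)%:E); last first.
  by rewrite lte_fin ltr_pdivrMr // ltr_pMr // ltr1n.
apply: mk_le; first by rewrite divr_ge0 // ltW.
move=> x [[d1 d2] /csum_sa[s1 s2]] x1.
have /(statesP huE)[pp _] := sp; have /(statesP huE)[pq _] := sq.
have gA := hpA sq x.1 (conj d1 s1) (le_trans (tsn_ge1 x) x1).
have gB := hpB sq x.2 (conj d2 s2) (le_trans (tsn_ge2 x) x1).
have gU : rnorm (phi (jA uA) - psi (jA uA)) <= e / (32 * r) := ltW hpU.
have mE f : states E f -> (massA f)%:C = f (jA uA).
  by move=> /(statesP huE)[pf _]; rewrite -(pf_unitE huA (jA_positive pf)).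
have gD := tsn_diameter (pullback_state1 scA) (pullback_state2 scB) x1.
rewrite /= in gD.
rewrite (state_split x pp) (state_split x pq) chAE chBE.
have mBE f : states E f -> (massB f)%:C = 1 - f (jA uA).
  by move=> sf; rewrite (mass_split sf) rmorphB rmorph1 /= mE.
rewrite !(mE _ sp) !(mBE _ sp); rewrite (mE _ sq) in gA; rewrite (mBE _ sq) in gB.
move: gA gB gU; move: (phi (jA uA) : R[i]) (psi (jA uA) : R[i]) => s s' gA gB gU.
have -> : s * chA x.1 + (1 - s) * chB x.2 - (psi (jA x.1) + psi (jB x.2)) =
    (s - s') * (chA x.1 - chB x.2) + - (psi (jA x.1) - s' * chA x.1) +
    - (psi (jB x.2) - (1 - s') * chB x.2) by ring.
apply: le_trans (crnormD _ _) _; rewrite crnormN.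
have h1 := crnormD ((s - s') * (chA x.1 - chB x.2)) (- (psi (jA x.1) - s' * chA x.1)).
rewrite crnormN crnormM in h1.
have h2 : rnorm (s - s') * rnorm (chA x.1 - chB x.2) <= e / 4.
  have -> : e / 4 = e / (32 * r) * (8 * r) by field; rewrite gt_eqF.
  by apply: ler_pM; rewrite ?crnorm_ge0.
lra.
Qed.

Lemma tsn_CD_qcms : CD_qcms tsn 2 (4 * r).
Proof.
split; last exact: tsn_CD_leibniz.
split; [by exists uE|exact: tsn_lipschitz| |exact: tsn_weakstar].
move=> phi psi sp sq; apply: (@le_lt_trans _ _ (8 * r)%:E); last exact: ltry.
apply: mk_le; first by rewrite mulr_ge0 // ltW.
by move=> x _; exact: tsn_diameter.
Qed.

Definition sum_tunnel : compact_tunnel 2 (4 * r) LA LB :=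
  CompactTunnel tsn_CD_qcms tsn_isometry1 tsn_isometry2.

(** The real part of a decomposition is again one; self-adjoint lifts are required because [mk] and
    [bl] test only those. *)
Lemma lnk_approx_sa x l : sa E x -> lnk x < l -> exists d (t : R),
  [/\ dom_sa LD d, LD d <= l, rnorm d <= r * l & rnorm (x - usc uE t - p d) <= eta * l].
Proof.
move=> sx /lnk_approx[d [t [dd Ld nd hd]]].
have [ds Ls] := sn_Repart herm dd.
exists (Repart d), (complex.Re t); split=> //.
- exact: le_trans Ls Ld.
- exact: le_trans (rnorm_Repart d) nd.
- have -> : x - usc uE (complex.Re t) - p (Repart d) = Repart (x - t *: uE - p d).
    rewrite !RepartD !RepartN (Repart_sa sx); congr (_ - _ - _).
      rewrite /Repart starZ (sa_unit huE) -scalerDl addcJ scalerA mulrA mulVf ?mul1r //.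
    by rewrite /Repart (smorZ pm) (smorD pm) (smorS pm).
  exact: le_trans (rnorm_Repart _) hd.
Qed.

(** The scalar [t] cancels between two states, and at scale 2 each of the two errors is at most
    [2 eta]. *)
Lemma state_gap phi psi x k : states B phi -> states A psi -> sa E x -> tsn_val x <= 1 ->
  (forall d, dom_sa LD d -> LD d <= 2 -> rnorm d <= r * 2 ->
     rnorm (phi (piB d) - psi (piA d)) <= k) ->
  rnorm (phi x.2 - psi x.1) <= 4 * eta + k.
Proof.
move=> sp sq sx x1 h; have [|d [t [dd Ld nd hd]]] := @lnk_approx_sa x 2 sx.
  by apply: le_lt_trans (tsn_ge3 x) _; apply: le_lt_trans x1 _; rewrite ltr1n.
have {}h := h d dd Ld nd.
have /(statesP huB)[pp p1] := sp; have /(statesP huA)[pq q1] := sq.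
pose z := x - usc uE t - p d.
have z1 : x.1 = z.1 + usc uA t + piA d by rewrite /z /= addrAC subrK subrK.
have z2 : x.2 = z.2 + usc uB t + piB d by rewrite /z /= addrAC subrK subrK.
have -> : phi x.2 - psi x.1 = phi z.2 + (phi (piB d) - psi (piA d)) + - psi z.1.
  rewrite z1 z2 !(pfD pp) !(pfD pq) (state_usc huB _ sp) (state_usc huA _ sq); ring.
have b1 := le_trans (state_bound huA z.1 sq) (le_trans (csum_rnorm1 z) hd).
have b2 := le_trans (state_bound huB z.2 sp) (le_trans (csum_rnorm2 z) hd).
apply: le_trans (crnormD _ _) _; rewrite crnormN.
have := crnormD (phi z.2) (phi (piB d) - psi (piA d)); lra.
Qed.

Section Extent.
Variable k : R.
Hypothesis transportA : forall phi, states B phi -> exists2 psi, states A psi &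
  forall (d : D) (l : R), 0 < l -> dom_sa LD d -> LD d <= l -> rnorm d <= r * l ->
    rnorm (phi (piB d) - psi (piA d)) <= k * l.
Hypothesis transportB : forall phi, states A phi -> exists2 psi, states B psi &
  forall (d : D) (l : R), 0 < l -> dom_sa LD d -> LD d <= l -> rnorm d <= r * l ->
    rnorm (phi (piA d) - psi (piB d)) <= k * l.
Hypothesis base_gap : (mk LD (muA \o piA) (muB \o piB) <= k%:E)%E.

Let k0 : 0 <= k.
Proof. by rewrite -lee_fin; apply: le_trans base_gap; exact: mk_ge0. Qed.

Let K := 4 * eta + k * 2.

Let K0 : 0 <= K.
Proof. by rewrite addr_ge0 // mulr_ge0 // ltW. Qed.

Lemma gap_left phi : states E phi -> exists2 psi, states A psi &
  (mk tsn phi (psi \o fst) <= K%:E)%E.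
Proof.
move=> sp; have /(statesP huE)[pp _] := sp.
have ms := mass_split sp.
have [|||psi sq h] := @mixed_state_transport _ _ _ uA uB (phi \o jA) (phi \o jB)
    (fun a b => dom_sa tsn (a, b) /\ tsn (a, b) <= 1) K huA huB
    (jA_positive pp) (jB_positive pp) _ _ K0.
- by rewrite ms opprB addrC subrK.
- by rewrite ms gerBl pf_mass_ge0 //; exact: jA_positive.
- move=> f sf; have [psi sq h] := transportA sf; exists psi => // a b [[_ sx] x1].
  by apply: (state_gap sf sq sx x1) => d dd Ld nd; apply: h.
exists psi => //; apply: mk_le => // -[a b] dx x1 /=.
by rewrite (state_split _ pp); exact: h.
Qed.

Lemma gap_right phi : states E phi -> exists2 psi, states B psi &
  (mk tsn phi (psi \o snd) <= K%:E)%E.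
Proof.
move=> sp; have /(statesP huE)[pp _] := sp.
have ms := mass_split sp.
have [||psi sq h] := @mixed_state_transport _ _ _ uB uA (phi \o jB) (phi \o jA)
    (fun b a => dom_sa tsn (a, b) /\ tsn (a, b) <= 1) K huB huA
    (jB_positive pp) (jA_positive pp) ms _ K0.
- have := pf_mass_ge0 huB (jB_positive pp); rewrite ms; lra.
- move=> f sf; have [psi sq h] := transportB sf; exists psi => // b a [[_ sx] x1].
  rewrite -crnormN opprB; apply: (state_gap sq sf sx x1) => d dd Ld nd.
  by rewrite -crnormN opprB; apply: h.
exists psi => //; apply: mk_le => // -[a b] dx x1 /=.
by rewrite (state_split _ pp) [phi (jA _) + _]addrC; exact: h.
Qed.

Lemma mk_diag (C : cstarAlgType R) (LC : seminorm C) phi : (mk LC phi phi <= 0%:E)%E.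
Proof. by apply: mk_le => // a _ _; rewrite subrr crnorm0. Qed.

Lemma sum_tunnel_extent : (pointed_extent muA muB sum_tunnel <= K%:E)%E.
Proof.
rewrite /pointed_extent /hausdorff_distance /= !ge_max; apply/andP; split; last first.
  apply: mk_le => // x [_ sx] x1; rewrite -crnormN opprB.
  apply: (state_gap hmuB hmuA sx x1) => d dd Ld nd.
  rewrite -crnormN opprB.
  have [pA _] := pullback_quasi_state huA piAm hmuA.
  have [pB _] := pullback_quasi_state huB piBm hmuB.
  exact: (mk_lt_dist pA pB base_gap).
apply/andP; split; apply/andP; split; apply: nnsup_le; rewrite ?lee_fin //.
- move=> _ [phi sp <-]; have [psi sq h] := gap_left sp.
  by apply: ge_ereal_inf; exists (mk tsn phi (psi \o fst)) => //; exists (psi \o fst) => //; exists psi.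
(* A pulled-back state is itself a state of [E], so that this half of the Hausdorff distance
   vanishes. *)
- move=> _ [_ [psi sq <-] <-].
  apply: ge_ereal_inf; exists (mk tsn (psi \o fst) (psi \o fst)).
    by exists (psi \o fst) => //; exact: pullback_state1.
  by apply: le_trans (mk_diag _ _) _; rewrite lee_fin.
- move=> _ [phi sp <-]; have [psi sq h] := gap_right sp.
  by apply: ge_ereal_inf; exists (mk tsn phi (psi \o snd)) => //; exists (psi \o snd) => //; exists psi.
- move=> _ [_ [psi sq <-] <-].
  apply: ge_ereal_inf; exists (mk tsn (psi \o snd) (psi \o snd)).
    by exists (psi \o snd) => //; exact: pullback_state2.
  by apply: le_trans (mk_diag _ _) _; rewrite lee_fin.
Qed.

Lemma sum_tunnel_propinquity :
  (pointed_propinquity 2 (4 * r) LA muA LB muB <= K%:E)%E.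
Proof.
apply: ge_ereal_inf; exists (pointed_extent muA muB sum_tunnel); last exact: sum_tunnel_extent.
by exists sum_tunnel.
Qed.

End Extent.

End TunnelSeminorm.

(** * From the metametric to the propinquity *)

Lemma propinquity_of_tunnel (R : realType) (A B : cstarAlgType R)
    (LA : seminorm A) (LB : seminorm B) (MA : set A) (MB : set B)
    (muA : A -> R[i]) (muB : B -> R[i]) (r eps : R) (t : tunnel LA MA muA LB MB r) :
  qcms LA -> qcms LB -> states A muA -> states B muB ->
  (qdiam LA < r%:E)%E -> (qdiam LB < r%:E)%E -> 1 <= r -> 0 < eps -> eps <= 1 / 20 ->
  (extent muB t < eps%:E)%E ->
  (pointed_propinquity 2 (4 * r) LA muA LB muB <= (28 * r * eps)%:E)%E.
Proof.
move=> hA hB hmuA hmuB qA qB r1 eps0 eps1.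
have [[[uA huA] [_ ncA _ _ _] _ _] _] := hA.
have [[[uB huB] [_ ncB _ _ _] _ _] _] := hB.
case: t => D LD MD piA piB e hD de he isoA isoB hp.
have [[_ [herm _ _ _ _] leib _ _] _] := hD.
have [iA _ _] := isoA; have [iB _ _] := isoB.
rewrite /extent /= !gt_max => /andP[/andP[hinf hmk]].
rewrite lte_fin !gt_max => /andP[hLe /andP[hmA hmB]].
have [_ [e1 [e10 aA aB] <-]] := ereal_inf_lt hinf; rewrite lte_fin => e1eps.
have r0 : 0 < r := lt_le_trans ltr01 r1.
have tA := state_transport huA huB hmuB ncB r1 qB iA iB eps0 eps1 e1eps de (ltW hLe) (ltW hmB) aA.
have tB := state_transport huB huA hmuA ncA r1 qA iB iA eps0 eps1 e1eps de (ltW hLe) (ltW hmA) aB.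
have reps : eps <= r * eps by rewrite ler_peMl // ltW.
have base : (mk LD (muA \o piA) (muB \o piB) <= (12 * r * eps)%:E)%E.
  by apply: le_trans (ltW hmk) _; rewrite lee_fin; lra.
have eps_le1 : eps <= 1 by lra.
(* Here [eta] is [eps] and [k] is [12 r eps], so that the bound is
   [4 eps + 24 r eps <= 28 r eps]. *)
apply: le_trans (sum_tunnel_propinquity hA hB hmuA hmuB huA huB qA qB herm leib iA iB
  r1 eps0 eps_le1 tA tB base) _.
by rewrite lee_fin; lra.
Qed.

Lemma propinquity_ge0 (R : realType) (C D : R) (A B : cstarAlgType R)
    (LA : seminorm A) (LB : seminorm B) (muA : A -> R[i]) (muB : B -> R[i]) :
  (0 <= pointed_propinquity C D LA muA LB muB)%E.
Proof.
apply: le_ereal_inf_tmp => _ [t ->].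
by rewrite /pointed_extent le_max mk_ge0 orbT.
Qed.

Lemma cvge0_near (R : realType) (x : nat -> \bar R) : (forall n, (0 <= x n)%E) ->
  (x n @[n --> \oo] --> 0%E <->
   forall e : R, 0 < e -> \forall n \near \oo, (x n < e%:E)%E).
Proof.
move=> x0; split=> [cx e e0|h U].
  have : nbhs (0%:E : \bar R) [set y : \bar R | (y < e%:E)%E].
    by apply: (@nbhs_open_ereal_lt R 0 (fun=> e)).
  exact: cx.
rewrite /nbhs /= => -[e e0 eU].
apply: filterS (h _ e0) => n /= xe; have := x0 n; case: (x n) xe => [y|//|//].
rewrite lte_fin lee_fin => ye y0; apply: eU.
by rewrite /ball_ /= sub0r normrN ger0_norm.
Qed.

(** As [exp (- x)] decreases on [[0, +oo]], its value at any diameter at least [r], infinite ones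
    included, differs from the value at [q = qdiam LB] by at least [exp (- q) - exp (- r) > 0]. *)
Lemma qdiam_lt_of_close (R : realType) (B : cstarAlgType R) (LB : seminorm B) (r : R) :
  (qdiam LB < r%:E)%E ->
  exists2 d : R, 0 < d & forall C (LC : @seminorm R C),
    (`|expeR (- qdiam LC) - expeR (- qdiam LB)| < d%:E)%E -> (qdiam LC < r%:E)%E.
Proof.
have : (0 <= qdiam LB)%E by exact: nnsup_ge0.
case: (qdiam LB) => [q|//|//]; rewrite lee_fin lte_fin => q0 qr.
exists (expR (- q) - expR (- r)); first by rewrite subr_gt0 ltr_expR ltrN2.
move=> C LC h; rewrite ltNge; apply/negP => rC; move: h.
have : (0 <= qdiam LC)%E by exact: nnsup_ge0.
have er := expR_gt0 (- r).
case: (qdiam LC) rC => [s|_|//] /=.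
  rewrite !lee_fin => rs _; rewrite lte_fin ltNge => /negP; apply.
  have : expR (- s) <= expR (- r) by rewrite ler_expR lerN2.
  by rewrite distrC; have := ler_norm (expR (- q) - expR (- s)); lra.
by move=> _; rewrite lte_fin sub0r normrN ger0_norm ?expR_ge0 //; lra.
Qed.

Theorem corollary5p16 (R : realType)
  (A : nat -> cstarAlgType R) (L : forall n : nat, seminorm (A n))
  (MM : forall n : nat, set (A n)) (mu : forall n : nat, A n -> R[i])
  (Ainf : cstarAlgType R) (Linf : seminorm Ainf)
  (MMinf : set Ainf) (muinf : Ainf -> R[i])
  (hcompact : forall n : nat, qcms (L n) /\ states (A n) (mu n))
  (hcompactinf : qcms Linf /\ states Ainf muinf)
  (hproper : forall n : nat, pointed_proper (L n) (MM n) (mu n))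
  (hproperinf : pointed_proper Linf MMinf muinf)
  (hD : metametric (L n) (MM n) (mu n) Linf MMinf muinf @[n --> \oo] --> 0%E)
  (r : R) (hr1 : 1 <= r) (hr : (qdiam Linf < r%:E)%E) :
  pointed_propinquity 2 (4 * r) (L n) (mu n) Linf muinf @[n --> \oo] --> 0%E.
Proof.
have r0 : 0 < r := lt_le_trans ltr01 hr1.
have metametric_ge0 n : (0 <= metametric (L n) (MM n) (mu n) Linf MMinf muinf)%E.
  by rewrite /metametric le_max abse_ge0 orbT.
have hD0 := (cvge0_near metametric_ge0).1 hD.
apply/cvge0_near => [n|e e0]; first exact: propinquity_ge0.
have [d d0 hd] := qdiam_lt_of_close hr.
(* [1 / 20] serves the transport of states, [r^-1] places [r] in the range of scales seen by the
   metametric, [d] transfers the bound on the diameter to [L n], and [e / (56 r)] makes [28 r eps]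
   at most [e / 2]. *)
pose eps := Num.min (Num.min (1 / 20) r^-1) (Num.min d (e / (56 * r))).
have eps0 : 0 < eps.
  by rewrite !lt_min d0 invr_gt0 r0 !divr_gt0 ?mulr_gt0.
have eps20 : eps <= 1 / 20 by rewrite !ge_min lexx.
have epsr : eps <= r^-1 by rewrite !ge_min lexx !orbT.
have epsd : eps <= d by rewrite !ge_min lexx !orbT.
have epse : eps <= e / (56 * r) by rewrite !ge_min lexx !orbT.
apply: filterS (hD0 _ eps0) => n.
rewrite /metametric gt_max => /andP[hloc hq].
have qn : (qdiam (L n) < r%:E)%E.
  by apply: hd; apply: lt_le_trans hq _; rewrite lee_fin.
have [_ [e1 [e10 hsup] <-]] := ereal_inf_lt hloc; rewrite lte_fin => e1eps.
have hlr : (local_metametric (L n) (MM n) (mu n) Linf MMinf muinf r < eps%:E)%E.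
  apply: le_lt_trans (lt_trans hsup _); last by rewrite lte_fin.
  apply: nnsup_ubound; exists r => //=; rewrite hr1 /=.
  rewrite -[r]invrK lef_pV2 ?posrE ?invr_gt0 //.
  exact: le_trans (ltW e1eps) epsr.
have [_ [t ->] ht] := ereal_inf_lt hlr.
have [qcn sn] := hcompact n; have [qci si] := hcompactinf.
apply: le_lt_trans (propinquity_of_tunnel qcn qci sn si qn hr hr1 eps0 eps20 ht) _.
rewrite lte_fin; apply: (@le_lt_trans _ _ (e / 2)).
  have -> : e / 2 = 28 * r * (e / (56 * r)) by field; rewrite gt_eqF.
  by rewrite ler_wpM2l // mulr_ge0 // ltW.
by rewrite ltr_pdivrMr // ltr_pMr // ltr1n.
Qed.
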